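(* Let $\mathcal{A}$ be a set of abducible predicates and $R$ a fixed Horn program (possibly recursive) with no abducible predicate in the head of any of its rules. Then: (1) the problem, given a set $B$ of abducibles, an observation $O$, and a pair $(E,F)$ of sets of abducibles, of deciding whether $(E,F)$ is a constrained explanation for $O$ wrt $\langle R\cup B,\mathcal{A},\emptyset\rangle$ is coNP-complete; (2) the problem, given a set $B$ of abducibles and an observation $O$, of deciding whether a constrained explanation for $O$ wrt $\langle R\cup B,\mathcal{A},\emptyset\rangle$ exists is $\Sigma_2^P$-complete.
   Context: Vocabulary $\sigma$: relation and constant symbols, no function symbols, countably infinite set of constants. A Horn program has no negation; its semantics is its least Herbrand model (its unique stable model). Abducibles: ground atoms whose predicate is in $\mathcal{A}$; $B$ is a finite set of abducibles. An observation is a finite set of ground atoms with non-abducible predicates. With $P=R\cup B$ and no integrity constraints, an explanation of $O$ wrt $\langle P,\mathcal{A},\emptyset\rangle$ is a pair $(E,F)$ of disjoint finite sets of abducibles with $F\subseteq P$ such that the least model of $(P\cup E)\setminus F$ contains $O$. Occurrence of a constant $c$ in a set $E$ of ground atoms: a pair (atom $p(x)\in E$, position $k$) with $c$ the $k$-th argument of $p(x)$. For a nonempty set $C$ of occurrences of $c$ in $E$, the replacement function $f_{E,C}$ maps a constant $x$ to the set obtained from $E$ by replacing $c$ with $x$ at each occurrence in $C$. $f_{E,C_1}$ (for $c_1$) and $f_{E,C_2}$ (for $c_2$) are independent if $c_1\neq c_2$ or $C_1\cap C_2=\emptyset$. For an explanation $\Delta=(E,F)$ and a constant $\xi$ not occurring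 in $E\cup O\cup P$, the degree of arbitrariness $\delta(\Delta)$ is the maximum number of pairwise independent replacement functions $f_{E,C}$ such that $(f_{E,C}(\xi),F)$ is an explanation of $O$. $\Delta$ is constrained if $\delta(\Delta)=0$. Complexity is measured in the input size with $R$ fixed. *)

(* Defs.v *)
From mathcomp Require Import all_boot all_order all_algebra.
From mathcomp Require Import finmap.

Set Implicit Arguments.
Unset Strict Implicit.
Unset Printing Implicit Defensive.

(** Deterministic Turing machines with [ntapes.+1] two-way infinite tapes.  A
    cell holds a blank ([None]), an input bit or a symbol of [work]. *)

Definition cell (W : Type) : Type := option (bool + W).

Inductive move := MoveLeft | Stay | MoveRight.

Record TM := {
  ntapes : nat;
  state : finType;
  work : finType;
  start : state;
  halting : pred state;
  trans : state -> {ffun 'I_ntapes.+1 -> cell work} ->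
          state * {ffun 'I_ntapes.+1 -> cell work * move} }.

(** The cells to the left of the head (nearest first), the scanned cell and the
    cells to the right of the head; all other cells are blank. *)
Record tape (W : Type) := Tape {
  lcells : seq (cell W);
  scanned : cell W;
  rcells : seq (cell W) }.

Definition uncons (W : Type) (s : seq (cell W)) : cell W * seq (cell W) :=
  if s is x :: s' then (x, s') else (None, [::]).

Definition act (W : Type) (t : tape W) (a : cell W * move) : tape W :=
  match a.2 with
  | MoveLeft =>
      Tape (uncons (lcells t)).2 (uncons (lcells t)).1 (a.1 :: rcells t)
  | Stay => Tape (lcells t) a.1 (rcells t)
  | MoveRight =>
      Tape (a.1 :: lcells t) (uncons (rcells t)).1 (uncons (rcells t)).2
  end.

Definition config (M : TM) : Type :=
  (state M * {ffun 'I_(ntapes M).+1 -> tape (work M)})%type.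

Definition step (M : TM) (c : config M) : config M :=
  if halting c.1 then c else
  let qa := trans c.1 [ffun i => scanned (c.2 i)] in
  (qa.1, [ffun i => act (c.2 i) (qa.2 i)]).

Definition input_tape (W : Type) (x : seq bool) : tape W :=
  let u := uncons [seq Some (inl b) | b <- x] in Tape [::] u.1 u.2.

Definition initial (M : TM) (x : seq bool) : config M :=
  (start M, [ffun i => input_tape (work M) (if i == ord0 then x else [::])]).

Fixpoint leading_bits (W : Type) (s : seq (cell W)) : seq bool :=
  if s is Some (inl b) :: s' then b :: leading_bits s' else [::].

(** The output is the longest bit string that starts at the head of tape 0. *)
Definition output (M : TM) (c : config M) : seq bool :=
  leading_bits (scanned (c.2 ord0) :: rcells (c.2 ord0)).

Definition polytime (f : seq bool -> seq bool) : Prop :=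
  exists (M : TM) (p : {poly nat}), forall x : seq bool,
    let c := iter (p.[size x])%R (@step M) (initial M x) in
    halting c.1 /\ output c = f x.

Definition language : Type := seq bool -> Prop.

Definition compl (L : language) : language := fun x => ~ L x.

Definition inP (L : language) : Prop :=
  exists2 f : seq bool -> seq bool, polytime f &
    forall x, L x <-> f x = [:: true].

(** Prefix-free codes: [true] announces a further item, [false] ends. *)
Definition enc_seq (T : Type) (enc : T -> seq bool) (s : seq T) : seq bool :=
  flatten [seq true :: enc x | x <- s] ++ [:: false].

Definition enc_word (w : seq bool) : seq bool := enc_seq (fun b => [:: b]) w.

Definition enc_pair (x y : seq bool) : seq bool := enc_word x ++ y.

(** The class of [L'] is the k'-th Pi class; [SigmaP 1] is NP. *)
Fixpoint SigmaP (k : nat) (L : language) : Prop :=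
  if k is k'.+1 then
    exists (L' : language) (p : {poly nat}),
      SigmaP k' (compl L') /\
      forall x, L x <->
        exists y, size y <= (p.[size x])%R /\ L' (enc_pair x y)
  else inP L.

Definition coNP (L : language) : Prop := SigmaP 1 (compl L).

Definition Sigma2P (L : language) : Prop := SigmaP 2 L.

Definition reducible (L1 L2 : language) : Prop :=
  exists2 f : seq bool -> seq bool, polytime f & forall x, L1 x <-> L2 (f x).

Definition complete (C : language -> Prop) (L : language) : Prop :=
  C L /\ forall L', C L' -> reducible L' L.

(** Constant symbols are named by bit strings, so that they form a countably
    infinite set and have a definite length when written in an input. *)
Definition const : Type := seq bool.

(** [inl] is a variable, [inr] a constant. *)
Definition term : Type := (nat + const)%type.

Definition gatom (Rel : finType) (ar : Rel -> nat) : Type :=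
  {p : Rel & (ar p).-tuple const}.

Definition atom (Rel : finType) (ar : Rel -> nat) : Type :=
  {p : Rel & (ar p).-tuple term}.

(** Head and body. *)
Definition rule (Rel : finType) (ar : Rel -> nat) : Type :=
  (atom ar * seq (atom ar))%type.

Definition program (Rel : finType) (ar : Rel -> nat) : Type := {fset rule ar}.

Section Abduction.

Variables (Rel : finType) (ar : Rel -> nat).

Implicit Types (a : gatom ar) (P R : {fset rule ar}) (A : {set Rel}).
Implicit Types (B O E F : {fset gatom ar}).

Definition instantiate (v : nat -> const) (b : atom ar) : gatom ar :=
  Tagged (fun p => (ar p).-tuple const)
    (map_tuple (fun t : term => match t with inl x => v x | inr c => c end)
       (tagged b)).

Definition fact a : rule ar :=
  (Tagged (fun p => (ar p).-tuple term)
     (map_tuple (fun c : const => inr c : term) (tagged a)), [::]).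

Definition facts E : {fset rule ar} := [fset fact a | a in E]%fset.

Definition herbrand_model P (M : gatom ar -> Prop) : Prop :=
  forall r, r \in P -> forall v : nat -> const,
    (forall b, b \in r.2 -> M (instantiate v b)) -> M (instantiate v r.1).

Definition least_model P : gatom ar -> Prop :=
  fun a => forall M, herbrand_model P M -> M a.

Definition no_abducible_head A R : Prop :=
  forall r, r \in R -> tag r.1 \notin A.

Definition abducibles A E : Prop := forall a, a \in E -> tag a \in A.

Definition observation A O : Prop := forall a, a \in O -> tag a \notin A.

Definition explanation A P O E F : Prop :=
  [/\ abducibles A E, abducibles A F, [disjoint E & F]%fset,
      (facts F `<=` P)%fset &
      forall a, a \in O ->
        least_model ((P `|` facts E) `\` facts F)%fset a].

(** An occurrence: an atom and a position, counted from 0. *)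
Definition occ : Type := (gatom ar * nat)%type.

Definition occurs_at E (c : const) (o : occ) : bool :=
  (o.1 \in E) && (onth (tagged o.1) o.2 == Some c).

(** The pair [(c, C)] stands for the replacement function f_{E,C}; distinct
    pairs give distinct functions, as their values at a fresh constant differ. *)
Definition replacement E (c : const) (C : {fset occ}) : Prop :=
  C != fset0 /\ forall o, o \in C -> occurs_at E c o.

Definition replace_atom (C : {fset occ}) (x : const) a : gatom ar :=
  Tagged (fun p => (ar p).-tuple const)
    [tuple if ((a, val i) : occ) \in C then x else tnth (tagged a) i
       | i < ar (tag a)].

Definition replace E (C : {fset occ}) (x : const) : {fset gatom ar} :=
  [fset replace_atom C x a | a in E]%fset.

Definition independent (r1 r2 : const * {fset occ}) : bool :=
  (r1.1 != r2.1) || [disjoint r1.2 & r2.2]%fset.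

Definition fresh P O E (xi : const) : Prop :=
  (forall a, a \in (E `|` O)%fset -> xi \notin tagged a) /\
  (forall r, r \in P -> forall b, b \in r.1 :: r.2 ->
     (inr xi : term) \notin tagged b).

Definition arbitrary_family A P O E F (xi : const)
    (S : {fset const * {fset occ}}) : Prop :=
  (forall r, r \in S ->
     replacement E r.1 r.2 /\ explanation A P O (replace E r.2 xi) F) /\
  (forall r1 r2, r1 \in S -> r2 \in S -> r1 != r2 -> independent r1 r2).

(** The degree of arbitrariness of [(E, F)], computed with [xi], is [d]. *)
Definition is_degree A P O E F (xi : const) (d : nat) : Prop :=
  (exists2 S, arbitrary_family A P O E F xi S & #|` S|%fset = d) /\
  (forall S, arbitrary_family A P O E F xi S -> #|` S|%fset <= d).

Definition constrained_explanation A P O E F : Prop :=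
  explanation A P O E F /\
  forall xi, fresh P O E xi -> is_degree A P O E F xi 0.

Definition enc_gatom a : seq bool :=
  nseq (enum_rank (tag a)) true ++ false :: enc_seq enc_word (tagged a).

Definition enc_gatoms (s : seq (gatom ar)) : seq bool := enc_seq enc_gatom s.

Definition set_of (s : seq (gatom ar)) : {fset gatom ar} := [fset a in s]%fset.

(** An input presents each of its sets as a list, in any order and possibly
    with repetitions.  [Rel], [ar], [A] and [R] are not part of the input, so that
    complexity is data complexity: an upper bound is claimed for every such
    choice, hardness for some choice. *)
Definition constrained_recognition A R : language := fun w =>
  exists b o e f : seq (gatom ar),
    [/\ w = enc_gatoms b ++ enc_gatoms o ++ enc_gatoms e ++ enc_gatoms f,
        abducibles A (set_of b), observation A (set_of o),
        abducibles A (set_of e) /\ abducibles A (set_of f) &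
        constrained_explanation A (R `|` facts (set_of b))%fset
          (set_of o) (set_of e) (set_of f)].

Definition constrained_existence A R : language := fun w =>
  exists b o : seq (gatom ar),
    [/\ w = enc_gatoms b ++ enc_gatoms o,
        abducibles A (set_of b), observation A (set_of o) &
        exists E F, constrained_explanation A (R `|` facts (set_of b))%fset
          (set_of o) E F].

End Abduction.

(* Main.v *)
(** Polynomial time is handled through programs over four stacks that work above
    arbitrary stack contents, so that polynomial-time functions on coded data
    compose freely; they are compiled to Turing machines, and conversely an
    arbitrary Turing machine is simulated by such a function.

    Upper bounds.  The least model restricted to the constants of the input is
    computed by saturation.  A constrained explanation contains no constant foreign
    to B, O and R, since all the occurrences of such a constant could be replaced at
    once; hence it has polynomial size.  The degree does not depend on the fresh
    constant, so that a set of occurrences is an NP certificate against being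
    constrained.

    Lower bounds.  A run of a stack machine is described by propositional Horn
    clauses, every push allocating a new heap cell, plus the choice of the unknown
    input bits.  A fixed non-recursive program turns "some replacement of E is still
    an explanation" into the satisfiability of these clauses: [s(k0)] and [e(v, k0)]
    make every variable both true and false, and replacing [k0] in [s] and in some
    of the [e(v, k0)] leaves exactly one value for each variable.  Existential
    variables are fixed by the choice of E itself. *)
Require Import Defs.
From HB Require Import structures.
From mathcomp Require Import all_boot all_order all_algebra.
From mathcomp Require Import finmap zify.
From Stdlib Require Import Classical_Prop.

Set Implicit Arguments.
Unset Strict Implicit.
Unset Printing Implicit Defensive.

(** * A language of four stacks *)

(** Stacks are preferred to tapes because a tape cell is overwritten, whereas a heap only grows:
    each instruction then yields implications only, and no clause has to say that a stack has a
    single content. The complexity classes are defined through Turing machines, so the verifier of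
    an arbitrary language has to become a stack program before it can be described by clauses.

    As the program is fixed, the clauses cannot be rules; they are atoms of the observation, with
    three negative and two positive slots each. The obstacle is that the candidate must itself be an
    explanation, so every clause has to hold before any replacement. This is why variables start
    with both values and why each clause must contain a variable that is not existential. The atoms
    [pVal] of the observation then discipline the replacements: touching the name of a variable, or
    moving its [k0] in [e] without moving the one in [s], loses an atom. Since some occurrence is
    replaced, the one in [s(k0)] is, and an assignment results. The hard instances have empty [B],
    which forces [F] to be empty. *)

Inductive reg := R0 | R1 | R2 | R3.

(** [R0] and [R1] hold data; [R2] and [R3] are scratch space for moving codes. *)
Record store := St { st0 : seq bool; st1 : seq bool; st2 : seq bool; st3 : seq bool }.

Definition get (s : store) (r : reg) : seq bool :=
  match r with R0 => st0 s | R1 => st1 s | R2 => st2 s | R3 => st3 s end.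

Definition set (s : store) (r : reg) (v : seq bool) : store :=
  match r with
  | R0 => St v (st1 s) (st2 s) (st3 s)
  | R1 => St (st0 s) v (st2 s) (st3 s)
  | R2 => St (st0 s) (st1 s) v (st3 s)
  | R3 => St (st0 s) (st1 s) (st2 s) v
  end.

Inductive cmd :=
| Skip
| Push of reg & bool
| Pop of reg
| Seq of cmd & cmd
| If of reg & (option bool -> bool) & cmd & cmd
| While of reg & (option bool -> bool) & cmd.

Notation "c1 ;; c2" := (Seq c1 c2) (at level 60, right associativity).

Inductive exec : cmd -> store -> nat -> store -> Prop :=
| ExSkip s : exec Skip s 0 s
| ExPush r b s : exec (Push r b) s 1 (set s r (b :: get s r))
| ExPop r s : exec (Pop r) s 1 (set s r (behead (get s r)))
| ExSeq c1 c2 s t1 s' t2 s'' :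
    exec c1 s t1 s' -> exec c2 s' t2 s'' -> exec (c1 ;; c2) s (t1 + t2) s''
| ExIfT r (p : option bool -> bool) c1 c2 s t s' :
    p (ohead (get s r)) -> exec c1 s t s' -> exec (If r p c1 c2) s t.+1 s'
| ExIfF r (p : option bool -> bool) c1 c2 s t s' :
    ~~ p (ohead (get s r)) -> exec c2 s t s' -> exec (If r p c1 c2) s t.+1 s'
| ExWhileT r (p : option bool -> bool) c s t1 s' t2 s'' :
    p (ohead (get s r)) -> exec c s t1 s' -> exec (While r p c) s' t2 s'' ->
    exec (While r p c) s (t1 + t2).+1 s''
| ExWhileF r (p : option bool -> bool) c s : ~~ p (ohead (get s r)) -> exec (While r p c) s 1 s.

(** An upper bound on the time instead of the exact time, so that estimates can be weakened at every
    composition. *)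
Definition runs c s n s' := exists2 t, t <= n & exec c s t s'.

Lemma runs_le c s n m s' : runs c s n s' -> n <= m -> runs c s m s'.
Proof. by case=> t tn e nm; exists t => //; apply: leq_trans nm. Qed.

Lemma runs_skip s : runs Skip s 0 s.
Proof. by exists 0 => //; constructor. Qed.

Lemma runs_push r b s : runs (Push r b) s 1 (set s r (b :: get s r)).
Proof. by exists 1 => //; constructor. Qed.

Lemma runs_pop r s : runs (Pop r) s 1 (set s r (behead (get s r))).
Proof. by exists 1 => //; constructor. Qed.

Lemma runs_seq c1 c2 s n1 s' n2 s'' :
  runs c1 s n1 s' -> runs c2 s' n2 s'' -> runs (c1 ;; c2) s (n1 + n2) s''.
Proof.
by move=> [t1 l1 e1] [t2 l2 e2]; exists (t1 + t2); [apply: leq_add | econstructor; eauto].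
Qed.

Lemma runs_ifT r (p : option bool -> bool) c1 c2 s n s' :
  p (ohead (get s r)) -> runs c1 s n s' -> runs (If r p c1 c2) s n.+1 s'.
Proof. by move=> h [t l e]; exists t.+1 => //; apply: ExIfT. Qed.

Lemma runs_ifF r (p : option bool -> bool) c1 c2 s n s' :
  ~~ p (ohead (get s r)) -> runs c2 s n s' -> runs (If r p c1 c2) s n.+1 s'.
Proof. by move=> h [t l e]; exists t.+1 => //; apply: ExIfF. Qed.

Lemma runs_whileT r (p : option bool -> bool) c s n1 s' n2 s'' :
  p (ohead (get s r)) -> runs c s n1 s' -> runs (While r p c) s' n2 s'' ->
  runs (While r p c) s (n1 + n2).+1 s''.
Proof.
move=> h [t1 l1 e1] [t2 l2 e2]; exists (t1 + t2).+1.
  by rewrite ltnS; apply: leq_add.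
by apply: ExWhileT e2.
Qed.

Lemma runs_whileF r (p : option bool -> bool) c s : ~~ p (ohead (get s r)) -> runs (While r p c) s 1 s.
Proof. by move=> h; exists 1 => //; apply: ExWhileF. Qed.

Definition store_size s := size (st0 s) + size (st1 s) + size (st2 s) + size (st3 s).

(** Each unit of time adds at most one bit. A time bound therefore also bounds the size of the
    computed value, which is what composition needs. *)
Lemma runs_size c s n s' : runs c s n s' -> store_size s' <= store_size s + n.
Proof.
case=> t tn e; apply: leq_trans (leq_add (leqnn _) tn) => {n tn}.
elim: e => {c s t s'}.
- by move=> s; rewrite addn0.
- by case=> b s; rewrite /store_size /=; lia.
- by case=> s; rewrite /store_size /= size_behead; lia.
- by move=> c1 c2 s t1 s' t2 s'' _ h1 _ h2; lia.
- by move=> r p c1 c2 s t s' _ _ h; lia.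
- by move=> r p c1 c2 s t s' _ _ h; lia.
- by move=> r p c s t1 s' t2 s'' _ _ h1 _ h2; lia.
- by move=> r p c s _; lia.
Qed.

Definition istrue (o : option bool) := if o is Some true then true else false.
Definition isbit (o : option bool) := if o is Some _ then true else false.

Ltac xstep :=
  first [ eapply runs_push | eapply runs_pop | eapply runs_skip
        | (eapply runs_seq; [ xstep | cbn [get set st0 st1 st2 st3 behead ohead istrue isbit] ]) 
        | (eapply runs_ifT; [ reflexivity | xstep ])
        | (eapply runs_ifF; [ reflexivity | xstep ]) ].

(** * Polynomial bounds *)

(** The base is at least 2, so sums and constants are absorbed by a larger exponent, and the bound
    is monotone in [n], as is required when one bound is substituted in another. *)
Definition pb (f : nat -> nat) := exists k, forall n, f n <= (n + 2) ^ k.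

Lemma pb_le f g : (forall n, f n <= g n) -> pb g -> pb f.
Proof. by move=> h [k hk]; exists k => n; apply: leq_trans (h n) (hk n). Qed.

Lemma pow_mono k n m : n <= m -> (n + 2) ^ k <= (m + 2) ^ k.
Proof. by case: k => [|k] h //; rewrite leq_exp2r // leq_add2r. Qed.

Lemma pow_inc k l n : k <= l -> (n + 2) ^ k <= (n + 2) ^ l.
Proof. by move=> h; apply: leq_pexp2l => //; rewrite addn2. Qed.

Lemma pb_const c : pb (fun=> c).
Proof.
exists c => n; apply: leq_trans (ltnW (ltn_expl c (ltnSn 1))) _.
by have := @pow_mono c 0 n (leq0n _).
Qed.

Lemma pb_id : pb (fun n => n).
Proof. by exists 1 => n; rewrite expn1 leq_addr. Qed.

Lemma pb_add f g : pb f -> pb g -> pb (fun n => f n + g n).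
Proof.
move=> [a ha] [b hb]; exists (a + b).+1 => n.
have h1 := leq_trans (ha n) (pow_inc n (leq_addr b a)).
have h2 := leq_trans (hb n) (pow_inc n (leq_addl a b)).
rewrite expnS; apply: leq_trans (leq_add h1 h2) _.
by rewrite addnn -mul2n leq_mul2r addn2 orbT.
Qed.

Lemma pb_mul f g : pb f -> pb g -> pb (fun n => f n * g n).
Proof.
by move=> [a ha] [b hb]; exists (a + b) => n; rewrite expnD; apply: leq_mul.
Qed.

Lemma pb_exp f k : pb f -> pb (fun n => f n ^ k).
Proof.
elim: k => [|k IH] hf; first exact: (pb_const 1).
by apply: pb_le (pb_mul hf (IH hf)) => n; rewrite expnS.
Qed.

Ltac pbs := repeat first
  [ exact: pb_id | exact: pb_const | assumption | apply: pb_add | apply: pb_mul | apply: pb_exp ].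

(** * Trees, and types coded by trees *)

Inductive tree := Leaf | Node of tree & tree.

(** Preorder with one bit per node: counting the subtrees still to come tells where a code ends, so
    a code on top of a stack delimits itself. *)
Fixpoint code (t : tree) : seq bool :=
  if t is Node a b then true :: code a ++ code b else [:: false].

Lemma code_prefix_free a b r1 r2 :
  code a ++ r1 = code b ++ r2 -> a = b /\ r1 = r2.
Proof.
elim: a b r1 r2 => [|a IHa a' IHa'] [|b b'] r1 r2 //= [] //.
by rewrite -!catA => /IHa [-> /IHa' [-> ->]].
Qed.

Lemma code_inj : injective code.
Proof.
by move=> a b h; case: (@code_prefix_free a b [::] [::]); rewrite ?cats0.
Qed.

Class Code (T : Type) := { enc : T -> tree; enc_inj : injective enc }.

#[global] Hint Mode Code ! : typeclass_instances.

Definition sz {T} {CT : Code T} (x : T) := size (code (enc x)).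

Lemma size_code_gt0 t : 0 < size (code t).
Proof. by case: t. Qed.

Program Instance code_unit : Code unit := {| enc := fun=> Leaf |}.
Next Obligation. by move=> [] []. Qed.

Program Instance code_bool : Code bool :=
  {| enc := fun b => if b then Node Leaf Leaf else Leaf |}.
Next Obligation. by move=> [] []. Qed.

Program Instance code_prod {T U} {CT : Code T} {CU : Code U} : Code (T * U) :=
  {| enc := fun x => Node (enc x.1) (enc x.2) |}.
Next Obligation. by move=> [a b] [c d] [h1 h2]; rewrite (enc_inj h1) (enc_inj h2). Qed.

Fixpoint enc_list {T} {CT : Code T} (s : seq T) : tree :=
  if s is x :: s' then Node (enc x) (enc_list s') else Leaf.

Program Instance code_seq {T} {CT : Code T} : Code (seq T) := {| enc := enc_list |}.
Next Obligation.
by elim=> [|x s IH] [|y s'] //= [h1 /IH ->]; rewrite (enc_inj h1).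
Qed.

(** Unary, and the same tree as the one of a list of [n] units, so that a numeral can serve as a
    loop counter without conversion. *)
Fixpoint enc_nat (n : nat) : tree :=
  if n is n'.+1 then Node Leaf (enc_nat n') else Leaf.

Program Instance code_nat : Code nat := {| enc := enc_nat |}.
Next Obligation. by elim=> [|n IH] [|m] //= [] /IH ->. Qed.

Program Definition code_fin (F : finType) : Code F :=
  {| enc := fun x => enc (nat_of_ord (enum_rank x)) |}.
Next Obligation. by move=> x y h; apply: enum_rank_inj; apply: val_inj; exact: (@enc_inj _ code_nat _ _ h). Qed.

Lemma sz_pair T U {CT : Code T} {CU : Code U} (x : T) (y : U) :
  sz (x, y) = (sz x + sz y).+1.
Proof. by rewrite /sz /= size_cat. Qed.

Lemma sz_cons T {CT : Code T} (x : T) (s : seq T) : sz (x :: s) = (sz x + sz s).+1.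
Proof. by rewrite /sz /= size_cat. Qed.

Lemma sz_nil T {CT : Code T} : sz ([::] : seq T) = 1.
Proof. by []. Qed.

Lemma sz_bool (b : bool) : sz b <= 3.
Proof. by case: b. Qed.

Lemma sz_nat (n : nat) : sz n = n.*2.+1.
Proof. by rewrite /sz; elim: n => //= n ->; rewrite doubleS. Qed.

Lemma sz_gt0 T {CT : Code T} (x : T) : 0 < sz x.
Proof. exact: size_code_gt0. Qed.

Lemma sz_cat T {CT : Code T} (s1 s2 : seq T) : (sz (s1 ++ s2)).+1 = sz s1 + sz s2.
Proof. by elim: s1 => [|x s1 IH] /=; rewrite ?sz_nil // !sz_cons; lia. Qed.

Lemma sz_rcons T {CT : Code T} (s : seq T) x : sz (rcons s x) = (sz s + sz x).+1.
Proof. by rewrite -cats1; have := @sz_cat _ CT s [:: x]; rewrite sz_cons sz_nil; lia. Qed.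

Lemma size_sz T {CT : Code T} (s : seq T) : size s < sz s.
Proof. by elim: s => //= x s IH; rewrite sz_cons; lia. Qed.

(** * Moving coded values between stacks *)

(** [R2] holds a bit string in reverse, every bit being announced by [true] and
    the whole being closed by [false]; [R3] counts the subtrees still to read. *)
Definition pushm (l z : seq bool) := foldl (fun z b => true :: b :: z) z l.

Definition grab_loop r : cmd :=
  While R3 istrue
    (If r istrue (Push R3 true ;; Push R2 true) (Pop R3 ;; Push R2 false) ;;
     Pop r ;; Push R2 true).

Definition grab r : cmd :=
  Push R2 false ;; Push R3 false ;; Push R3 true ;; grab_loop r ;; Pop R3.

(** Stated with an arbitrary continuation of the loop, so that the induction on the tree can chain
    the two subtrees; the left one is read while the right one is pending on [R3]. *)
Lemma grab_loop0 t a0 a1 z w n s :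
  runs (grab_loop R0) (St a0 a1 (pushm (code t) z) w) n s ->
  runs (grab_loop R0) (St (code t ++ a0) a1 z (true :: w)) (n + 6 * size (code t)) s.
Proof.
elim: t a0 z w n => [|a IHa b IHb] a0 z w n h.
  apply: runs_le.
    eapply runs_whileT => //.
      eapply runs_seq; first by apply: runs_ifF => //; xstep; xstep.
      rewrite /=. xstep; xstep.
    exact: h.
  by rewrite /=; lia.
apply: runs_le.
  eapply runs_whileT => //.
    eapply runs_seq; first by apply: runs_ifT => //; xstep; xstep.
    rewrite /=. xstep; xstep.
  rewrite /= -catA. apply: IHa. apply: IHb. move: h; rewrite /= /pushm foldl_cat. exact.
by rewrite /= size_cat; lia.
Qed.

Lemma grab_loop1 t a0 a1 z w n s :
  runs (grab_loop R1) (St a0 a1 (pushm (code t) z) w) n s ->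
  runs (grab_loop R1) (St a0 (code t ++ a1) z (true :: w)) (n + 6 * size (code t)) s.
Proof.
elim: t a1 z w n => [|a IHa b IHb] a1 z w n h.
  apply: runs_le.
    eapply runs_whileT => //.
      eapply runs_seq; first by apply: runs_ifF => //; xstep; xstep.
      rewrite /=. xstep; xstep.
    exact: h.
  by rewrite /=; lia.
apply: runs_le.
  eapply runs_whileT => //.
    eapply runs_seq; first by apply: runs_ifT => //; xstep; xstep.
    rewrite /=. xstep; xstep.
  rewrite /= -catA. apply: IHa. apply: IHb. move: h; rewrite /= /pushm foldl_cat. exact.
by rewrite /= size_cat; lia.
Qed.

Lemma runs_grab0 t a0 a1 z w :
  runs (grab R0) (St (code t ++ a0) a1 z w) (5 + 6 * size (code t))
    (St a0 a1 (pushm (code t) (false :: z)) w).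
Proof.
apply: runs_le.
  xstep; xstep; xstep; eapply runs_seq.
    by apply: grab_loop0; apply: runs_whileF.
  by rewrite /=; xstep.
by lia.
Qed.

Lemma runs_grab1 t a0 a1 z w :
  runs (grab R1) (St a0 (code t ++ a1) z w) (5 + 6 * size (code t))
    (St a0 a1 (pushm (code t) (false :: z)) w).
Proof.
apply: runs_le.
  xstep; xstep; xstep; eapply runs_seq.
    by apply: grab_loop1; apply: runs_whileF.
  by rewrite /=; xstep.
by lia.
Qed.

Definition unload ct cf : cmd :=
  While R2 istrue (Pop R2 ;; If R2 istrue ct cf ;; Pop R2) ;; Pop R2.

(** The string lies reversed on [R2], so its last bit is treated first; hence the effect is a
    [foldr]. *)
Lemma runs_unload ct cf (F G : bool -> seq bool -> seq bool) k :
  (forall (b : bool) a0 a1 z w,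
     runs (if b then ct else cf) (St a0 a1 z w) k (St (F b a0) (G b a1) z w)) ->
  forall l a0 a1 z w,
    runs (unload ct cf) (St a0 a1 (pushm l (false :: z)) w) ((k + 4) * size l + 2)
      (St (foldr F a0 l) (foldr G a1 l) z w).
Proof.
move=> h l a0 a1 z w.
suff hl : runs (While R2 istrue (Pop R2 ;; If R2 istrue ct cf ;; Pop R2))
   (St a0 a1 (pushm l (false :: z)) w) ((k + 4) * size l + 1)
      (St (foldr F a0 l) (foldr G a1 l) (false :: z) w).
  by apply: runs_le; [eapply runs_seq; [exact: hl | xstep] | lia].
elim/last_ind: l a0 a1 => [|l b IH] a0 a1.
  by apply: runs_le; [apply: runs_whileF | lia].
rewrite {1}/pushm foldl_rcons !foldr_rcons size_rcons.
apply: runs_le; first eapply runs_whileT; first by [].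
    xstep; rewrite /=. eapply runs_seq.
      have := h b a0 a1 (b :: pushm l (false :: z)) w.
      by case: (b) => hb; [apply: runs_ifT hb | apply: runs_ifF hb].
    by xstep.
  exact: IH.
lia.
Qed.

Definition put0 := unload (Push R0 true) (Push R0 false).
Definition put1 := unload (Push R1 true) (Push R1 false).
Definition put01 := unload (Push R0 true ;; Push R1 true) (Push R0 false ;; Push R1 false).
Definition disc := unload Skip Skip.

Lemma foldr_cons (T : Type) (l a : seq T) : foldr cons a l = l ++ a.
Proof. by elim: l => //= x l ->. Qed.

Lemma foldr_id (T U : Type) (l : seq T) (a : U) : foldr (fun _ x => x) a l = a.
Proof. by elim: l. Qed.

Lemma runs_put0 l a0 a1 z w :
  runs put0 (St a0 a1 (pushm l (false :: z)) w) (5 * size l + 2) (St (l ++ a0) a1 z w).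
Proof.
have := @runs_unload (Push R0 true) (Push R0 false) cons (fun _ x => x) 1 _ l a0 a1 z w.
by rewrite foldr_cons foldr_id; apply; case=> *; xstep.
Qed.

Lemma runs_put1 l a0 a1 z w :
  runs put1 (St a0 a1 (pushm l (false :: z)) w) (5 * size l + 2) (St a0 (l ++ a1) z w).
Proof.
have := @runs_unload (Push R1 true) (Push R1 false) (fun _ x => x) cons 1 _ l a0 a1 z w.
by rewrite foldr_cons foldr_id; apply; case=> *; xstep.
Qed.

Lemma runs_put01 l a0 a1 z w :
  runs put01 (St a0 a1 (pushm l (false :: z)) w) (6 * size l + 2)
    (St (l ++ a0) (l ++ a1) z w).
Proof.
have := @runs_unload (Push R0 true ;; Push R1 true) (Push R0 false ;; Push R1 false)
   cons cons 2 _ l a0 a1 z w.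
by rewrite !foldr_cons; apply; case=> * /=; (apply: runs_le; [xstep; xstep | by []]).
Qed.

Lemma runs_disc l a0 a1 z w :
  runs disc (St a0 a1 (pushm l (false :: z)) w) (4 * size l + 2) (St a0 a1 z w).
Proof.
have := @runs_unload Skip Skip (fun _ x => x) (fun _ x => x) 0 _ l a0 a1 z w.
by rewrite !foldr_id; apply; case=> *; exact: runs_skip.
Qed.

(** * Polynomial-time functions between coded types *)

(** The program may assume nothing about what lies below its argument, and must
    leave it untouched, so that programs compose by stacking. *)
Definition ptime_spec {T U} {CT : Code T} {CU : Code U} (f : T -> U) :=
  exists c g, pb g /\ forall x a0 a1 z w,
    runs c (St (code (enc x) ++ a0) a1 z w) (g (sz x))
      (St (code (enc (f x)) ++ a0) a1 z w).

(** A constructor rather than a definition, so that proof search does not confuse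
    functions whose values happen to have convertible codes. *)
Variant ptime {T U} {CT : Code T} {CU : Code U} (f : T -> U) : Prop :=
  Ptime of ptime_spec f.

Section Closure.
Context {T U : Type} {CT : Code T} {CU : Code U}.

Lemma ptimeE (f : T -> U) : ptime f -> exists c k, forall x a0 a1 z w,
    runs c (St (code (enc x) ++ a0) a1 z w) ((sz x + 2) ^ k)
      (St (code (enc (f x)) ++ a0) a1 z w).
Proof.
case=> -[c [g [[k hk] h]]]; exists c, k => x a0 a1 z w.
exact: runs_le (h x a0 a1 z w) (hk _).
Qed.

Lemma pt_size (f : T -> U) : ptime f -> exists k, forall x, sz (f x) <= (sz x + 2) ^ k.
Proof.
case=> -[c [g [hg h]]]; have [k hk] : pb (fun n => n + g n) by pbs.
exists k => x; apply: leq_trans (hk _).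
by have := runs_size (h x [::] [::] [::] [::]); rewrite /store_size /= !cats0 !addn0.
Qed.

Lemma pt_ext (f g : T -> U) : f =1 g -> ptime f -> ptime g.
Proof. by move=> e [[c [h [hh H]]]]; apply: Ptime; exists c, h; split=> // x *; rewrite -e. Qed.

Lemma pt_cast (f : T -> U) : (forall x, enc (f x) = enc x) -> ptime f.
Proof.
move=> h; apply: Ptime; exists Skip, (fun=> 0); split; first exact: pb_const.
by move=> x *; rewrite h; exact: runs_skip.
Qed.

End Closure.

Section Closure1.
Context {T U V : Type} {CT : Code T} {CU : Code U} {CV : Code V}.

Lemma pt_comp (f : T -> U) (g : U -> V) : ptime f -> ptime g -> ptime (fun x => g (f x)).
Proof.
move=> hf hg; have [k hk] := pt_size hf.
have [cf [kf Hf]] := ptimeE hf; have [cg [kg Hg]] := ptimeE hg.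
apply: Ptime; exists (cf ;; cg), (fun n => (n + 2) ^ kf + ((n + 2) ^ k + 2) ^ kg); split; first by pbs.
move=> x a0 a1 z w; eapply runs_seq; first exact: Hf.
by apply: runs_le (Hg _ _ _ _ _) _; apply: pow_mono.
Qed.

Lemma pt_const (u : U) : ptime (fun _ : T => u).
Proof.
pose pushes := foldr (fun b c => c ;; Push R0 b) Skip.
apply: Ptime; exists (grab R0 ;; disc ;; pushes (code (enc u))),
  (fun n => 5 + 6 * n + (4 * n + 2 + size (code (enc u)))); split; first by pbs.
move=> x a0 a1 z w; eapply runs_seq; first exact: runs_grab0.
eapply runs_seq; first exact: runs_disc.
elim: (code (enc u)) => [|b l IH] /=; first exact: runs_skip.
by apply: runs_le; [eapply runs_seq; [exact: IH | xstep] | lia].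
Qed.

End Closure1.

Lemma pt_id {T} {CT : Code T} : ptime (fun x : T => x).
Proof. exact: pt_cast. Qed.

Definition dup := grab R0 ;; put01.

Lemma runs_dup t a0 a1 z w :
  runs dup (St (code t ++ a0) a1 z w) (12 * size (code t) + 7)
    (St (code t ++ a0) (code t ++ a1) z w).
Proof.
apply: runs_le; first eapply runs_seq.
- exact: runs_grab0.
- exact: runs_put01.
- by lia.
Qed.

Definition swp := grab R1 ;; grab R0 ;; put1 ;; put0.

Lemma runs_swp t u a0 a1 z w :
  runs swp (St (code t ++ a0) (code u ++ a1) z w)
    (11 * size (code t) + 11 * size (code u) + 14) (St (code u ++ a0) (code t ++ a1) z w).
Proof.
apply: runs_le.
  eapply runs_seq; first exact: runs_grab1.
  eapply runs_seq; first exact: runs_grab0.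
  eapply runs_seq; [exact: runs_put1 | exact: runs_put0].
by lia.
Qed.

Section Closure2.
Context {T U V W : Type} {CT : Code T} {CU : Code U} {CV : Code V} {CW : Code W}.

(** The argument is duplicated onto [R1], where it survives the run of [f], since programs leave
    everything below their argument and on the other stacks as it was. *)
Lemma pt_pair (f : T -> U) (g : T -> V) : ptime f -> ptime g -> ptime (fun x => (f x, g x)).
Proof.
move=> hf hg; have [k hk] := pt_size hf.
have [cf [kf Hf]] := ptimeE hf; have [cg [kg Hg]] := ptimeE hg.
apply: Ptime; exists (dup ;; cf ;; swp ;; cg ;; grab R1 ;; put0 ;; Push R0 true).
exists (fun n => 12 * n + 7 + ((n + 2) ^ kf + (11 * (n + 2) ^ k + 11 * n + 14 +
   ((n + 2) ^ kg + (5 + 6 * (n + 2) ^ k + (5 * (n + 2) ^ k + 2 + 1)))))).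
split; first by pbs.
move=> x a0 a1 z w; eapply runs_seq; first exact: runs_dup.
eapply runs_seq; first exact: Hf.
eapply runs_seq.
  by apply: runs_le; [exact: runs_swp | have := hk x; rewrite /sz; lia].
eapply runs_seq; first exact: Hg.
eapply runs_seq.
  by apply: runs_le; [exact: runs_grab1 | have := hk x; rewrite /sz; lia].
eapply runs_seq.
  by apply: runs_le; [exact: runs_put0 | have := hk x; rewrite /sz; lia].
by rewrite /= -catA; xstep.
Qed.

Lemma pt_fst0 : ptime (fun p : T * U => p.1).
Proof.
apply: Ptime; exists (Pop R0 ;; grab R0 ;; grab R0 ;; disc ;; put0).
exists (fun n => 100 * n + 100); split; first by pbs.
move=> [x y] a0 a1 z w /=; apply: runs_le.
  xstep; rewrite -catA.
  eapply runs_seq; first exact: runs_grab0.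
  eapply runs_seq; first exact: runs_grab0.
  eapply runs_seq; first exact: runs_disc.
  exact: runs_put0.
by rewrite sz_pair /sz; lia.
Qed.

Lemma pt_snd0 : ptime (fun p : T * U => p.2).
Proof.
apply: Ptime; exists (Pop R0 ;; grab R0 ;; disc).
exists (fun n => 100 * n + 100); split; first by pbs.
move=> [x y] a0 a1 z w /=; apply: runs_le.
  xstep; rewrite -catA.
  eapply runs_seq; first exact: runs_grab0.
  exact: runs_disc.
by rewrite sz_pair /sz; lia.
Qed.

(** Once the root bit is popped, the next bit tells whether the left component is a leaf. If so,
    what follows it is the code of the argument of [f]; otherwise the root bit is restored and the
    same code is reread as a value of type [V]. Lists, numerals and booleans all branch in this
    way. *)
Lemma pt_case0 (f : U -> W) (g : V -> W) (h : T -> W) :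
  ptime f -> ptime g ->
  (forall x, (exists2 a, enc x = Node Leaf (enc a) & h x = f a) \/
     (exists2 b, enc x = enc b & h x = g b) /\
     (exists l r u, enc x = Node (Node l r) u)) -> ptime h.
Proof.
move=> /ptimeE [cf [kf Hf]] /ptimeE [cg [kg Hg]] H.
apply: Ptime; exists (Pop R0 ;; If R0 istrue (Push R0 true ;; cg) (Pop R0 ;; cf)).
exists (fun n => 3 + (n + 2) ^ kf + (n + 2) ^ kg); split; first by pbs.
move=> x a0 a1 z w; case: (H x) => [[a e1 e2] | [[b e1 e2] [l [r [u e3]]]]].
  rewrite e1 e2 /sz e1; apply: runs_le.
    by rewrite /=; xstep; apply: runs_ifF => //; xstep; exact: Hf.
  have h1 : sz a <= size (code (Node Leaf (enc a))) by rewrite /sz /=; lia.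
  by have := pow_mono kf h1; lia.
rewrite e3 e2 /sz; apply: runs_le.
  rewrite /=; xstep; apply: runs_ifT => //; xstep.
  by move: (Hg b a0 a1 z w); rewrite -e1 e3 /=; exact.
by rewrite e1 -/(sz b); lia.
Qed.

End Closure2.

Lemma pt_case_seq0 {X T U} {CX : Code X} {CT : Code T} {CU : Code U}
    (f : X -> U) (g : T * seq T * X -> U) : ptime f -> ptime g ->
  ptime (fun p : seq T * X => match p.1 with [::] => f p.2 | y :: l => g (y, l, p.2) end).
Proof.
move=> hf hg; apply: (pt_case0 hf hg) => -[[|y l] x].
  by left; exists x.
right; split; first by exists (y, l, x).
by exists (enc y), (enc l), (enc x).
Qed.

Lemma pt_case_nat0 {X U} {CX : Code X} {CU : Code U}
    (f : X -> U) (g : nat * X -> U) : ptime f -> ptime g ->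
  ptime (fun p : nat * X => match p.1 with 0 => f p.2 | n.+1 => g (n, p.2) end).
Proof.
move=> hf hg.
pose g' (p : unit * nat * X) := g (p.1.2, p.2).
have hg' : ptime g'.
  apply: (@pt_comp _ _ _ _ _ _ (fun p : unit * nat * X => (p.1.2, p.2))) hg.
  by apply: pt_pair; [exact: pt_comp pt_fst0 pt_snd0 | exact: pt_snd0].
apply: (pt_case0 hf hg') => -[[|n] x].
  by left; exists x.
right; split; first by exists (tt, n, x).
by exists Leaf, (enc n), (enc x).
Qed.

Lemma pt_if0 {X U} {CX : Code X} {CU : Code U} (f g : X -> U) :
  ptime f -> ptime g -> ptime (fun p : bool * X => if p.1 then f p.2 else g p.2).
Proof.
move=> hf hg.
have hf' : ptime (fun p : unit * unit * X => f p.2) by exact: pt_comp pt_snd0 hf.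
apply: (pt_case0 hg hf') => -[[] x].
  right; split; first by exists (tt, tt, x).
  by exists Leaf, Leaf, (enc x).
by left; exists x.
Qed.

(** ** Closure properties in a context [X] *)

Section Context.
Context {X T U V : Type} {CX : Code X} {CT : Code T} {CU : Code U} {CV : Code V}.

Lemma pt_fst (f : X -> T * U) : ptime f -> ptime (fun x => (f x).1).
Proof. by move=> hf; exact: pt_comp hf pt_fst0. Qed.

Lemma pt_snd (f : X -> T * U) : ptime f -> ptime (fun x => (f x).2).
Proof. by move=> hf; exact: pt_comp hf pt_snd0. Qed.

Lemma pt_cons (f : X -> T) (g : X -> seq T) :
  ptime f -> ptime g -> ptime (fun x => f x :: g x).
Proof.
move=> hf hg; apply: (pt_comp (pt_pair hf hg) (g := fun p => p.1 :: p.2)).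
by apply: pt_cast => -[].
Qed.

Lemma pt_S (f : X -> nat) : ptime f -> ptime (fun x => (f x).+1).
Proof.
move=> hf; apply: (pt_comp (pt_pair (pt_const tt) hf) (g := fun p => p.2.+1)).
by apply: pt_cast => -[].
Qed.

Lemma pt_if (b : X -> bool) (f g : X -> T) :
  ptime b -> ptime f -> ptime g -> ptime (fun x => if b x then f x else g x).
Proof.
by move=> hb hf hg; exact: pt_comp (pt_pair hb pt_id) (pt_if0 hf hg).
Qed.

Lemma pt_case_seq (l : X -> seq T) (f : X -> U) (g : X -> T -> seq T -> U) :
  ptime l -> ptime f -> ptime (fun p : X * T * seq T => g p.1.1 p.1.2 p.2) ->
  ptime (fun x => match l x with [::] => f x | y :: l' => g x y l' end).
Proof.
move=> hl hf hg.
have hg' : ptime (fun p : T * seq T * X => g p.2 p.1.1 p.1.2).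
  apply: (pt_comp (f := fun p : T * seq T * X => (p.2, p.1.1, p.1.2)) _ hg).
  apply: pt_pair; first apply: pt_pair; first exact: pt_snd0.
    exact: pt_comp pt_fst0 pt_fst0.
  exact: pt_comp pt_fst0 pt_snd0.
exact: pt_comp (pt_pair hl pt_id) (pt_case_seq0 hf hg').
Qed.

Lemma pt_case_nat (l : X -> nat) (f : X -> U) (g : X -> nat -> U) :
  ptime l -> ptime f -> ptime (fun p : X * nat => g p.1 p.2) ->
  ptime (fun x => match l x with 0 => f x | n.+1 => g x n end).
Proof.
move=> hl hf hg.
have hg' : ptime (fun p : nat * X => g p.2 p.1).
  apply: (pt_comp (f := fun p : nat * X => (p.2, p.1)) _ hg).
  by apply: pt_pair; [exact: pt_snd0 | exact: pt_fst0].
exact: pt_comp (pt_pair hl pt_id) (pt_case_nat0 hf hg').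
Qed.

(** Iterating a polynomial-time function may, say, square the size at each round, so a common bound
    on all intermediate values has to be assumed. The list on [R1] acts only as a counter. *)
Lemma pt_iter (f : U -> U) (cnt : X -> seq T) (u0 : X -> U) :
  ptime f -> ptime cnt -> ptime u0 ->
  (exists k, forall x i, i <= size (cnt x) -> sz (iter i f (u0 x)) <= (sz x + 2) ^ k) ->
  ptime (fun x => iter (size (cnt x)) f (u0 x)).
Proof.
move=> hf hc hu [k hk]; have [k' hk'] := pt_size hc.
have [cf [kf Hf]] := ptimeE hf; have [c0 [k0 H0]] := ptimeE (pt_pair hc hu).
pose body := Pop R1 ;; grab R1 ;; disc ;; cf.
have loop B : forall l u a0 a1 z w, (forall i, i <= size l -> sz (iter i f u) <= B) ->
    runs (While R1 istrue body) (St (code (enc u) ++ a0) (code (enc (l : seq T)) ++ a1) z w)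
      (20 * sz l + size l * (B + 2) ^ kf)
      (St (code (enc (iter (size l) f u)) ++ a0) (false :: a1) z w).
  elim=> [|y l IH] u a0 a1 z w hB.
    by apply: runs_le; [apply: runs_whileF | rewrite sz_nil; lia].
  apply: runs_le; first eapply runs_whileT; first by [].
      rewrite /body /=; xstep; rewrite -catA.
      eapply runs_seq; first exact: runs_grab1.
      eapply runs_seq; first exact: runs_disc.
      exact: Hf.
    rewrite [size (y :: l)]/= iterSr; apply: IH => i hi.
    by rewrite -iterSr; apply: hB.
  have := @pow_mono kf (sz u) B (hB 0 isT).
  by rewrite sz_cons /= /sz; lia.
apply: Ptime; exists (c0 ;; Pop R0 ;; grab R0 ;; put1 ;; While R1 istrue body ;; Pop R1).
exists (fun n => (n + 2) ^ k0 + (1 + (5 + 6 * (n + 2) ^ k' + (5 * (n + 2) ^ k' + 2 +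
   (20 * (n + 2) ^ k' + (n + 2) ^ k' * ((n + 2) ^ k + 2) ^ kf + 1)))));
  split; first by pbs.
move=> x a0 a1 z w; eapply runs_seq; first exact: H0.
rewrite /=; xstep; rewrite -catA.
have h1 := hk' x.
eapply runs_seq; first by apply: runs_le; [exact: runs_grab0 | move: h1; rewrite /sz /=; lia].
eapply runs_seq; first by apply: runs_le; [exact: runs_put1 | move: h1; rewrite /sz /=; lia].
eapply runs_seq.
  apply: runs_le; first by apply: (loop ((sz x + 2) ^ k)); exact: hk.
  apply: leq_add; first by rewrite leq_mul2l h1 orbT.
  by apply: leq_mul => //; apply: leq_trans h1; apply: ltnW; exact: size_sz.
by xstep.
Qed.

End Context.

(** * Folds with controlled growth of the accumulator *)

Section Folds.
Context {X T A : Type} {CX : Code X} {CT : Code T} {CA : Code A}.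

Lemma sz_drop i (l : seq T) : sz (drop i l) <= sz l.
Proof.
elim: l i => [|y l IH] [|i] //=; rewrite sz_cons.
by apply: leq_trans (IH i) _; lia.
Qed.

Lemma pt_foldl_bnd (f : X -> A -> T -> A) (a0 : X -> A) (l : X -> seq T) :
  ptime (fun p : X * A * T => f p.1.1 p.1.2 p.2) -> ptime a0 -> ptime l ->
  (exists k, forall x i, sz (foldl (f x) (a0 x) (take i (l x))) <= (sz x + 2) ^ k) ->
  ptime (fun x => foldl (f x) (a0 x) (l x)).
Proof.
move=> hf h0 hl [k hk]; have [k' hk'] := pt_size hl.
pose step (s : X * A * seq T) :=
  match s.2 with [::] => s | y :: l' => (s.1.1, f s.1.1 s.1.2 y, l') end.
have hstep : ptime step.
  apply: (pt_case_seq (g := fun s y l' => (s.1.1, f s.1.1 s.1.2 y, l'))).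
  - exact: pt_snd0.
  - exact: pt_id.
  apply: pt_pair; last exact: pt_snd0.
  have h3 : ptime (fun p : X * A * seq T * T * seq T => p.1.1.1).
    by do 2![apply: pt_fst]; apply: pt_fst; exact: pt_id.
  apply: pt_pair; first by apply: pt_fst.
  apply: (pt_comp (f := fun p : X * A * seq T * T * seq T => (p.1.1.1, p.1.2)) _ hf).
  by apply: pt_pair => //; apply: pt_snd; apply: pt_fst; exact: pt_id.
have hi x i : iter i step (x, a0 x, l x) =
   (x, foldl (f x) (a0 x) (take i (l x)), drop i (l x)).
  elim: i => [|i IH]; first by rewrite take0 drop0.
  rewrite iterS IH /step /=; case: (ltnP i (size (l x))) => hlt.
    have [y0 _] : exists y : T, True by case: (l x) hlt => // y; exists y.
    by rewrite (drop_nth y0 hlt) (take_nth y0 hlt) foldl_rcons.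
  by rewrite drop_oversize // !take_oversize ?drop_oversize // ltnW.
apply: (pt_ext (f := fun x => (iter (size (l x)) step (x, a0 x, l x)).1.2)).
  by move=> x; rewrite hi take_size.
apply: pt_snd; apply: pt_fst; apply: pt_iter => //.
  by apply: pt_pair => //; apply: pt_pair => //; exact: pt_id.
have [k3 hk3] : pb (fun n => n + (n + 2) ^ k + (n + 2) ^ k' + 2) by pbs.
exists k3 => x i _; apply: leq_trans (hk3 _); rewrite hi !sz_pair.
by have := hk x i; have := hk' x; have := sz_drop i (l x); lia.
Qed.

(** If a step enlarges the accumulator by an amount that does not depend on the accumulator, the
    increments add up instead of compounding, and the intermediate values stay polynomial. *)
Lemma pt_foldl (f : X -> A -> T -> A) (a0 : X -> A) (l : X -> seq T) :
  ptime (fun p : X * A * T => f p.1.1 p.1.2 p.2) -> ptime a0 -> ptime l ->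
  (exists k, forall x a y, sz (f x a y) <= sz a + (sz x + sz y + 2) ^ k) ->
  ptime (fun x => foldl (f x) (a0 x) (l x)).
Proof.
move=> hf h0 hl [k hk]; apply: pt_foldl_bnd => //.
have [k1 hk1] := pt_size hl; have [k2 hk2] := pt_size h0.
have hs x m : forall s a, sz s <= m ->
   sz (foldl (f x) a s) <= sz a + size s * (sz x + m + 2) ^ k.
  elim=> [|y s IH] a; rewrite ?sz_cons /=; first by rewrite addn0.
  move=> hm; have h1 : sz s <= m by lia.
  have h2 : sz y <= m by lia.
  apply: leq_trans (IH _ h1) _; have := hk x a y.
  have h3 : sz x + sz y <= sz x + m by lia.
  by have := pow_mono k h3; rewrite mulSn; lia.
have htake : forall s : seq T, forall i, sz (take i s) <= sz s.
  by elim=> [|y s IH] [|i] //=; rewrite !sz_cons //; have := IH i; lia.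
have [k3 hk3] : pb (fun n => (n + 2) ^ k2 + (n + 2) ^ k1 * (n + (n + 2) ^ k1 + 2) ^ k) by pbs.
exists k3 => x i; apply: leq_trans (hk3 _).
apply: leq_trans (hs x (sz (l x)) _ _ (htake _ i)) _.
apply: leq_add (hk2 x) _; apply: leq_mul.
  apply: leq_trans (hk1 x); apply: ltnW; apply: leq_trans (size_sz _) (htake _ i).
by apply: pow_mono; rewrite leq_add2l.
Qed.

End Folds.

Ltac pt1 := first
 [ exact: pt_id | exact: pt_fst0 | exact: pt_snd0 | exact: pt_const | assumption
 | apply: pt_pair | apply: pt_cons | apply: pt_S | apply: pt_if
 | apply: pt_fst | apply: pt_snd ].
Ltac pts := repeat pt1.

(** * List functions, boolean connectives and equality tests in polynomial time *)

Section Lists.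
Context {X T U : Type} {CX : Code X} {CT : Code T} {CU : Code U}.

Lemma pt_catrev (f g : X -> seq T) : ptime f -> ptime g -> ptime (fun x => catrev (f x) (g x)).
Proof.
move=> hf hg.
apply: (pt_ext (f := fun x => foldl (fun a y => y :: a) (g x) (f x))).
  by move=> x; elim: (f x) (g x) => //= y s IH a; rewrite IH.
apply: (pt_foldl (f := fun _ a y => y :: a)) => //; first by pts.
by exists 1 => x a y; rewrite sz_cons; lia.
Qed.

Lemma pt_rev (f : X -> seq T) : ptime f -> ptime (fun x => rev (f x)).
Proof. by move=> hf; apply: pt_catrev => //; exact: pt_const. Qed.
End Lists.

Section Lists2.
Context {X T U : Type} {CX : Code X} {CT : Code T} {CU : Code U}.

Lemma pt_cat (f g : X -> seq T) : ptime f -> ptime g -> ptime (fun x => f x ++ g x).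
Proof.
move=> hf hg; apply: (pt_ext (f := fun x => catrev (rev (f x)) (g x))).
  by move=> x; rewrite catrevE revK.
by apply: pt_catrev => //; apply: pt_rev.
Qed.

Lemma pt_rcons (f : X -> seq T) (g : X -> T) : ptime f -> ptime g -> ptime (fun x => rcons (f x) (g x)).
Proof.
move=> hf hg; apply: (pt_ext (f := fun x => f x ++ [:: g x])).
  by move=> x; rewrite cats1.
by apply: pt_cat => //; pts.
Qed.

End Lists2.

Section Lists2a.
Context {X T U : Type} {CX : Code X} {CT : Code T} {CU : Code U}.

Lemma pt_map (f : X -> T -> U) (l : X -> seq T) :
  ptime (fun p : X * T => f p.1 p.2) -> ptime l -> ptime (fun x => [seq f x y | y <- l x]).
Proof.
move=> hf hl.
apply: (pt_ext (f := fun x => rev (foldl (fun a y => f x y :: a) [::] (l x)))).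
  move=> x; rewrite -[RHS]revK; congr rev.
  suff h : forall a, foldl (fun a y => f x y :: a) a (l x) = catrev (map (f x) (l x)) a.
    by rewrite h catrevE cats0.
  by elim: (l x) => //= y s IH a; rewrite IH.
apply: pt_rev; apply: (pt_foldl (f := fun x a y => f x y :: a)) => //.
- apply: pt_cons; last by pts.
  by apply: (pt_comp (f := fun p : X * seq U * T => (p.1.1, p.2)) _ hf); pts.
- exact: pt_const.
have [k hk] := pt_size hf; have [k' hk'] : pb (fun n => (n + 1 + 2) ^ k + 1).
  by apply: pb_add (pb_const _); apply: pb_exp; pbs.
exists k' => x a y; apply: leq_trans (leq_add (leqnn _) (hk' _)); rewrite sz_cons.
by have := hk (x, y); rewrite sz_pair /= addn1; lia.
Qed.

End Lists2a.

Section Lists2b.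
Context {X T U : Type} {CX : Code X} {CT : Code T} {CU : Code U}.

Lemma pt_flatten (l : X -> seq (seq T)) : ptime l -> ptime (fun x => flatten (l x)).
Proof.
move=> hl; apply: (pt_ext (f := fun x => foldl cat [::] (l x))).
  move=> x; rewrite -[RHS]/([::] ++ flatten (l x)).
  elim: (l x) [::] => [|s ll IH] a /=; first by rewrite cats0.
  by rewrite IH catA.
apply: (pt_foldl (f := fun _ => cat)) => //.
- by apply: pt_cat; pts.
- exact: pt_const.
by exists 1 => x a y; have := @sz_cat _ CT a y; lia.
Qed.
End Lists2b.

Section Lists3.
Context {X T U : Type} {CX : Code X} {CT : Code T} {CU : Code U}.

Lemma pt_filter (p : X -> T -> bool) (l : X -> seq T) :
  ptime (fun q : X * T => p q.1 q.2) -> ptime l -> ptime (fun x => [seq y <- l x | p x y]).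
Proof.
move=> hp hl.
apply: (pt_ext (f := fun x => flatten [seq if p x y then [:: y] else [::] | y <- l x])).
  by move=> x; elim: (l x) => //= y s ->; case: ifP.
apply: pt_flatten; apply: (pt_map (f := fun x y => if p x y then [:: y] else [::])) => //.
by pts.
Qed.

Lemma pt_allpairs V (CV : Code V) (f : X -> T -> U -> V) (l : X -> seq T) (m : X -> T -> seq U) :
  ptime (fun q : X * T * U => f q.1.1 q.1.2 q.2) -> ptime l ->
  ptime (fun q : X * T => m q.1 q.2) ->
  ptime (fun x => [seq f x y z | y <- l x, z <- m x y]).
Proof.
move=> hf hl hm; apply: pt_flatten.
apply: (pt_map (f := fun x y => [seq f x y z | z <- m x y])) => //.
by apply: (pt_map (f := fun q z => f q.1 q.2 z)).
Qed.

Lemma pt_has (p : X -> T -> bool) (l : X -> seq T) :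
  ptime (fun q : X * T => p q.1 q.2) -> ptime l -> ptime (fun x => has (p x) (l x)).
Proof.
move=> hp hl.
apply: (pt_ext (f := fun x => foldl (fun a y => if p x y then true else a) false (l x))).
  move=> x; rewrite -[RHS]/(false || has (p x) (l x)).
  elim: (l x) false => [|y s IH] a /=; first by rewrite orbF.
  by rewrite IH; case: (p x y); case: a.
apply: (pt_foldl (f := fun x a y => if p x y then true else a)) => //; pts.
  by apply: (pt_comp (f := fun q : X * bool * T => (q.1.1, q.2)) _ hp); pts.
exists 2 => x a y; apply: leq_trans (sz_bool _) _.
by have := @pow_mono 2 0 (sz x + sz y) (leq0n _); lia.
Qed.

Lemma pt_neg (b : X -> bool) : ptime b -> ptime (fun x => ~~ b x).
Proof.
by move=> hb; apply: (pt_ext (f := fun x => if b x then false else true)); pts.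
Qed.

Lemma pt_and (b c : X -> bool) : ptime b -> ptime c -> ptime (fun x => b x && c x).
Proof.
by move=> hb hc; apply: (pt_ext (f := fun x => if b x then c x else false)); pts.
Qed.

Lemma pt_or (b c : X -> bool) : ptime b -> ptime c -> ptime (fun x => b x || c x).
Proof.
by move=> hb hc; apply: (pt_ext (f := fun x => if b x then true else c x)); pts.
Qed.
End Lists3.

Section Lists4.
Context {X T U : Type} {CX : Code X} {CT : Code T} {CU : Code U}.

Lemma pt_all (p : X -> T -> bool) (l : X -> seq T) :
  ptime (fun q : X * T => p q.1 q.2) -> ptime l -> ptime (fun x => all (p x) (l x)).
Proof.
move=> hp hl; apply: (pt_ext (f := fun x => ~~ has (fun y => ~~ p x y) (l x))).
  by move=> x; rewrite has_predC negbK.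
by apply: pt_neg; apply: pt_has => //; apply: pt_neg.
Qed.

Lemma pt_nsize (l : X -> seq T) : ptime l -> ptime (fun x => size (l x)).
Proof.
move=> hl; apply: (pt_ext (f := fun x => foldl (fun a _ => a.+1) 0 (l x))).
  move=> x; rewrite -[RHS]/(0 + size (l x)).
  by elim: (l x) 0 => [|y s IH] a /=; rewrite ?addn0 // IH addSnnS.
apply: (pt_foldl (f := fun _ a _ => a.+1)) => //; pts.
by exists 1 => x a y; rewrite !sz_nat; lia.
Qed.

Lemma pt_nseq_tt (f : X -> nat) : ptime f -> ptime (fun x => nseq (f x) tt).
Proof.
move=> hf; apply: (pt_comp (g := fun n => nseq n tt) hf).
by apply: pt_cast => n /=; elim: n => //= n ->.
Qed.

Lemma pt_behead (l : X -> seq T) : ptime l -> ptime (fun x => behead (l x)).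
Proof.
move=> hl; apply: (pt_ext (f := fun x => if l x is _ :: l' then l' else [::])).
  by move=> x; case: (l x).
by apply: (pt_case_seq (g := fun _ _ l' => l')) => //; pts.
Qed.

Lemma pt_head (x0 : T) (l : X -> seq T) : ptime l -> ptime (fun x => head x0 (l x)).
Proof.
move=> hl; apply: (pt_ext (f := fun x => if l x is y :: _ then y else x0)).
  by move=> x; case: (l x).
by apply: (pt_case_seq (g := fun _ y _ => y)) => //; pts.
Qed.

(** Makes the code of a value available as data. Since codes are injective, equality on any coded
    type reduces to equality of bit lists. *)
Lemma pt_bits : ptime (fun x : T => code (enc x)).
Proof.
pose F (b : bool) a := true :: code (@enc _ code_bool b) ++ a.
apply: Ptime; exists (grab R0 ;; Push R0 false ;;
  unload (Push R0 false ;; Push R0 false ;; Push R0 true ;; Push R0 true)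
         (Push R0 false ;; Push R0 true)).
exists (fun n => 5 + 6 * n + (1 + (8 * n + 2))); split; first by pbs.
move=> x a0 a1 z w; eapply runs_seq; first exact: runs_grab0.
xstep.
have := @runs_unload (Push R0 false ;; Push R0 false ;; Push R0 true ;; Push R0 true)
   (Push R0 false ;; Push R0 true) F (fun _ a => a) 4 _ (code (@enc _ CT x)) (false :: a0) a1 z w.
rewrite foldr_id.
have -> : foldr F (false :: a0) (code (enc x)) = code (enc (code (enc x))) ++ a0.
  by elim: (code (enc x)) => //= b l ->; rewrite /F -catA.
apply; case=> * /=.
  by apply: runs_le; [xstep; xstep; xstep; xstep | by []].
by apply: runs_le; [xstep; xstep | by []].
Qed.

End Lists4.

Section Lists5.
Context {X T U : Type} {CX : Code X} {CT : Code T} {CU : Code U}.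

Lemma pt_eqbits (f g : X -> seq bool) : ptime f -> ptime g -> ptime (fun x => f x == g x).
Proof.
move=> hf hg.
pose h (a : bool * seq bool) (y : bool) :=
  if a.2 is z :: r then (if y then a.1 && z else a.1 && ~~ z, r) else (false, [::]).
pose s x := foldl h (true, g x) (f x).
apply: (pt_ext (f := fun x => if (s x).2 is _ :: _ then false else (s x).1)).
  move=> x; rewrite /s -[RHS]andTb.
  elim: (f x) (g x) true => [|y l IH] [|z r] b //=; rewrite ?andbT ?andbF //.
    rewrite /h /=. elim: l {IH} => //= y' l; exact.
  rewrite {2}/h /= IH eqseq_cons; case: y; case: z; case: b => //=; by rewrite andbF.
have hs : ptime s.
  apply: (pt_foldl (f := fun _ => h)) => //; first last.
  - exists 3 => x [b r] y; rewrite /h /=.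
    have h8 := @pow_mono 3 0 (sz x + sz y) (leq0n _).
    case: r => [|c r]; rewrite !sz_pair.
      by have := sz_bool false; rewrite sz_nil; lia.
    by case: y h8 => h8; rewrite sz_cons; [have := sz_bool (b && c) | have := sz_bool (b && ~~ c)]; lia.
  - by pts.
  rewrite /h; apply: (pt_case_seq (X := X * (bool * seq bool) * bool)
    (l := fun p => p.1.2.2) (f := fun _ => (false, [::]))
    (g := fun p z r => (if p.2 then p.1.2.1 && z else p.1.2.1 && ~~ z, r))).
  - by pts.
  - by pts.
  apply: pt_pair; last by pts.
  apply: pt_if; first by pts. 
    by apply: pt_and; pts.
  by apply: pt_and; last apply: pt_neg; pts.
apply: (pt_case_seq (l := fun x => (s x).2) (f := fun x => (s x).1) (g := fun _ _ _ => false)).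
- by apply: pt_snd.
- by apply: pt_fst.
exact: pt_const.
Qed.
End Lists5.

Lemma pt_eq {X} {CX : Code X} (T : eqType) (CT : Code T) (f g : X -> T) :
  ptime f -> ptime g -> ptime (fun x => f x == g x).
Proof.
move=> hf hg; apply: (pt_ext (f := fun x => code (enc (f x)) == code (enc (g x)))).
  by move=> x; apply/eqP/eqP => [/code_inj h | -> //]; exact: enc_inj h.
apply: pt_eqbits; [exact: pt_comp hf pt_bits | exact: pt_comp hg pt_bits].
Qed.

Lemma pt_mem {X} {CX : Code X} (T : eqType) (CT : Code T) (f : X -> T) (l : X -> seq T) :
  ptime f -> ptime l -> ptime (fun x => f x \in l x).
Proof.
move=> hf hl; apply: (pt_ext (f := fun x => has (fun y => f x == y) (l x))).
  by move=> x; rewrite has_sym_eq_mem || (elim: (l x) => //= y s ->; rewrite inE).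
apply: pt_has => //; apply: pt_eq; last by pts.
by apply: (pt_comp pt_fst0).
Qed.

(** A table with one equality test for each element of the finite type. *)
Lemma pt_fin (F : finType) (CF : Code F) U (CU : Code U) (f : F -> U) : ptime f.
Proof.
case: (pickP F) => [x0 _ | no]; last first.
  by apply: Ptime; exists Skip, (fun=> 0); split=> [|x]; [exact: pb_const | have := no x].
apply: (pt_ext (f := foldr (fun y g x => if x == y then f y else g x) (fun=> f x0) (enum F))).
  move=> x; have: x \in enum F by rewrite mem_enum.
  by elim: (enum F) => //= y s IH; rewrite inE; case: eqP => //= ->.
elim: (enum F) => [|y s IH]; first exact: pt_const.
by apply: pt_if => //; [apply: pt_eq; pts | pts].
Qed.

(** ** Arithmetic and indexing *)

Section Arith.
Context {X T : Type} {CX : Code X} {CT : Code T}.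

Lemma pt_iter_nat {U} {CU : Code U} (f : U -> U) (n : X -> nat) (u0 : X -> U) :
  ptime f -> ptime n -> ptime u0 ->
  (exists k, forall x i, i <= n x -> sz (iter i f (u0 x)) <= (sz x + 2) ^ k) ->
  ptime (fun x => iter (n x) f (u0 x)).
Proof.
move=> hf hn hu [k hk].
apply: (pt_ext (f := fun x => iter (size (nseq (n x) tt)) f (u0 x))).
  by move=> x; rewrite size_nseq.
apply: pt_iter => //; first exact: pt_nseq_tt.
by exists k => x i; rewrite size_nseq; exact: hk.
Qed.

Lemma pt_add (f g : X -> nat) : ptime f -> ptime g -> ptime (fun x => f x + g x).
Proof.
move=> hf hg; apply: (pt_ext (f := fun x => iter (f x) succn (g x))).
  by move=> x; rewrite iter_succn addnC.
apply: pt_iter_nat => //; first by pts.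
have [k1 h1] := pt_size hf; have [k2 h2] := pt_size hg.
have [k hk] : pb (fun n => (n + 2) ^ k1 + (n + 2) ^ k2) by pbs.
exists k => x i hi; apply: leq_trans (hk _); have := h1 x; have := h2 x.
by rewrite iter_succn !sz_nat; lia.
Qed.

Lemma pt_sub (f g : X -> nat) : ptime f -> ptime g -> ptime (fun x => f x - g x).
Proof.
move=> hf hg; apply: (pt_ext (f := fun x => iter (g x) predn (f x))).
  by move=> x; rewrite iter_predn.
apply: pt_iter_nat => //.
  apply: (pt_ext (f := fun n => match n with 0 => 0 | m.+1 => m end)); first by case.
  by apply: (pt_case_nat (l := fun n => n) (f := fun=> 0) (g := fun _ n => n)); pts.
have [k1 h1] := pt_size hf.
exists k1 => x i hi; have := h1 x.
by rewrite iter_predn !sz_nat; lia.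
Qed.

Lemma pt_drop (n : X -> nat) (l : X -> seq T) : ptime n -> ptime l -> ptime (fun x => drop (n x) (l x)).
Proof.
move=> hn hl.
have e i (s : seq T) : iter i behead s = drop i s.
  by elim: i => [|i IH]; rewrite ?drop0 // iterS IH -drop1 drop_drop.
apply: (pt_ext (f := fun x => iter (n x) behead (l x))); first by move=> x; rewrite e.
apply: pt_iter_nat => //; first by apply: pt_behead; pts.
have [k1 h1] := pt_size hl; exists k1 => x i hi; apply: leq_trans (h1 x).
by rewrite e sz_drop.
Qed.

Lemma pt_zip {U} {CU : Code U} (l : X -> seq T) (m : X -> seq U) :
  ptime l -> ptime m -> ptime (fun x => zip (l x) (m x)).
Proof.
move=> hl hm.
pose h (a : seq (T * U) * seq U) (y : T) :=
  if a.2 is z :: r then (rcons a.1 (y, z), r) else (a.1, [::]).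
apply: (pt_ext (f := fun x => (foldl h ([::], m x) (l x)).1)).
  move=> x; rewrite -[RHS]/([::] ++ zip (l x) (m x)).
  elim: (l x) (m x) [::] => [|y s IH] [|z r] a /=; rewrite ?cats0 //.
    rewrite /h /=; by elim: s {IH}.
  by rewrite {2}/h /= IH cat_rcons.
apply: pt_fst; apply: (pt_foldl (f := fun _ => h)) => //; first last.
- exists 2 => x [a r] y; rewrite /h /=.
  have h8 := @pow_mono 2 (sz y) (sz x + sz y) (leq_addl _ _).
  have h9 : sz y + 4 <= (sz y + 2) ^ 2 by nia.
  case: r => [|c r]; rewrite !sz_pair ?sz_nil; first by lia.
  by rewrite sz_rcons sz_cons sz_pair; lia.
- by pts.
rewrite /h; apply: (pt_case_seq (X := X * (seq (T * U) * seq U) * T)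
  (l := fun p => p.1.2.2) (f := fun p => (p.1.2.1, [::]))
  (g := fun p z r => (rcons p.1.2.1 (p.2, z), r))); pts.
by apply: pt_rcons; pts.
Qed.

End Arith.

Section Arith2.
Context {X T : Type} {CX : Code X} {CT : Code T}.

Lemma pt_mul (f g : X -> nat) : ptime f -> ptime g -> ptime (fun x => f x * g x).
Proof.
move=> hf hg; apply: (pt_ext (f := fun x => foldl (fun a _ => g x + a) 0 (nseq (f x) tt))).
  move=> x; rewrite -[RHS]addn0; elim: (f x) 0 => //= n IH a.
  by rewrite IH; lia.
apply: (pt_foldl (f := fun x a _ => g x + a)); first last.
- have [k hk] := pt_size hg; exists k => x a u.
  have h : (sz x + 2) ^ k <= (sz x + sz u + 2) ^ k by apply: pow_mono; rewrite leq_addr.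
  by move: (hk x); rewrite !sz_nat; lia.
- exact: pt_nseq_tt.
- exact: pt_const.
apply: pt_add; last by pts.
by apply: (pt_comp (f := fun p : X * nat * unit => p.1.1)); pts.
Qed.

Lemma pt_take (n : X -> nat) (l : X -> seq T) : ptime n -> ptime l -> ptime (fun x => take (n x) (l x)).
Proof.
move=> hn hl; apply: (pt_ext (f := fun x => [seq p.2 | p <- zip (nseq (n x) tt) (l x)])).
  by move=> x; elim: (l x) (n x) => [|y s IH] [|m] //=; rewrite IH.
apply: (pt_map (f := fun _ p => p.2)); first by pts.
by apply: pt_zip => //; exact: pt_nseq_tt.
Qed.

Lemma pt_leq (f g : X -> nat) : ptime f -> ptime g -> ptime (fun x => f x <= g x).
Proof. by move=> hf hg; apply: pt_eq; [exact: pt_sub | exact: pt_const]. Qed.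

Lemma pt_nseq (n : X -> nat) (y : T) : ptime n -> ptime (fun x => nseq (n x) y).
Proof.
move=> hn; apply: (pt_ext (f := fun x => [seq y | _ <- nseq (n x) tt])).
  by move=> x; elim: (n x) => //= m ->.
by apply: (pt_map (f := fun _ _ => y)); [exact: pt_const | exact: pt_nseq_tt].
Qed.

Lemma pt_iota0 (n : X -> nat) : ptime n -> ptime (fun x => iota 0 (n x)).
Proof.
move=> hn.
pose h (a : seq nat * nat) := (rcons a.1 a.2, a.2.+1).
have hi i : iter i h ([::], 0) = (iota 0 i, i).
  elim: i => // i IH; rewrite iterS IH; congr (_, _).
  by rewrite -[in RHS]addn1 iotaD cats1.
apply: (pt_ext (f := fun x => (iter (n x) h ([::], 0)).1)).
  by move=> x; rewrite hi.
apply: pt_fst; apply: pt_iter_nat => //.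
- by rewrite /h; pts; apply: pt_rcons; pts.
- exact: pt_const.
have [k hk] := pt_size hn.
have [k' hk'] : pb (fun m => (m + 2) ^ k * (2 * (m + 2) ^ k + 2) + 1 + 2 * (m + 2) ^ k + 3) by pbs.
exists k' => x i h1; apply: leq_trans (hk' _); rewrite hi sz_pair sz_nat.
have h2 := hk x; rewrite sz_nat in h2.
set P := (sz x + 2) ^ k in h2 *.
have h3 m s : m + s <= P -> sz (iota m s) <= s * (2 * P + 2) + 1.
  elim: s m => [|s IH] m hm; first by rewrite sz_nil.
  by rewrite /= sz_cons sz_nat; have := IH m.+1; rewrite mulSn; lia.
have h4 : i * (2 * P + 2) <= P * (2 * P + 2) by rewrite leq_mul2r; lia.
by have := h3 0 i; lia.
Qed.

Lemma pt_expn (f : X -> nat) k : ptime f -> ptime (fun x => f x ^ k).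
Proof.
move=> hf; elim: k => [|k IH]; first exact: pt_const.
by apply: (pt_ext (f := fun x => f x * f x ^ k)); [move=> x; rewrite expnS | exact: pt_mul].
Qed.

Lemma pt_horner (p : {poly nat}) (f : X -> nat) : ptime f -> ptime (fun x => p.[f x]%R).
Proof.
move=> hf; rewrite /horner; elim: (polyseq p) => [|a s IH] /=; first exact: pt_const.
by apply: pt_add; [apply: pt_mul | exact: pt_const].
Qed.

End Arith2.

Lemma horner_nat_mono (p : {poly nat}) m n : m <= n -> p.[m]%R <= p.[n]%R.
Proof.
move=> h; rewrite /horner; elim: (polyseq p) => //= a s IH.
by apply: leq_add => //; apply: leq_mul.
Qed.

Lemma horner_nat_bound (p : {poly nat}) : exists k, forall n, p.[n]%R <= (n + 2) ^ k.
Proof.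
suff : pb (fun n => p.[n]%R) by [].
rewrite /horner; elim: (polyseq p) => [|a s IH] /=; first exact: pb_const.
by apply: pb_add (pb_mul IH pb_id) (pb_const a).
Qed.

Definition pow_poly k : {poly nat} := (('X + 2%:P) ^+ k)%R.

Lemma pow_polyE k n : ((pow_poly k).[n])%R = (n + 2) ^ k.
Proof.
rewrite /pow_poly; elim: k => [|k IH]; first by rewrite GRing.expr0 hornerC.
by rewrite GRing.exprS hornerM IH hornerD hornerX hornerC expnS.
Qed.

(** ** Raw bit strings *)

Lemma sz_bits (x : seq bool) : sz x <= 4 * size x + 1.
Proof. by elim: x => //= b x IH; rewrite sz_cons; have := sz_bool b; lia. Qed.

(** A Turing machine receives a bare string and must return one, whereas [ptime] speaks of coded
    values: [lin] encodes the string in place and [lout] decodes the result. *)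
Lemma pt_raw (f : seq bool -> seq bool) : ptime f ->
  exists c k, forall x, runs c (St x [::] [::] [::]) ((size x + 2) ^ k) (St (f x) [::] [::] [::]).
Proof.
move=> hf; have [cf [kf Hf]] := ptimeE hf; have [k hk] := pt_size hf.
pose lin := Push R2 false ;;
  While R0 isbit (If R0 istrue (Push R2 true) (Push R2 false) ;; Pop R0 ;; Push R2 true) ;;
  Push R0 false ;;
  unload (Push R0 false ;; Push R0 false ;; Push R0 true ;; Push R0 true)
         (Push R0 false ;; Push R0 true).
pose lout := Push R2 false ;;
  While R0 istrue (Pop R0 ;;
     If R0 istrue (Pop R0 ;; Pop R0 ;; Pop R0 ;; Push R2 true) (Pop R0 ;; Push R2 false) ;;
     Push R2 true) ;;
  Pop R0 ;; put0.
have Hin x : runs lin (St x [::] [::] [::]) (100 * size x + 100)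
    (St (code (@enc _ (@code_seq _ code_bool) x)) [::] [::] [::]).
  pose F (b : bool) a := true :: code (@enc _ code_bool b) ++ a.
  apply: runs_le.
    xstep; eapply runs_seq.
      have : forall z, runs (While R0 isbit (If R0 istrue (Push R2 true) (Push R2 false) ;;
        Pop R0 ;; Push R2 true)) (St x [::] z [::]) (5 * size x + 1) (St [::] [::] (pushm x z) [::]).
        elim: x => [|b x IH] z; first by exact: runs_whileF.
        apply: runs_le.
          eapply runs_whileT => //.
            eapply (@runs_seq _ _ _ 2 (St (b :: x) [::] (b :: z) [::])).
              by case: b; [apply: runs_ifT | apply: runs_ifF] => //; xstep.
            by rewrite /=; xstep; xstep.
          exact: (IH (true :: b :: z)).
        by rewrite /=; lia.
      exact.
    xstep.
    have := @runs_unload (Push R0 false ;; Push R0 false ;; Push R0 true ;; Push R0 true)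
       (Push R0 false ;; Push R0 true) F (fun _ a => a) 4 _ x [:: false] [::] [::] [::].
    rewrite foldr_id.
    have -> : foldr F [:: false] x = code (@enc _ (@code_seq _ code_bool) x).
      by elim: x => //= b l ->.
    apply; case=> * /=.
      by apply: runs_le; [xstep; xstep; xstep; xstep | by []].
    by apply: runs_le; [xstep; xstep | by []].
  by lia.
have Hout x : runs lout (St (code (@enc _ (@code_seq _ code_bool) x)) [::] [::] [::])
    (100 * size x + 100) (St x [::] [::] [::]).
  apply: runs_le.
    xstep; eapply runs_seq.
      have : forall z, runs (While R0 istrue (Pop R0 ;;
        If R0 istrue (Pop R0 ;; Pop R0 ;; Pop R0 ;; Push R2 true) (Pop R0 ;; Push R2 false) ;;
        Push R2 true)) (St (code (@enc _ (@code_seq _ code_bool) x)) [::] z [::]) (8 * size x + 1)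
          (St [:: false] [::] (pushm x z) [::]).
        elim: x => [|b x IH] z; first by exact: runs_whileF.
        apply: runs_le.
          eapply runs_whileT => //.
            rewrite /=; xstep.
            eapply (@runs_seq _ _ _ 5 (St (code (enc_list x)) [::] (b :: z) [::])).
              case: b; [apply: runs_ifT | apply: runs_ifF] => //=.
                by apply: runs_le; [xstep; xstep; xstep; xstep | by []].
              by apply: runs_le; [xstep; xstep | by []].
            by rewrite /=; xstep.
          exact: (IH (true :: b :: z)).
        by rewrite /=; lia.
      exact.
    xstep; rewrite /=.
    by have := runs_put0 x [::] [::] [::] [::]; rewrite cats0; exact.
  by lia.
have [k' hk'] : pb (fun n => 100 * n + 100 + ((4 * n + 1 + 2) ^ kf +
    (100 * (4 * n + 1 + 2) ^ k + 100))) by pbs.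
exists (lin ;; cf ;; lout), k' => x; apply: runs_le (hk' _).
have hx := sz_bits x.
eapply runs_seq; first exact: Hin.
eapply runs_seq.
  have := Hf x [::] [::] [::] [::]; rewrite cats0 cats0 => h; apply: runs_le h _.
  exact: pow_mono.
apply: runs_le; first exact: Hout.
have h1 := hk x; have h2 : size (f x) < sz (f x) by exact: size_sz.
by have := @pow_mono k _ _ hx; lia.
Qed.

(** * Flat stack machines *)

Inductive ins (Q : Type) :=
| IPush of reg & bool & Q
| IPop of reg & Q
| IIf of reg & (option bool -> bool) & Q & Q.

Definition ins_map Q Q' (f : Q -> Q') (i : ins Q) : ins Q' :=
  match i with
  | IPush r b q => IPush r b (f q)
  | IPop r q => IPop r (f q)
  | IIf r p q1 q2 => IIf r p (f q1) (f q2)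
  end.

(** [None] is the exit. *)
Record machine := Machine {
  mst : finType;
  mstart : option mst;
  mins : mst -> ins (option mst) }.

Definition istep Q (i : ins Q) (s : store) : Q * store :=
  match i with
  | IPush r b q => (q, set s r (b :: get s r))
  | IPop r q => (q, set s r (behead (get s r)))
  | IIf r p q1 q2 => (if p (ohead (get s r)) then q1 else q2, s)
  end.

Lemma istep_map Q Q' (f : Q -> Q') i s :
  istep (ins_map f i) s = (f (istep i s).1, (istep i s).2).
Proof. by case: i => //= r p q1 q2; case: ifP. Qed.

Inductive mpath (m : machine) : nat -> option (mst m) -> store -> option (mst m) -> store -> Prop :=
| MP0 q s : mpath 0 q s q s
| MPS n q s q' s' :
    mpath n (istep (mins q) s).1 (istep (mins q) s).2 q' s' -> mpath n.+1 (Some q) s q' s'.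

Lemma mpath_cat m n1 n2 (q1 q2 q3 : option (mst m)) s1 s2 s3 :
  mpath n1 q1 s1 q2 s2 -> mpath n2 q2 s2 q3 s3 -> mpath (n1 + n2) q1 s1 q3 s3.
Proof.
by move=> h; elim: h n2 q3 s3 => // n q s q' s' _ IH n2 q3 s3 h2; apply: MPS; exact: IH.
Qed.

Lemma mpath_map m m' (f : option (mst m) -> option (mst m')) :
  (forall q, exists2 q', f (Some q) = Some q' & mins q' = ins_map f (mins q)) ->
  forall n q s q' s', mpath n q s q' s' -> mpath n (f q) s (f q') s'.
Proof.
move=> hf n q s q' s'; elim=> {n q s q' s'} [q s|n q s q' s' _ IH]; first exact: MP0.
by have [p -> e] := hf q; apply: MPS; rewrite e istep_map.
Qed.

(** The exit of the first machine is redirected to the entry of the second, which may itself be the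
    exit, as for [Skip]. *)
Definition seq_l m1 m2 (o : option (mst m1)) : option (mst m1 + mst m2) :=
  if o is Some q then Some (inl q) else omap inr (mstart m2).

Fixpoint compile (c : cmd) : machine :=
  match c with
  | Skip => @Machine void None (fun q => match q with end)
  | Push r b => @Machine unit (Some tt) (fun=> IPush r b None)
  | Pop r => @Machine unit (Some tt) (fun=> IPop r None)
  | Seq c1 c2 =>
      let m1 := compile c1 in let m2 := compile c2 in
      @Machine (mst m1 + mst m2)%type (seq_l m2 (mstart m1))
        (fun q => match q with
                  | inl q1 => ins_map (@seq_l m1 m2) (mins q1)
                  | inr q2 => ins_map (omap inr) (mins q2)
                  end)
  | If r p c1 c2 =>
      let m1 := compile c1 in let m2 := compile c2 in
      let f1 := omap (fun q => Some (inl q)) in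
      let f2 := omap (fun q => Some (inr q)) in
      @Machine (option (mst m1 + mst m2)) (Some None)
        (fun q => match q with
                  | None => IIf r p (f1 (mstart m1)) (f2 (mstart m2))
                  | Some (inl q1) => ins_map f1 (mins q1)
                  | Some (inr q2) => ins_map f2 (mins q2)
                  end)
  | While r p c =>
      let m := compile c in
      @Machine (option (mst m)) (Some None)
        (fun q => match q with
                  | None => IIf r p (Some (mstart m)) None
                  | Some q => ins_map (fun o => Some o) (mins q)
                  end)
  end.

(** The costs in [exec] are chosen so that each rule charges exactly the flat instructions it
    executes; hence [t] is the exact length of the path. *)
Lemma compile_correct c s t s' :
  exec c s t s' -> mpath t (mstart (compile c)) s None s'.
Proof.
elim=> {c s t s'} //=.
- by move=> s; exact: MP0.
- by move=> r b s; apply: MPS; exact: MP0.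
- by move=> r s; apply: MPS; exact: MP0.
- move=> c1 c2 s t1 s' t2 s'' _ h1 _ h2; eapply mpath_cat.
    by apply: (mpath_map (m' := compile (c1 ;; c2)) (f := @seq_l _ (compile c2)) _ h1) => q; eexists.
  by apply: (mpath_map (m' := compile (c1 ;; c2)) (f := omap inr) _ h2) => q; eexists.
- move=> r p c1 c2 s t s' hp _ h; apply: MPS => /=; rewrite hp.
  by apply: (mpath_map (m' := compile (If r p c1 c2)) (f := omap (fun q => Some (inl q))) _ h) => q; eexists.
- move=> r p c1 c2 s t s' /negbTE hp _ h; apply: MPS => /=; rewrite hp.
  by apply: (mpath_map (m' := compile (If r p c1 c2)) (f := omap (fun q => Some (inr q))) _ h) => q; eexists.
- move=> r p c s t1 s' t2 s'' hp _ h1 _ h2; apply: MPS => /=; rewrite hp.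
  eapply mpath_cat; last exact: h2.
  by apply: (mpath_map (m' := compile (While r p c)) (f := fun o => Some o) _ h1) => q; eexists.
- by move=> r p c s /negbTE hp; apply: MPS => /=; rewrite hp; exact: MP0.
Qed.

(** * From stack machines to Turing machines *)

Definition idx (r : reg) : 'I_4 :=
  match r with R0 => inord 0 | R1 => inord 1 | R2 => inord 2 | R3 => inord 3 end.

Definition reg_eqb (r r' : reg) :=
  match r, r' with R0, R0 | R1, R1 | R2, R2 | R3, R3 => true | _, _ => false end.

Lemma idx_eq r r' : (idx r == idx r') = reg_eqb r r'.
Proof. by case: r; case: r'; rewrite -val_eqE /= !inordK. Qed.

Lemma idx0 : idx R0 = ord0.
Proof. by apply: val_inj; rewrite /= inordK. Qed.

Definition vcell := cell void.

Definition cell_bit (c : vcell) : option bool := if c is Some (inl b) then Some b else None.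

(** A push takes two steps, hence the flag: the head moves left and then writes. *)
Definition tm_trans (m : machine) (q : option (mst m) * bool) (v : {ffun 'I_4 -> vcell}) :
    (option (mst m) * bool) * {ffun 'I_4 -> vcell * move} :=
  if q.1 is Some q1 then
    match mins q1 with
    | IPush r b q' =>
        if q.2 then
          ((q', false), [ffun i => (if i == idx r then Some (inl b) else v i, Stay)])
        else ((Some q1, true), [ffun i => (v i, if i == idx r then MoveLeft else Stay)])
    | IPop r q' =>
        ((q', false), [ffun i => if i == idx r then (None, MoveRight) else (v i, Stay)])
    | IIf r p q1 q2 =>
        ((if p (cell_bit (v (idx r))) then q1 else q2, false), [ffun i => (v i, Stay)])
    end
  else (q, [ffun i => (v i, Stay)]).

Definition tm_of (m : machine) : TM :=
  {| ntapes := 3; state := (option (mst m) * bool)%type; work := void;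
     start := (mstart m, false); halting := fun q => q.1 == None;
     trans := @tm_trans m |}.

(** The top of the stack is under the head and the stack extends to the right, possibly followed by
    blanks. The cells on the left are arbitrary, since a push overwrites the one it enters. *)
Definition holds_bits (t : tape void) (l : seq bool) :=
  exists j, scanned t :: rcells t = [seq Some (inl b) | b <- l] ++ nseq j None.

Lemma holds_bits_input x : holds_bits (input_tape void x) x.
Proof.
case: x => [|b x]; first by exists 1.
by exists 0; rewrite /input_tape /= cats0.
Qed.

Lemma holds_bits_top t l : holds_bits t l -> cell_bit (scanned t) = ohead l.
Proof. by case: l => [|b l] [[|j]] //= [-> _]. Qed.

Lemma holds_bits_pop t l : holds_bits t l -> holds_bits (act t (None, MoveRight)) (behead l).
Proof.
case: t => lc c rc; case: l => [|b l] [j] /=.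
  case: j => [|j] //= [_ ->]; exists (j.-1).+1.
  by case: j.
case=> _ ->; case: l => [|b' l] /=; last by exists j.
by exists (j.-1).+1; case: j.
Qed.

Lemma holds_bits_stay t l : holds_bits t l -> holds_bits (act t (scanned t, Stay)) l.
Proof. by case: t. Qed.

Lemma holds_bits_push t l b : holds_bits t l ->
  holds_bits (act (act t (scanned t, MoveLeft)) (Some (inl b), Stay)) (b :: l).
Proof. by case: t => lc c rc [j] /= h; exists j; rewrite /= h. Qed.

Definition tm_rep (m : machine) (c : config (tm_of m)) (q : option (mst m)) (s : store) :=
  c.1 = (q, false) /\ forall r, holds_bits (c.2 (idx r)) (get s r).

Lemma get_set s r r' v : get (set s r v) r' = if reg_eqb r' r then v else get s r'.
Proof. by case: r; case: r'. Qed.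

Lemma tm_sim m (c : config (tm_of m)) (q : mst m) s :
  tm_rep c (Some q) s -> exists2 k, k <= 2 &
    tm_rep (iter k (@step (tm_of m)) c) (istep (mins q) s).1 (istep (mins q) s).2.
Proof.
case: c => -[q' ph] ts [/= [-> ->] h].
case e : (mins q) => [r b q1 | r q1 | r p q1 q2].
- exists 2 => //; rewrite /tm_rep /=.
  rewrite /step /= /tm_trans /= e /= e /=; split=> // r'.
  rewrite !ffunE get_set idx_eq; case er : (reg_eqb r' r).
    have -> : r = r' by case: r er {e}; case: r'.
    exact: holds_bits_push.
  exact: (holds_bits_stay (holds_bits_stay (h r'))).
- exists 1 => //; rewrite /tm_rep /=.
  rewrite /step /= /tm_trans /= e /=; split=> // r'.
  rewrite !ffunE get_set idx_eq; case er : (reg_eqb r' r).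
    have -> : r = r' by case: r er {e}; case: r'.
    exact: holds_bits_pop.
  exact: holds_bits_stay.
- exists 1 => //; rewrite /tm_rep /=.
  rewrite /step /= /tm_trans /= e /=; split=> [|r'].
    by rewrite ffunE (holds_bits_top (h r)).
  by rewrite !ffunE; apply: holds_bits_stay.
Qed.

Lemma tm_path m n (q q' : option (mst m)) s s' : mpath n q s q' s' ->
  forall c : config (tm_of m), tm_rep c q s ->
  exists2 k, k <= n.*2 & tm_rep (iter k (@step (tm_of m)) c) q' s'.
Proof.
elim=> {n q s q' s'} [q s c h|n q s q' s' _ IH c h]; first by exists 0.
have [k1 l1 h1] := tm_sim h; have [k2 l2 h2] := IH _ h1.
exists (k2 + k1); first by rewrite doubleS; lia.
by rewrite iterD.
Qed.

Lemma leading_bitsE (l : seq bool) j :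
  leading_bits ([seq (Some (inl b) : vcell) | b <- l] ++ nseq j None) = l.
Proof. by elim: l => [|b l IH] /=; [case: j | rewrite IH]. Qed.

Theorem ptime_polytime (f : seq bool -> seq bool) : ptime f -> polytime f.
Proof.
(* One flat instruction takes at most two moves of the Turing machine; the factor 2 is paid by
   raising the exponent by one. *)
move=> /pt_raw [c [k h]]; exists (tm_of (compile c)), (pow_poly k.+1) => x.
rewrite pow_polyE /=.
have [t ht /compile_correct /tm_path hp] := h x.
have [|n hn [h1 h2]] := hp (initial (tm_of (compile c)) x).
  split=> // r; rewrite ffunE.
  have -> : (if idx r == ord0 then x else [::]) = get (St x [::] [::] [::]) r.
    by rewrite -idx0 idx_eq; case: r.
  exact: holds_bits_input.
set c' := iter n _ _ in h1 h2.
have hle : n <= (size x + 2) ^ k.+1.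
  apply: leq_trans hn _; rewrite -mul2n expnS; apply: leq_mul => //.
  by rewrite addn2.
have stay j : iter j (@step (tm_of (compile c))) c' = c'.
  by elim: j => //= j ->; rewrite /step h1.
rewrite -(subnK hle) iterD -/c' stay; split; first by rewrite h1.
by have [j hj] := h2 R0; rewrite /output -idx0 hj leading_bitsE.
Qed.

(** * Simulating Turing machines *)

Lemma fin_bound (F : finType) (g : F -> nat) : exists K, forall x, g x <= K.
Proof. by exists (\max_(x : F) g x) => x; apply: leq_bigmax. Qed.

Lemma pt_lookup {T : eqType} {CT : Code T} U {CU : Code U} (keys : seq T) (f : T -> U)
    (d : T -> U) : ptime d -> ptime (fun x => if x \in keys then f x else d x).
Proof.
move=> hd; elim: keys => [|y s IH] //=.
apply: (pt_ext (f := fun x => if x == y then f y else if x \in s then f x else d x)).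
  by move=> x; rewrite inE; case: eqP => [->|].
by apply: pt_if => //; [apply: pt_eq; pts | pts].
Qed.

Section Simulation.
Variable M : TM.

Local Notation C := (option (bool + work M))%type.
Local Instance code_C : Code C := code_fin C.
Local Instance code_D : Code (option bool) := code_fin (option bool).
Local Instance code_Q : Code (state M) := code_fin (state M).

Local Notation ttape := (seq C * C * seq C)%type.

Let tact (t : ttape) (a : C * option bool) : ttape :=
  match a.2 with
  | None => (t.1.1, a.1, t.2)
  | Some b => if b then (a.1 :: t.1.1, head None t.2, behead t.2)
              else (behead t.1.1, head None t.1.1, a.1 :: t.2)
  end.

(** Directions are recoded in a finite type, to which the codes and tables above apply. *)
Let dir (d : move) : option bool :=
  match d with MoveLeft => Some false | Stay => None | MoveRight => Some true end.

Let t_of (t : tape (work M)) : ttape := (lcells t, scanned t, rcells t).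

Lemma tact_act t a : t_of (act t a) = tact (t_of t) (a.1, dir a.2).
Proof. by case: t a => l c r [b []] //=; rewrite /act /tact /=; [case: l | case: r]. Qed.

Let tab (x : state M * seq C) : state M * seq (C * option bool) :=
  let v := [ffun i : 'I_(ntapes M).+1 => nth None x.2 i] in
  if halting x.1 then (x.1, [seq (c, None) | c <- x.2]) else
  ((trans x.1 v).1, [seq (((trans x.1 v).2 i).1, dir ((trans x.1 v).2 i).2) | i <- enum 'I_(ntapes M).+1]).

Let keys : seq (state M * seq C) :=
  [seq (q, tval t) | q <- enum (state M), t <- enum {: (ntapes M).+1.-tuple C}].

(** Lists of scanned cells with one entry per tape are finite in number, so on [keys] the transition
    function is a finite table; all other arguments get a default value. *)
Let ktab (x : state M * seq C) : state M * seq (C * option bool) := if x \in keys then tab x else (x.1, [::]).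

Let tstep (c : state M * seq ttape) : state M * seq ttape :=
  let r := ktab (c.1, [seq t.1.2 | t <- c.2]) in
  (r.1, [seq tact p.1 p.2 | p <- zip c.2 r.2]).

Let c_of (c : config M) : state M * seq ttape :=
  (c.1, [seq t_of (c.2 i) | i <- enum 'I_(ntapes M).+1]).

Lemma tstep_step c : c_of (step c) = tstep (c_of c).
Proof.
case: c => q ts; rewrite /tstep /c_of /=.
set v := (X in ktab (_, X)).
have ev : v = [seq scanned (ts i) | i <- enum 'I_(ntapes M).+1] by rewrite /v -map_comp.
have sv : size v == (ntapes M).+1 by rewrite ev size_map size_enum_ord.
have -> : ktab (q, v) = tab (q, v).
  rewrite /ktab ifT //; apply/allpairsP; exists (q, Tuple sv).
  by rewrite /= !mem_enum.
rewrite /tab /step /=; case: ifP => _ /=.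
  congr (_, _); rewrite ev; move: (enum _) => e.
  rewrite -map_comp zip_map -map_comp; apply: eq_map => i /=.
  by rewrite /tact /t_of.
have -> : [ffun i : 'I_(ntapes M).+1 => nth None v i] = [ffun i => scanned (ts i)].
  apply/ffunP => i; rewrite !ffunE ev (nth_map i) ?size_enum_ord //.
  by rewrite nth_ord_enum.
congr (_, _); move: (enum _) => e.
rewrite zip_map -map_comp; apply: eq_map => i /=.
by rewrite ffunE tact_act.
Qed.

Lemma pt_tact : ptime (fun p : ttape * (C * option bool) => tact p.1 p.2).
Proof.
pose F := (C * option bool)%type.
pose stay (a : F) := a.2 == None; pose right (a : F) := a.2 == Some true.
have h1 : ptime stay by exact: pt_fin.
have h2 : ptime right by exact: pt_fin.
pose G (p : ttape * F) : ttape := if stay p.2 then (p.1.1.1, p.2.1, p.1.2) else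
   if right p.2 then (p.2.1 :: p.1.1.1, head None p.1.2, behead p.1.2)
   else (behead p.1.1.1, head None p.1.1.1, p.2.1 :: p.1.2).
apply: (pt_ext (f := G)); first by move=> [t [c [[]|]]].
apply: pt_if; first by apply: pt_comp h1; pts.
  by pts.
apply: pt_if; first by apply: pt_comp h2; pts.
  by pts; [apply: pt_head; pts | apply: pt_behead; pts].
by pts; [apply: pt_behead; pts | apply: pt_head; pts].
Qed.

Lemma pt_tstep : ptime tstep.
Proof.
have hk : ptime ktab by apply: pt_lookup; pts.
have hr : ptime (fun c : state M * seq ttape => ktab (c.1, [seq t.1.2 | t <- c.2])).
  apply: (pt_comp _ hk); pts; apply: (pt_map (f := fun _ t => t.1.2)); pts.
apply: pt_pair; first by apply: pt_fst.
apply: (pt_map (f := fun _ p => tact p.1 p.2)).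
  by apply: pt_comp pt_tact; pts.
by apply: pt_zip; [pts | apply: pt_snd].
Qed.

(** A step lengthens a configuration by at most a constant, so all configurations of a polynomial
    run have polynomial size, as [pt_iter] requires. *)
Lemma sz_tstep : exists K, forall c, sz (tstep c) <= sz c + K.
Proof.
have [Kq hq] : exists K, forall q : state M, sz q <= K by exact: fin_bound.
have [Kc hc] : exists K, forall c : C, sz c <= K by exact: fin_bound.
have ht t a : sz (tact t a) <= sz t + (2 * Kc + 3).
  have hh (s : seq C) : sz (head None s) <= Kc by exact: hc.
  have hb (s : seq C) : sz (behead s) <= sz s by case: s => [|c s] //=; rewrite sz_cons; lia.
  case: t a => -[l c] r [b [[]|]]; rewrite /tact /= !sz_pair ?sz_cons.
  - by move: (hc b) (hh r) (hb r); lia.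
  - by move: (hc b) (hh l) (hb l); lia.
  - by move: (hc b); lia.
have hz l m : sz [seq tact p.1 p.2 | p <- zip l m] <= sz l + size m * (2 * Kc + 3).
  elim: l m => [|t l IH] [|a m] //=; rewrite ?sz_nil ?sz_cons; try by lia.
  by rewrite mulSn; move: (IH m) (ht t a); lia.
exists (Kq + (ntapes M).+1 * (2 * Kc + 3)) => -[q l]; rewrite /tstep /=.
set r := ktab _; rewrite !sz_pair.
have hs : size r.2 <= (ntapes M).+1.
  rewrite /r /ktab; case: ifP => // /allpairsP [[q' t] [_ _ [e1 e2]]].
  rewrite /tab; case: ifP => _ /=; last by rewrite size_map size_enum_ord.
  by rewrite size_map e2 size_tuple.
have h5 : size r.2 * (2 * Kc + 3) <= (ntapes M).+1 * (2 * Kc + 3) by rewrite leq_mul2r hs orbT.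
by move: (hz l r.2) (hq r.1); lia.
Qed.

Let lead (s : seq C) : bool * seq bool :=
  foldl (fun a (c : C) => if a.1 && isbit (if c is Some (inl b) then Some b else None)
         then (true, rcons a.2 (istrue (if c is Some (inl b) then Some b else None)))
         else (false, a.2)) (true, [::]) s.

Lemma leadE s : (lead s).2 = leading_bits s.
Proof.
rewrite /lead -[RHS]/([::] ++ leading_bits s).
have stop : forall s l, (foldl (fun a (c : C) => if a.1 && isbit (if c is Some (inl b) then Some b else None)
         then (true, rcons a.2 (istrue (if c is Some (inl b) then Some b else None)))
         else (false, a.2)) (false, l) s).2 = l by elim.
elim: s [::] => [|[[b|w]|] s IH] l /=; rewrite ?cats0 ?stop //.
by rewrite IH cat_rcons; case: b.
Qed.

Lemma pt_leading : ptime (fun s : seq C => leading_bits s).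
Proof.
apply: (pt_ext (f := fun s => (lead s).2)); first by move=> s; rewrite leadE.
apply: pt_snd; apply: (pt_foldl (X := seq C) (f := fun _ a (c : C) =>
  if a.1 && isbit (if c is Some (inl b) then Some b else None)
         then (true, rcons a.2 (istrue (if c is Some (inl b) then Some b else None)))
         else (false, a.2)) (l := fun s => s)); [|by pts|by pts|].
  have h1 : ptime (fun c : C => isbit (if c is Some (inl b) then Some b else None)) by exact: pt_fin.
  have h2 : ptime (fun c : C => istrue (if c is Some (inl b) then Some b else None)) by exact: pt_fin.
  apply: pt_if; first by apply: pt_and; [pts | apply: pt_comp h1; pts].
    by pts; apply: pt_rcons; [pts | apply: pt_comp h2; pts].
  by pts.
exists 3 => x [b l] c.
have h8 : (0 + 2) ^ 3 <= (sz x + sz c + 2) ^ 3 by exact: pow_mono.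
have hb (d : bool) : sz d <= 3 by exact: sz_bool.
have hp : 0 < sz b by exact: sz_gt0.
case: ifP => _; rewrite !sz_pair ?sz_rcons /=.
  by set d := istrue _; move: hp (hb true) (hb d); lia.
by move: hp (hb false); lia.
Qed.

Lemma pt_simulate (p : {poly nat}) (f : seq bool -> seq bool) :
  (forall x : seq bool,
    let c := iter (p.[size x])%R (@step M) (initial M x) in
    halting c.1 /\ output c = f x) -> ptime f.
Proof.
move=> h.
pose c0 (x : seq bool) : state M * seq ttape :=
  let u : seq C := [seq Some (inl b) | b <- x] in
  (start M, ([::], head None u, behead u) :: nseq (ntapes M) ([::], None, [::])).
have e0 x : c_of (initial M x) = c0 x.
  rewrite /c_of /initial /c0 /= enum_ordSl /= ffunE /=; congr (_, _ :: _).
    by rewrite /input_tape /t_of /=; case: x.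
  rewrite -map_comp -[ntapes M in RHS]size_enum_ord; elim: (enum _) => //= i s ->.
  by rewrite ffunE.
have ei x i : c_of (iter i (@step M) (initial M x)) = iter i tstep (c0 x).
  by elim: i => [|i IH]; rewrite ?e0 // !iterS tstep_step IH.
have h0 : ptime c0.
  have hu : ptime (fun x : seq bool => [seq Some (inl b) : C | b <- x]).
    apply: (pt_map (f := fun _ b => Some (inl b) : C)); last by pts.
    by apply: (pt_comp (g := fun b : bool => Some (inl b) : C) pt_snd0); exact: pt_fin.
  by pts; [apply: pt_head | apply: pt_behead].
pose out (c : state M * seq ttape) :=
  let t := head ([::], None, [::]) c.2 in leading_bits (t.1.2 :: t.2).
apply: (pt_ext (f := fun x => out (iter (p.[size x])%R tstep (c0 x)))).
  move=> x; rewrite -ei; have [_ <-] := h x.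
  by rewrite /out /c_of /output /= enum_ordSl.
have hout : ptime out.
  have hh : ptime (fun c : state M * seq ttape => head ([::], None, [::]) c.2).
    by apply: pt_head; pts.
  by apply: pt_comp pt_leading; pts.
apply: pt_comp hout; apply: pt_iter_nat => //.
- exact: pt_tstep.
- by apply: pt_horner; apply: pt_nsize; pts.
have [K hK] := sz_tstep; have [k hk] := pt_size h0; have [k' hk'] := horner_nat_bound p.
have [k2 hk2] : pb (fun n => (n + 2) ^ k + (n + 2) ^ k' * K) by pbs.
exists k2 => x i hi; apply: leq_trans (hk2 _).
have h1 : sz (iter i tstep (c0 x)) <= sz (c0 x) + i * K.
  elim: i {hi} => [|i IH]; first by rewrite addn0.
  by rewrite iterS mulSn; move: (hK (iter i tstep (c0 x))); lia.
apply: leq_trans h1 _; apply: leq_add; first exact: hk.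
rewrite leq_mul2r; apply/orP; right; apply: leq_trans hi _; apply: leq_trans (hk' _) _.
by apply: pow_mono; apply: ltnW; exact: size_sz.
Qed.

End Simulation.

Theorem polytime_ptime (f : seq bool -> seq bool) : polytime f -> ptime f.
Proof. by case=> M [p h]; exact: pt_simulate h. Qed.

(** * The propositional clauses of a machine run *)

(** A clause [(N, P)] is the disjunction of the negated variables of [N] and of
    the variables of [P]; the empty name is a dummy that satisfies no literal. *)
Definition var : Type := seq nat.
Definition clause : Type := (seq var * seq var)%type.

Definition csat (beta : var -> bool) (c : clause) : bool :=
  has (fun v => (v != [::]) && ~~ beta v) c.1 || has (fun v => (v != [::]) && beta v) c.2.

(** Every clause is brought to three negative and two positive slots, by repetition or by the dummy
    name, so that a single predicate of five arguments can hold it. *)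
Definition hcl (a b c d : var) : clause := ([:: a; b; c], [:: d; d]).
Definition ocl (a b : var) : clause := ([:: [::]; [::]; [::]], [:: a; b]).
Definition ncl (a b : var) : clause := ([:: a; b; b], [:: [::]; [::]]).

Definition reg_num (r : reg) : nat := match r with R0 => 0 | R1 => 1 | R2 => 2 | R3 => 3 end.
Definition num_reg (n : nat) : reg := match n with 0 => R0 | 1 => R1 | 2 => R2 | _ => R3 end.
Definition regs := [:: R0; R1; R2; R3].
Definition bit_num (o : option bool) : nat :=
  match o with None => 0 | Some false => 1 | Some true => 2 end.

Lemma reg_numK : cancel reg_num num_reg.
Proof. by case. Qed.

HB.instance Definition _ := Equality.copy reg (can_type reg_numK).

Definition rdiff (r : reg) := [seq r' <- regs | ~~ reg_eqb r' r].

Section Clauses.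
Variable m : machine.
Notation Q := (option (mst m)).

Definition state_num (q : Q) : nat := enum_rank q.

(** Time [t], stack [r]: a stack is a pointer to a heap cell [d], whose bit and
    lower neighbour never change.  The cells [0 .. n-1] are the input, [n] is the
    bottom, and a push at time [t] allocates the cell [n + 1 + t].  As nothing is
    ever overwritten, a run is described by Horn clauses. *)
Definition vQ t (q : Q) : var := [:: 0; t; state_num q].
Definition vP t r d : var := [:: 1; t; reg_num r; d].
Definition vB o d : var := [:: 2; bit_num o; d].
Definition vL d d' : var := [:: 3; d; d'].
Definition vU i : var := [:: 4; i].

(** Frame axioms for the stacks that an instruction leaves alone. *)
Definition keep N t q rs : seq clause :=
  [seq hcl (vQ t q) (vQ t q) (vP t r d) (vP t.+1 r d) | r <- rs, d <- iota 0 N].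

Definition goto t q q' : clause := hcl (vQ t q) (vQ t q) (vQ t q) (vQ t.+1 q').

Definition step_clauses n N t (q : Q) : seq clause :=
  match q with
  | None => goto t q None :: keep N t q regs
  | Some q1 =>
    match mins q1 with
    | IPush r b q' =>
        [:: goto t q q';
            hcl (vQ t q) (vQ t q) (vQ t q) (vP t.+1 r (n.+1 + t));
            hcl (vQ t q) (vQ t q) (vQ t q) (vB (Some b) (n.+1 + t))] ++
        [seq hcl (vQ t q) (vQ t q) (vP t r d) (vL (n.+1 + t) d) | d <- iota 0 N] ++
        keep N t q (rdiff r)
    | IPop r q' =>
        goto t q q' ::
        [seq hcl (vQ t q) (vP t r d) (vL d d') (vP t.+1 r d') | d <- iota 0 N, d' <- iota 0 N] ++
        keep N t q (rdiff r)
    | IIf r p q1 q2 =>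
        [seq hcl (vQ t q) (vP t r d) (vB o d) (vQ t.+1 (if p o then q1 else q2))
           | o <- [:: None; Some false; Some true], d <- iota 0 N] ++
        keep N t q regs
    end
  end.

Definition unit_cl v := ocl v v.

(** The bottom cell [n] carries no bit and is its own lower neighbour, so that popping an empty
    stack leaves it empty. *)
Definition init_clauses n : seq clause :=
  [:: unit_cl (vQ 0 (mstart m)); unit_cl (vP 0 R0 0); unit_cl (vP 0 R1 n);
      unit_cl (vP 0 R2 n); unit_cl (vP 0 R3 n); unit_cl (vL n n); unit_cl (vB None n)] ++
  [seq unit_cl (vL i i.+1) | i <- iota 0 n].

(** The cells after [w] copy the variables [vU]; the last [m2] cells receive at least one bit each,
    and nothing forbids both. Each clause mentions a cell variable, which will never be
    existential. *)
Definition input_clauses (w : seq bool) m1 m2 : seq clause :=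
  [seq unit_cl (vB (Some p.2) p.1) | p <- zip (iota 0 (size w)) w] ++
  [seq hcl (vU j) (vU j) (vU j) (vB (Some true) (size w + j)) | j <- iota 0 m1] ++
  [seq ocl (vU j) (vB (Some false) (size w + j)) | j <- iota 0 m1] ++
  [seq ocl (vB (Some true) (size w + m1 + j)) (vB (Some false) (size w + m1 + j)) | j <- iota 0 m2].

(** These are the only clauses without a positive literal: the run itself can always be satisfied,
    and only its answer can fail to be. *)
Definition final_clauses N T : seq clause :=
  [seq ncl (vP T R0 d) (vB o d) | o <- [:: None; Some false], d <- iota 0 N].

Definition run_clauses n T : seq clause :=
  init_clauses n ++
  flatten [seq flatten [seq step_clauses n (n.+1 + T) t q | q <- enum {: Q}] | t <- iota 0 T].

Definition clauses (w : seq bool) m1 m2 T : seq clause :=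
  let n := size w + m1 + m2 in
  run_clauses n T ++ input_clauses w m1 m2 ++ final_clauses (n.+1 + T) T.

Definition mstep (c : Q * store) : Q * store :=
  if c.1 is Some q then istep (mins q) c.2 else c.

Lemma mpath_iter n (q q' : Q) s s' : mpath n q s q' s' -> iter n mstep (q, s) = (q', s').
Proof.
elim=> {n q s q' s'} // n q s q' s' _ IH.
by rewrite iterSr -IH /mstep /=; case: (istep _ _).
Qed.

Lemma mstep_exit n s : iter n mstep (None, s) = (None, s).
Proof. by elim: n => //= n ->. Qed.

(** * Every satisfying assignment contains the run *)

Section Soundness.
Variables (beta : var -> bool) (n T : nat) (z : seq bool).
Notation N := (n.+1 + T).
Hypothesis sz_z : size z = n.
Hypothesis hrun : all (csat beta) (run_clauses n T).
Hypothesis hbit : forall i, i < n -> beta (vB (Some (nth false z i)) i).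

(** An assignment may make more variables true than the run does. Hence a stack is only required to
    have, among the chains of true [vL], one that spells it. *)
Fixpoint repr (l : seq bool) (d : nat) : Prop :=
  if l is b :: l' then beta (vB (Some b) d) /\ exists d', [/\ d' < N, beta (vL d d') & repr l' d']
  else beta (vB None d) /\ beta (vL d d).

Lemma repr_top l d : repr l d -> beta (vB (ohead l) d).
Proof. by case: l => [|b l] []. Qed.

Lemma repr_pop l d : d < N -> repr l d -> exists d', [/\ d' < N, beta (vL d d') & repr (behead l) d'].
Proof. by case: l => [|b l] hd [h1 h2] //; exists d. Qed.

Definition inv t (c : Q * store) :=
  beta (vQ t c.1) /\ forall r, exists d, [/\ d < N, beta (vP t r d) & repr (get c.2 r) d].

Lemma inv0 : inv 0 (mstart m, St z [::] [::] [::]).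
Proof.
move: hrun; rewrite /run_clauses all_cat => /andP [/allP h _].
have hu v : unit_cl v \in init_clauses n -> v != [::] -> beta v.
  by move=> /h; rewrite /csat /= => h1 h2; move: h1; rewrite h2 /= orbF orbb.
split; first by apply: hu; rewrite // inE eqxx.
have hn : n < N by lia.
have rn : repr [::] n by split; apply: hu; rewrite ?inE ?eqxx ?orbT.
case; [|by exists n; split=> //; apply: hu; rewrite ?inE ?eqxx ?orbT ..].
exists 0; split; [by [] | by apply: hu; rewrite ?inE ?eqxx ?orbT |].
(* The claim is generalised to the suffix of [z] that starts at cell [i], by induction on a bound
   for the number of input cells left. *)
rewrite /= -(drop0 z).
have hs : 0 <= n by [].
have e0 : n = 0 + (n - 0) by lia.
move: {2}(n - 0) (leqnn (n - 0)) => k; move: (0) hs => i hi hk {e0}.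
elim: k i hi hk => [|k IH] i hi hk.
  have -> : i = n by lia.
  by rewrite drop_oversize ?sz_z.
case: (ltngtP i n) hi => // [hi _ | -> _]; last by rewrite drop_oversize ?sz_z.
rewrite (drop_nth false) ?sz_z //=; split; first exact: hbit.
exists i.+1; split; [by lia | | by apply: IH; lia].
apply: hu => //; rewrite mem_cat; apply/orP; right; apply/mapP.
by exists i => //; rewrite mem_iota.
Qed.

(** Unit propagation: for the current state and the cells named by the invariant, the clauses of the
    instruction have true premises, so their conclusions restore the invariant at the next time. *)
Lemma inv_step t c : t < T -> inv t c -> inv t.+1 (mstep c).
Proof.
case: c => q s ht [/= hq hs].
have h0 : forall c, c \in step_clauses n N t q -> csat beta c.
  move: hrun; rewrite /run_clauses all_cat => /andP [_ /allP h] c hc; apply: h.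
  apply/flattenP; exists (flatten [seq step_clauses n N t q | q <- enum {: Q}]).
    by apply/mapP; exists t => //; rewrite mem_iota.
  by apply/flattenP; exists (step_clauses n N t q) => //; apply/mapP; exists q; rewrite ?mem_enum.
have imp a b c d : hcl a b c d \in step_clauses n N t q -> d != [::] ->
    beta a -> beta b -> beta c -> beta d.
  move=> /h0; rewrite /csat /= => h hd ha hb hc.
  by move: h; rewrite ha hb hc hd /= !andbF /= orbF orbb.
have hk rs r : {subset keep N t q rs <= step_clauses n N t q} ->
    has (reg_eqb r) rs -> forall d, d < N -> beta (vP t r d) -> beta (vP t.+1 r d).
  move=> hsub hr d hd hp.
  apply: (imp (vQ t q) (vQ t q) (vP t r d)) => //; apply: hsub.
  elim: rs hr => //= r' rs IH; rewrite /keep allpairs_cons mem_cat.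
  move=> /orP [e | /IH h]; last by apply/orP; right.
  have -> : r = r' by move: e; clear; case: r; case: r'.
  by apply/orP; left; apply/mapP; exists d => //; rewrite mem_iota.
have hall r : has (reg_eqb r) regs by case: r.
rewrite /mstep /=; case: q hq h0 imp hk => [q1|] hq h0 imp hk; last first.
  split=> /=.
    by apply: (imp _ _ _ _ _ _ hq hq hq) => //; rewrite inE eqxx.
  move=> r; have [d [h1 h2 h3]] := hs r; exists d; split=> //.
  by apply: (hk regs) => // c hc; rewrite inE hc orbT.
case e : (mins q1) imp hk => [r b q' | r q' | r p q2 q3] imp hk.
- rewrite /step_clauses e in imp hk.
  split=> /=; first by apply: (imp _ _ _ _ _ _ hq hq hq); rewrite // inE eqxx.
  move=> r'; rewrite get_set; case er : (reg_eqb r' r).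
    have -> : r' = r by move: er; clear; case: r; case: r'.
    have [d [h1 h2 h3]] := hs r.
    exists (n.+1 + t); split; [by lia | by apply: (imp _ _ _ _ _ _ hq hq hq); rewrite // !inE eqxx ?orbT |].
    split; first by apply: (imp _ _ _ _ _ _ hq hq hq); rewrite // !inE eqxx ?orbT.
    exists d; split=> //; apply: (imp _ _ _ _ _ _ hq hq h2) => //.
    rewrite !mem_cat; apply/orP; right; apply/orP; left; apply/mapP.
    by exists d => //; rewrite mem_iota.
  have [d [h1 h2 h3]] := hs r'; exists d; split=> //.
  apply: (hk (rdiff r)) => //; first by move=> c hc; rewrite !mem_cat hc !orbT.
  by move: er; clear; case: r; case: r'.
- rewrite /step_clauses e in imp hk.
  split=> /=; first by apply: (imp _ _ _ _ _ _ hq hq hq); rewrite // inE eqxx.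
  move=> r'; rewrite get_set; case er : (reg_eqb r' r).
    have -> : r' = r by move: er; clear; case: r; case: r'.
    have [d [h1 h2 h3]] := hs r; have [d' [h4 h5 h6]] := repr_pop h1 h3.
    exists d'; split=> //; apply: (imp _ _ _ _ _ _ hq h2 h5) => //.
    rewrite inE mem_cat; apply/orP; right; apply/orP; left; apply/allpairsP.
    by exists (d, d'); split=> //; rewrite mem_iota.
  have [d [h1 h2 h3]] := hs r'; exists d; split=> //.
  apply: (hk (rdiff r)) => //; first by move=> c hc; rewrite inE !mem_cat hc !orbT.
  by move: er; clear; case: r; case: r'.
- rewrite /step_clauses e in imp hk.
  split=> /=.
    have [d [h1 h2 h3]] := hs r; have h4 := repr_top h3; apply: (imp _ _ _ _ _ _ hq h2 h4) => //.
    rewrite mem_cat; apply/orP; left; apply/allpairsP; exists (ohead (get s r), d).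
    by split=> //; [case: (ohead _) => [[]|] | rewrite mem_iota].
  move=> r'; have [d [h1 h2 h3]] := hs r'; exists d; split=> //.
  by apply: (hk regs) => // c hc; rewrite mem_cat hc orbT.
Qed.

Lemma inv_iter t : t <= T -> inv t (iter t mstep (mstart m, St z [::] [::] [::])).
Proof.
elim: t => [|t IH] ht; first exact: inv0.
by rewrite iterS; apply: inv_step => //; apply: IH; exact: ltnW.
Qed.

End Soundness.

(** ** The canonical satisfying assignment *)

(** The same run with pointers into a heap in place of stack contents: this is the reading of a
    configuration that the variables [vP], [vB] and [vL] express. *)
Record pcfg := PC { pq : Q; pptr : reg -> nat; pbit : nat -> option bool; plow : nat -> nat }.

Definition updr (f : reg -> nat) r v := fun r' => if reg_eqb r' r then v else f r'.
Definition updn A (f : nat -> A) d v := fun d' => if d' == d then v else f d'.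

Section Completeness.
Variables (n T : nat) (z : seq bool) (u : nat -> bool).
Notation N := (n.+1 + T).

Definition pstep t (c : pcfg) : pcfg :=
  if pq c is Some q then
    match mins q with
    | IPush r b q' =>
        PC q' (updr (pptr c) r (n.+1 + t)) (updn (pbit c) (n.+1 + t) (Some b))
          (updn (plow c) (n.+1 + t) (pptr c r))
    | IPop r q' => PC q' (updr (pptr c) r (plow c (pptr c r))) (pbit c) (plow c)
    | IIf r p q1 q2 =>
        PC (if p (pbit c (pptr c r)) then q1 else q2) (pptr c) (pbit c) (plow c)
    end
  else c.

Fixpoint pc t : pcfg :=
  if t is t'.+1 then pstep t' (pc t')
  else PC (mstart m) (fun r => if r is R0 then 0 else n)
         (fun d => if d < n then Some (nth false z d) else None)
         (fun d => if d < n then d.+1 else n).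

Lemma pc_bound t : (forall r, pptr (pc t) r < n.+1 + t) /\ (forall d, plow (pc t) d < n.+1 + t).
Proof.
elim: t => [|t [h1 h2]] /=; first by split=> [[] | d] //=; try lia; case: ifP; lia.
rewrite /pstep; case: (pq _) => [q|]; last by split=> x; [move: (h1 x) | move: (h2 x)]; lia.
case: (mins q) => [r b q'|r q'|r p q1 q2]; split=> x; rewrite /= ?/updr ?/updn /=;
  try case: ifP => _; move: (h1 r) (h2 (pptr (pc t) r)); try (move: (h1 x)); try (move: (h2 x)); lia.
Qed.

(** Later pushes only write to later cells. One heap, that of time [T], can therefore interpret [vB]
    and [vL] for all times. *)
Lemma pc_stable t t' d : t <= t' -> d < n.+1 + t ->
  pbit (pc t') d = pbit (pc t) d /\ plow (pc t') d = plow (pc t) d.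
Proof.
move=> /subnK <- hd; elim: (t' - t) => //= k [h1 h2].
rewrite /pstep; case: (pq _) => [q|] //; case: (mins q) => //= r b q'.
have hne : (d == n.+1 + (k + t)) = false by lia.
by rewrite /updn hne.
Qed.

Definition pbeta (v : var) : bool :=
  match v with
  | [:: 0; t; k] => k == state_num (pq (pc t))
  | [:: 1; t; r; d] => d == pptr (pc t) (num_reg r)
  | [:: 2; o; d] => o == bit_num (pbit (pc T) d)
  | [:: 3; d; d'] => d' == plow (pc T) d
  | [:: 4; i] => u i
  | _ => false
  end.

Lemma csat_hcl (beta : var -> bool) (a b c d : var) : [&& a != [::], b != [::], c != [::] & d != [::]] ->
  (beta a -> beta b -> beta c -> beta d) -> csat beta (hcl a b c d).
Proof.
rewrite /csat /= => /and4P [-> -> -> ->] /=.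
by case: (beta a); case: (beta b); case: (beta c) => // h; rewrite h.
Qed.

Lemma pbeta_Q t q : pbeta (vQ t q) = (q == pq (pc t)).
Proof. by rewrite /= /state_num; apply/eqP/eqP => [/val_inj/enum_rank_inj | ->]. Qed.

Lemma pbeta_P t r d : pbeta (vP t r d) = (d == pptr (pc t) r).
Proof. by rewrite /= reg_numK. Qed.

Lemma pbeta_B o d : pbeta (vB o d) = (o == pbit (pc T) d).
Proof. by rewrite /=; case: o => [[]|]; case: (pbit _ _) => [[]|]. Qed.

Lemma pbeta_step t q : t < T -> all (csat pbeta) (step_clauses n N t q).
Proof.
move=> ht; have [hb1 hb2] := pc_bound t.
have stab d : d < n.+1 + t.+1 -> pbit (pc T) d = pbit (pc t.+1) d /\ plow (pc T) d = plow (pc t.+1) d.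
  by move=> hd; apply: pc_stable.
have stab' d : d < n.+1 + t -> pbit (pc T) d = pbit (pc t) d /\ plow (pc T) d = plow (pc t) d.
  by move=> hd; apply: pc_stable => //; exact: ltnW.
have K rs : (pq (pc t) = q -> forall r, r \in rs -> pptr (pc t.+1) r = pptr (pc t) r) ->
    all (csat pbeta) (keep N t q rs).
  move=> h; apply/allP => c /allpairsP [[r d] [hr _ ->]]; apply: csat_hcl => //.
  by rewrite pbeta_Q !pbeta_P => /eqP e _; rewrite h.
have G q' : (pq (pc t) = q -> pq (pc t.+1) = q') -> csat pbeta (goto t q q').
  by move=> h; apply: csat_hcl => //; rewrite !pbeta_Q => /eqP e _ _; rewrite h.
have hnt : n.+1 + t < n.+1 + t.+1 by lia.
have hrd r r' : r' \in rdiff r -> reg_eqb r' r = false.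
  by rewrite mem_filter => /andP [/negbTE].
case: q K G => [q1|] K G; last first.
  rewrite /step_clauses -cat1s all_cat all_seq1; apply/andP; split.
    by apply: G => /= e; rewrite /pstep e.
  by apply: K => /= e r _; rewrite /pstep e.
rewrite /step_clauses; case em : (mins q1) => [r b q' | r q' | r p q2 q3].
- rewrite !all_cat; apply/and3P; split.
  + rewrite /= !andbT; apply/and3P; split.
    * by apply: G => /= e; rewrite /pstep e em.
    * apply: csat_hcl => //; rewrite pbeta_Q pbeta_P => /eqP e _ _.
      by rewrite /= /pstep -e em /= /updr; case: (r).
    * apply: csat_hcl => //; rewrite pbeta_Q pbeta_B => /eqP e _ _.
      have [-> _] := stab (n.+1 + t) hnt.
      by rewrite /= /pstep -e em /= /updn eqxx.
  + apply/allP => c /mapP [d _ ->]; apply: csat_hcl => //.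
    rewrite pbeta_Q pbeta_P => /eqP e _ /eqP ->.
    rewrite /pbeta /vL; have [_ ->] := stab (n.+1 + t) hnt.
    by rewrite /= /pstep -e em /= /updn eqxx.
  + by apply: K => /= e r' hr'; rewrite /pstep e em /= /updr hrd.
- rewrite -cat1s all_cat; apply/andP; split.
    by rewrite all_seq1; apply: G => /= e; rewrite /pstep e em.
  rewrite all_cat; apply/andP; split.
  + apply/allP => c /allpairsP [[d d'] [_ _ ->]]; apply: csat_hcl => //.
    rewrite pbeta_Q !pbeta_P => /eqP e /eqP ->.
    rewrite {1}/pbeta /vL; have [_ ->] := stab' _ (hb1 r) => /eqP ->.
    by rewrite /= /pstep -e em /= /updr; case: (r).
  + by apply: K => /= e r' hr'; rewrite /pstep e em /= /updr hrd.
- rewrite all_cat; apply/andP; split.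
  + apply/allP => c /allpairsP [[o d] [_ _ ->]]; apply: csat_hcl => //.
    rewrite !pbeta_Q pbeta_P pbeta_B => /eqP e /eqP ->.
    have [-> _] := stab' _ (hb1 r) => /eqP ->.
    by rewrite /= /pstep -e em.
  + by apply: K => /= e r' hr'; rewrite /pstep e em.
Qed.

Lemma pbeta_low d : plow (pc T) d = plow (pc 0) d \/ n < d.
Proof.
case: (leqP d n) => h; [left | by right].
have hd : d < n.+1 + 0 by lia.
by case: (pc_stable (leq0n T) hd).
Qed.

Lemma pbeta_run : all (csat pbeta) (run_clauses n T).
Proof.
rewrite /run_clauses all_cat; apply/andP; split; last first.
  apply/allP => c /flattenP [s1 /mapP [t ht ->]] /flattenP [s2 /mapP [q _ ->]] hc.
  by move: c hc; apply/allP; apply: pbeta_step; rewrite mem_iota in ht.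
have hu v : v != [::] -> pbeta v -> csat pbeta (unit_cl v).
  by move=> h1 h2; rewrite /csat /= h1 h2.
have hl d : d <= n -> plow (pc T) d = if d < n then d.+1 else n.
  by move=> hd; case: (pbeta_low d) => // h; lia.
have hbn : pbit (pc T) n = None.
  have hn : n < n.+1 + 0 by lia.
  by have [-> _] := pc_stable (leq0n T) hn; rewrite /= ltnn.
rewrite all_cat; apply/andP; split; last first.
  apply/allP => c /mapP [i]; rewrite mem_iota => hi ->; apply: hu => //.
  by rewrite /= hl; [case: ifP; lia | lia].
rewrite /= !hu //= ?reg_numK //=; last by rewrite hl ?ltnn.
by rewrite hbn.
Qed.

End Completeness.

(** An assignment yields the unknown bits, and the run that it contains on them cannot end in
    [false]. Conversely, the canonical assignment of an accepting run satisfies everything; the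
    values of [vU] are prescribed in both directions, because they will be existential. *)
Theorem clauses_correct w m1 m2 T (acc : seq bool -> bool) :
  (forall z, size z = size w + m1 + m2 ->
     iter T mstep (mstart m, St z [::] [::] [::]) = (None, St [:: acc z] [::] [::] [::])) ->
  forall y1, size y1 = m1 ->
  ((exists2 beta : var -> bool, (forall j, j < m1 -> beta (vU j) = nth false y1 j) &
      all (csat beta) (clauses w m1 m2 T)) <->
   (exists2 y2, size y2 = m2 & acc (w ++ y1 ++ y2))).
Proof.
move=> hacc y1 s1; set n := size w + m1 + m2 in hacc.
have top (beta : var -> bool) z b : size z = n -> all (csat beta) (run_clauses n T) ->
    (forall i, i < n -> beta (vB (Some (nth false z i)) i)) ->
    iter T mstep (mstart m, St z [::] [::] [::]) = (None, St [:: b] [::] [::] [::]) ->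
    exists d, [/\ d < n.+1 + T, beta (vP T R0 d) & beta (vB (Some b) d)].
  move=> sz_z hr hb e; have [_ /(_ R0)] := inv_iter sz_z hr hb (leqnn T).
  by rewrite e => -[d [h1 h2 [h3 _]]]; exists d.
split=> [[beta hu] | [y2 s2 ha]].
  rewrite /clauses -/n (all_cat _ (run_clauses n T)) (all_cat _ (input_clauses w m1 m2)).
  move=> /and3P [hr hin hf]; move: hin.
  rewrite /input_clauses !all_cat => /and4P [hw hu1 hu0 hy].
  (* A cell to which the assignment gives both bits is read as [true]. *)
  pose y2 := mkseq (fun j => beta (vB (Some true) (size w + m1 + j))) m2.
  have sz2 : size y2 = m2 by rewrite size_mkseq.
  exists y2 => //.
  have sz_z : size (w ++ y1 ++ y2) = n by rewrite !size_cat s1 sz2 /n; lia.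
  have [|d [h1 h2 h3]] := top beta _ _ sz_z hr _ (hacc _ sz_z).
    move=> i hi; rewrite !nth_cat; case: ltnP => h1.
      move/allP: hw => /(_ (unit_cl (vB (Some (nth false w i)) i))).
      rewrite /csat /= orbF orbb; apply; apply/mapP; exists (i, nth false w i) => //.
      apply/(nthP (0, false)); exists i; first by rewrite size_zip size_iota minnn.
      by rewrite nth_zip ?size_iota // nth_iota.
    have [j hj] : exists j, i = size w + j by exists (i - size w); lia.
    rewrite hj addKn s1; case: ltnP => h2.
      move/allP: hu1 => /(_ (hcl (vU j) (vU j) (vU j) (vB (Some true) (size w + j)))).
      move/allP: hu0 => /(_ (ocl (vU j) (vB (Some false) (size w + j)))).
      rewrite /csat /= hu // !orbF => A B.
      have {}A := A (map_f (fun j => ocl (vU j) (vB (Some false) (size w + j)))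
                     (etrans (mem_iota 0 m1 j) h2)).
      have {}B := B (map_f (fun j => hcl (vU j) (vU j) (vU j) (vB (Some true) (size w + j)))
                     (etrans (mem_iota 0 m1 j) h2)).
      by case: (nth false y1 j) A B => //= _; rewrite orbb.
    have [k hk] : exists k, j = m1 + k by exists (j - m1); lia.
    have hkm : k < m2 by rewrite /n in hi; lia.
    rewrite hk addKn addnA nth_mkseq //.
    move/allP: hy => /(_ _ (map_f _ (etrans (mem_iota 0 m2 k) hkm))).
    rewrite /csat /= orbF; case e : (beta _) => //=.
  case ea : (acc _) h3 => //= h3.
  move/allP: hf => /(_ (ncl (vP T R0 d) (vB (Some false) d))).
  rewrite /csat /= h2 h3 /= => -> //; apply/allpairsP; exists (Some false, d).
  by split=> //; rewrite mem_iota.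
pose z := w ++ y1 ++ y2.
have sz_z : size z = n by rewrite /z !size_cat s1 s2 /n; lia.
pose u j := nth false y1 j.
exists (pbeta n T z u) => //.
have hb0 i : i < n -> pbit (pc n z T) i = Some (nth false z i).
  move=> hi; have hi1 : i < n.+1 + 0 by lia.
  by have [-> _] := pc_stable z (leq0n T) hi1; rewrite /= hi.
rewrite /clauses -/n (all_cat _ (run_clauses n T)) (all_cat _ (input_clauses w m1 m2)).
apply/and3P; split; first exact: pbeta_run.
  rewrite /input_clauses !all_cat; apply/and4P; split.
  - apply/allP => c /mapP [[i b] /(nthP (0, false)) [k]].
    rewrite size_zip size_iota minnn => hk; rewrite nth_zip ?size_iota // nth_iota // => -[<- <-] ->.
    rewrite /csat /unit_cl /ocl [has _ [:: [::]; _; _]]/= orFb; apply/hasP.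
    exists (vB (Some (nth false w k)) k); rewrite ?inE ?eqxx // pbeta_B hb0; last by rewrite /n; lia.
    by rewrite /z nth_cat hk eqxx.
  - apply/allP => c /mapP [j]; rewrite mem_iota => hj ->; apply: csat_hcl => //.
    rewrite pbeta_B hb0 => [hu _ _|]; last by rewrite /n; lia.
    rewrite nth_cat ltnNge leq_addr /= addKn nth_cat s1; move: hj => /= ->.
    by rewrite (hu : nth false y1 j = true).
  - apply/allP => c /mapP [j]; rewrite mem_iota => hj ->.
    rewrite /csat /ocl [has _ [:: [::]; _; _]]/= orFb; apply/hasP.
    case e : (u j); [exists (vU j) | exists (vB (Some false) (size w + j))]; rewrite ?inE ?eqxx ?orbT //.
    rewrite pbeta_B hb0; last by rewrite /n; lia.
    rewrite nth_cat ltnNge leq_addr /= addKn nth_cat s1; move: hj => /= ->.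
    by rewrite (e : nth false y1 j = false).
  - apply/allP => c /mapP [j]; rewrite mem_iota => hj ->.
    rewrite /csat /ocl [has _ [:: [::]; _; _]]/= orFb; apply/hasP.
    exists (vB (Some (nth false z (size w + m1 + j))) (size w + m1 + j)).
      by case: (nth _ _ _); rewrite !inE eqxx ?orbT.
    by rewrite pbeta_B hb0 ?eqxx // /n; lia.
(* Soundness applied to the canonical assignment itself locates the top cell [d] of [R0]. There the
   pointer and the bit are unique, so every final clause has a false variable in its negative
   part. *)
have [|d [h1 h2 h3]] := top (pbeta n T z u) z _ sz_z (pbeta_run n T z u) _ (hacc _ sz_z).
  by move=> i hi; rewrite pbeta_B hb0.
apply/allP => c /allpairsP [[o d'] [ho _ ->]].
rewrite /csat /ncl; apply/orP; left.
move: h2 h3; rewrite pbeta_P pbeta_B ha => /eqP e1 /eqP e2.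
case: (d' =P d) => [-> | ne]; apply/hasP.
  exists (vB o d); rewrite ?inE ?eqxx ?orbT // pbeta_B -e2.
  by move: ho; rewrite /= !inE => /orP [] /eqP ->.
exists (vP T R0 d'); rewrite ?inE ?eqxx // pbeta_P -e1.
by apply/andP; split=> //; apply/eqP.
Qed.

End Clauses.

(** * Ground atoms and explanations *)

Section Generic.
Variables (Rel : finType) (ar : Rel -> nat).
Implicit Types (a : gatom ar) (P R : {fset rule ar}) (A : {set Rel}).
Implicit Types (B O E F : {fset gatom ar}).

(** Forgetting the proof of the length replaces equality of dependent pairs by equality of plain
    ones. *)
Definition raw a : Rel * seq const := (tag a, tval (tagged a)).

Lemma raw_inj : injective raw.
Proof.
move=> [p t] [q u] [/= e]; case: _ / e u => u h.
by congr (Tagged _ _); apply: val_inj.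
Qed.

Definition ev (v : nat -> const) (t : term) : const := match t with inl x => v x | inr c => c end.

Lemma raw_instantiate v (b : atom ar) : raw (instantiate v b) = (tag b, [seq ev v t | t <- tagged b]).
Proof. by []. Qed.

Lemma instantiate_fact v a : instantiate v (fact a).1 = a.
Proof.
by apply: raw_inj; rewrite raw_instantiate /raw /= -map_comp map_id_in.
Qed.

Lemma fact_inj : injective (@fact Rel ar).
Proof. by move=> a b e; rewrite -(instantiate_fact (fun=> [::]) a) e instantiate_fact. Qed.

Lemma in_facts E r : reflect (exists2 a, a \in E & r = fact a) (r \in facts E).
Proof. apply: (iffP (imfsetP _ _ _ _)) => -[a h1 h2]; exists a => //. Qed.

Lemma mem_facts E a : (fact a \in facts E) = (a \in E).
Proof. by apply/in_facts/idP => [[b hb /fact_inj ->] | h] //; exists a. Qed.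

Lemma least_model_rule P r v : r \in P ->
  (forall b, b \in r.2 -> least_model P (instantiate v b)) -> least_model P (instantiate v r.1).
Proof. by move=> hr h M hM; apply: (hM _ hr) => b hb; exact: (h b hb M hM). Qed.

Lemma least_model_fact P a : fact a \in P -> least_model P a.
Proof. move=> h; rewrite -(instantiate_fact (fun=> [::]) a); exact: (least_model_rule (r := fact a)). Qed.

Lemma replace_raw C x a :
  tval (tagged (replace_atom C x a)) =
  [seq if (a, p.1) \in C then x else p.2 | p <- zip (iota 0 (size (tagged a))) (tagged a)].
Proof.
set l := tval (tagged a); apply: (@eq_from_nth _ [::]).
  by rewrite size_tuple size_map size_zip size_iota minnn size_tuple.
move=> i; rewrite size_tuple => hi.
rewrite [RHS](nth_map (0, [::])) ?size_zip ?size_iota ?minnn ?size_tuple //.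
rewrite nth_zip ?size_iota ?size_tuple // nth_iota //.
have -> : nth [::] (tagged (replace_atom C x a)) i =
    tnth (tagged (replace_atom C x a)) (Ordinal hi) by rewrite (tnth_nth [::]).
by rewrite tnth_mktuple (tnth_nth [::]).
Qed.

(** A single successful replacement already forms an independent family, so degree zero excludes
    every one of them. *)
Lemma is_degree0 A P O E F xi : is_degree A P O E F xi 0 <->
  forall c C, replacement E c C -> ~ explanation A P O (replace E C xi) F.
Proof.
split=> [[_ h] c C hr he | h].
  suff : #|` [fset (c, C)]%fset| <= 0 by rewrite cardfs1.
  apply: h; split=> [r | r1 r2]; rewrite ?inE.
    by move=> /eqP ->.
  by move=> /eqP -> /eqP ->; rewrite eqxx.
split.
  by exists fset0 => //; rewrite ?cardfs0.
move=> S [h1 _]; rewrite leqn0 cardfs_eq0; apply/negPn/negP => /fset0Pn [[c C] /h1 [hr he]].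
exact: h hr he.
Qed.

Lemma notin_small (s : seq const) (x : const) : \max_(c <- s) size c < size x -> x \notin s.
Proof.
move=> h; apply/negP => hx; move: h; rewrite ltnNge => /negP; apply.
exact: (@leq_bigmax_seq _ s xpredT (fun c => size c) x hx isT).
Qed.

Definition aterms (b : atom ar) : seq term := tval (tagged b).

Definition rule_consts (r : rule ar) : seq const :=
  flatten [seq pmap (fun t : term => if t is inr c then Some c else None) (aterms b)
          | b <- r.1 :: r.2].

Lemma rule_constsP (r : rule ar) b c : b \in r.1 :: r.2 -> (inr c : term) \in aterms b ->
  c \in rule_consts r.
Proof.
move=> hb hc; apply/flattenP; eexists; first by apply/mapP; exists b.
by rewrite mem_pmap; apply/mapP; exists (inr c).
Qed.

Lemma fresh_exists P O E : exists xi, fresh P O E xi.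
Proof.
pose s := flatten [seq tval (tagged a) | a <- enum_fset (E `|` O)%fset] ++
  flatten [seq rule_consts r | r <- enum_fset P].
exists (nseq (\max_(c <- s) size c).+1 true).
have hx : nseq (\max_(c <- s) size c).+1 true \notin s by apply: notin_small; rewrite size_nseq.
move: hx; set xi := nseq _ _; rewrite mem_cat negb_or => /andP [h1 h2]; split.
  move=> a ha; apply: contra h1 => hx; apply/flattenP; exists (tval (tagged a)) => //.
  by apply/mapP; exists a.
move=> r hr b hb; apply: contra h2 => hx; apply/flattenP.
exists (rule_consts r); first by apply/mapP; exists r.
exact: rule_constsP hx.
Qed.

End Generic.

(** * The gadget program *)

Definition gar (p : 'I_8) : nat := nth 0 [:: 2; 2; 1; 1; 1; 1; 1; 5] p.

(** [pVal] demands that a variable still has a value after the replacement: it fails when [e(v, k0)]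
    has become [e(v, x)] while [s(k0)] has stayed. [pCh] demands a choice for an existential
    variable, and [pCl] holds the five slots of a clause. *)
Definition pE : 'I_8 := @Ordinal 8 0 isT.
Definition pA : 'I_8 := @Ordinal 8 1 isT.
Definition pS : 'I_8 := @Ordinal 8 2 isT.
Definition pTru : 'I_8 := @Ordinal 8 3 isT.
Definition pFal : 'I_8 := @Ordinal 8 4 isT.
Definition pVal : 'I_8 := @Ordinal 8 5 isT.
Definition pCh : 'I_8 := @Ordinal 8 6 isT.
Definition pCl : 'I_8 := @Ordinal 8 7 isT.

Definition gA : {set 'I_8} := [set p : 'I_8 | p < 3].

Definition k0 : const := [::].
Definition k1 : const := [:: true].

Definition mkat (p : 'I_8) (l : seq term) (h : size l == gar p) : atom gar :=
  Tagged (fun p => (gar p).-tuple term) (Tuple h).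
Definition mkg (p : 'I_8) (l : seq const) (h : size l == gar p) : gatom gar :=
  Tagged (fun p => (gar p).-tuple const) (Tuple h).

Notation "p @[ l ]" := (@mkat p l isT) (at level 9, format "p @[ l ]").

Local Notation V n := (inl n : term).
Local Notation K c := (inr c : term).

(** [e(v, k0)] makes [v] false and [e(v, x)], [s(x)] makes it true: with [s(k0)]
    every variable is both, and replacing [k0] by a fresh constant in [s] and in
    some of the [e] yields an assignment.  [a(u, k0)] and [a(u, k1)] fix the value
    of an existential variable. *)
Definition gadget_rules : seq (rule gar) :=
  [:: (pTru @[[:: V 0]], [:: pE @[[:: V 0; V 1]]; pS @[[:: V 1]]]);
      (pTru @[[:: V 0]], [:: pA @[[:: V 0; K k1]]]);
      (pFal @[[:: V 0]], [:: pE @[[:: V 0; K k0]]]);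
      (pFal @[[:: V 0]], [:: pA @[[:: V 0; K k0]]]);
      (pVal @[[:: V 0]], [:: pE @[[:: V 0; V 1]]; pS @[[:: V 1]]]);
      (pVal @[[:: V 0]], [:: pE @[[:: V 0; K k0]]; pS @[[:: V 1]]]);
      (pCh @[[:: V 0]], [:: pA @[[:: V 0; K k0]]]);
      (pCh @[[:: V 0]], [:: pA @[[:: V 0; K k1]]]);
      (pCl @[[:: V 0; V 1; V 2; V 3; V 4]], [:: pFal @[[:: V 0]]]);
      (pCl @[[:: V 0; V 1; V 2; V 3; V 4]], [:: pFal @[[:: V 1]]]);
      (pCl @[[:: V 0; V 1; V 2; V 3; V 4]], [:: pFal @[[:: V 2]]]);
      (pCl @[[:: V 0; V 1; V 2; V 3; V 4]], [:: pTru @[[:: V 3]]]);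
      (pCl @[[:: V 0; V 1; V 2; V 3; V 4]], [:: pTru @[[:: V 4]]])].

Definition gadget : program gar := [fset r in gadget_rules]%fset.

Lemma in_gadget r : (r \in gadget) = (r \in gadget_rules).
Proof. by rewrite /gadget in_fset. Qed.

Lemma gadget_no_abducible_head : no_abducible_head gA gadget.
Proof.
have /allP h : all (fun r : rule gar => tag r.1 \notin gA) gadget_rules by rewrite /= !inE.
by move=> r; rewrite in_gadget => /h.
Qed.

(** * The least model of the gadget program in closed form *)

Section Semantics.
Variable E : {fset gatom gar}.
Hypothesis habd : abducibles gA E.

Definition inE_ p (l : seq const) : Prop := exists2 a, a \in E & raw a = (p, l).
Definition sTru x := (exists2 z, inE_ pE [:: x; z] & inE_ pS [:: z]) \/ inE_ pA [:: x; k1].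
Definition sFal x := inE_ pE [:: x; k0] \/ inE_ pA [:: x; k0].
Definition sVal x := exists2 z, inE_ pE [:: x; z] \/ inE_ pE [:: x; k0] & inE_ pS [:: z].
Definition sCh x := inE_ pA [:: x; k0] \/ inE_ pA [:: x; k1].
Definition sCl (l : seq const) :=
  [\/ sFal (nth k0 l 0), sFal (nth k0 l 1) | sFal (nth k0 l 2)] \/
  (sTru (nth k0 l 3) \/ sTru (nth k0 l 4)).

(** Without recursion the rules unfold into an explicit condition on [E]; the atoms with abducible
    predicates are those of [E]. *)
Definition sem (x : 'I_8 * seq const) : Prop :=
  match val x.1 with
  | 3 => sTru (nth k0 x.2 0)
  | 4 => sFal (nth k0 x.2 0)
  | 5 => sVal (nth k0 x.2 0)
  | 6 => sCh (nth k0 x.2 0)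
  | 7 => sCl x.2
  | _ => inE_ x.1 x.2
  end.

Definition gprog : program gar :=
  ((gadget `|` facts (Defs.set_of [::]) `|` facts E) `\` facts fset0)%fset.

Lemma in_gprog r : (r \in gprog) = (r \in gadget_rules) || (r \in facts E).
Proof.
have h0 : facts (fset0 : {fset gatom gar}) = fset0.
  by apply/eqP; rewrite -fsubset0; apply/fsubsetP => x /in_facts [a]; rewrite inE.
have h1 : facts (Defs.set_of ([::] : seq (gatom gar))) = fset0.
  by rewrite -h0; congr facts; apply/fsetP => x; rewrite !inE.
by rewrite /gprog h0 h1 fsetD0 fsetU0 in_fsetU in_gadget.
Qed.

Lemma sem_model : herbrand_model gprog (fun a => sem (raw a)).
Proof.
move=> r; rewrite in_gprog => /orP []; last first.
  move=> /in_facts [a ha ->] v _; rewrite instantiate_fact.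
  have : inE_ (tag a) (tagged a) by exists a.
  have := habd ha; rewrite inE /sem /raw /=; move: (tagged a).
  by case: (tag a) => -[|[|[|k]]] hk.
move=> hr v hb; move: hr hb; rewrite /gadget_rules.
do ![rewrite in_cons => /orP [/eqP -> | ]]; last by [].
all: rewrite /= => hb; rewrite raw_instantiate /=.
- have := hb _ (mem_head _ _); have := hb _ (mem_last _ _).
  by rewrite !raw_instantiate /= => h2 h1; left; exists (v 1).
- by have := hb _ (mem_head _ _); rewrite raw_instantiate; right.
- by have := hb _ (mem_head _ _); rewrite raw_instantiate; left.
- by have := hb _ (mem_head _ _); rewrite raw_instantiate; right.
- have := hb _ (mem_head _ _); have := hb _ (mem_last _ _).
  by rewrite !raw_instantiate /= => h2 h1; exists (v 1) => //; left.
- have := hb _ (mem_head _ _); have := hb _ (mem_last _ _).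
  by rewrite !raw_instantiate /= => h2 h1; exists (v 1) => //; right.
- by have := hb _ (mem_head _ _); rewrite raw_instantiate; left.
- by have := hb _ (mem_head _ _); rewrite raw_instantiate; right.
- by have := hb _ (mem_head _ _); rewrite raw_instantiate; left; constructor 1.
- by have := hb _ (mem_head _ _); rewrite raw_instantiate; left; constructor 2.
- by have := hb _ (mem_head _ _); rewrite raw_instantiate; left; constructor 3.
- by have := hb _ (mem_head _ _); rewrite raw_instantiate; right; left.
- by have := hb _ (mem_head _ _); rewrite raw_instantiate; right; right.
Qed.

(** Quantifying over the atoms with a given raw form, of which there is at most one, avoids building
    dependent tuples. *)
Definition derivable (x : 'I_8 * seq const) : Prop :=
  forall a, raw a = x -> least_model gprog a.

Lemma derivable_rule i (l : seq const) :
  let r := nth (fact (@mkg pS [:: k0] isT)) gadget_rules i in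
  i < size gadget_rules ->
  (forall b, b \in r.2 -> derivable (raw (instantiate (nth k0 l) b))) ->
  derivable (raw (instantiate (nth k0 l) r.1)).
Proof.
move=> r hi hb a /raw_inj ->; apply: least_model_rule.
  by rewrite in_gprog mem_nth.
by move=> b /hb h; apply: h.
Qed.

Lemma derivable_inE p l : inE_ p l -> derivable (p, l).
Proof.
move=> [a ha e] b; rewrite -e => /raw_inj ->; apply: least_model_fact.
by rewrite in_gprog mem_facts ha orbT.
Qed.

Lemma sem_derivable a : sem (raw a) -> least_model gprog a.
Proof.
have hT x : sTru x -> derivable (pTru, [:: x]).
  case=> [[z h1 h2] | h].
    apply: (@derivable_rule 0 [:: x; z]) => // b; rewrite !inE => /orP [] /eqP ->; exact: derivable_inE.
  by apply: (@derivable_rule 1 [:: x]) => // b; rewrite !inE => /eqP ->; exact: derivable_inE.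
have hF x : sFal x -> derivable (pFal, [:: x]).
  case=> h.
    by apply: (@derivable_rule 2 [:: x]) => // b; rewrite !inE => /eqP ->; exact: derivable_inE.
  by apply: (@derivable_rule 3 [:: x]) => // b; rewrite !inE => /eqP ->; exact: derivable_inE.
have hV x : sVal x -> derivable (pVal, [:: x]).
  case=> z [] h1 h2.
    apply: (@derivable_rule 4 [:: x; z]) => // b; rewrite !inE => /orP [] /eqP ->; exact: derivable_inE.
  apply: (@derivable_rule 5 [:: x; z]) => // b; rewrite !inE => /orP [] /eqP ->; exact: derivable_inE.
have hC x : sCh x -> derivable (pCh, [:: x]).
  case=> h.
    by apply: (@derivable_rule 6 [:: x]) => // b; rewrite !inE => /eqP ->; exact: derivable_inE.
  by apply: (@derivable_rule 7 [:: x]) => // b; rewrite !inE => /eqP ->; exact: derivable_inE.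
have hL x0 x1 x2 x3 x4 : sCl [:: x0; x1; x2; x3; x4] -> derivable (pCl, [:: x0; x1; x2; x3; x4]).
  case=> [[]|[]] h; [
    apply: (@derivable_rule 8 [:: x0; x1; x2; x3; x4]) |
    apply: (@derivable_rule 9 [:: x0; x1; x2; x3; x4]) |
    apply: (@derivable_rule 10 [:: x0; x1; x2; x3; x4]) |
    apply: (@derivable_rule 11 [:: x0; x1; x2; x3; x4]) |
    apply: (@derivable_rule 12 [:: x0; x1; x2; x3; x4])] => // b;
  rewrite !inE => /eqP ->; by [exact: hF | exact: hT].
move=> h; suff : derivable (raw a) by apply.
case: a h => p t; have := size_tuple t; rewrite /sem /raw /=.
move: (tval t); case: p t => -[|[|[|[|[|[|[|[|k]]]]]]]] hk t l //=.
- by move=> _ h; exact: derivable_inE.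
- by move=> _ h; exact: derivable_inE.
- by move=> _ h; exact: derivable_inE.
- case: l => [|x [|]] //= _ h; have -> : Ordinal hk = pTru by exact: val_inj. exact: hT.
- case: l => [|x [|]] //= _ h; have -> : Ordinal hk = pFal by exact: val_inj.
  exact: hF.
- case: l => [|x [|]] //= _ h; have -> : Ordinal hk = pVal by exact: val_inj.
  exact: hV.
- case: l => [|x [|]] //= _ h; have -> : Ordinal hk = pCh by exact: val_inj.
  exact: hC.
- case: l => [|x0 [|x1 [|x2 [|x3 [|x4 [|]]]]]] //= _ h; have -> : Ordinal hk = pCl by exact: val_inj.
  exact: hL.
Qed.

Lemma gprog_sem a : least_model gprog a <-> sem (raw a).
Proof. by split=> [h | ]; [exact: h sem_model | exact: sem_derivable]. Qed.

End Semantics.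

(** Each number in unary, closed by [false]. The dummy name becomes the empty string, which is also
    [k0]. *)
Definition nm (v : var) : const := flatten [seq nseq i true ++ [:: false] | i <- v].

Lemma nm_inj : injective nm.
Proof.
have h i j r r' : nseq i true ++ false :: r = nseq j true ++ false :: r' -> i = j /\ r = r'.
  by elim: i j => [|i IH] [|j] //= [] // /IH [-> ->].
elim=> [|i v IH] [|j w] //; rewrite /nm /= -!catA /=.
- by case: j.
- by case: i.
- by move=> /h [-> /IH ->].
Qed.

Definition gE x y : gatom gar := @mkg pE [:: x; y] isT.
Definition gAt x y : gatom gar := @mkg pA [:: x; y] isT.
Definition gS x : gatom gar := @mkg pS [:: x] isT.
Definition gVal x : gatom gar := @mkg pVal [:: x] isT.
Definition gCh x : gatom gar := @mkg pCh [:: x] isT.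

Definition clause_args (c : clause) : seq const :=
  [:: nm (nth [::] c.1 0); nm (nth [::] c.1 1); nm (nth [::] c.1 2);
      nm (nth [::] c.2 0); nm (nth [::] c.2 1)].
Definition gCl c : gatom gar := @mkg pCl (clause_args c) isT.

Definition gP : program gar := (gadget `|` facts (Defs.set_of [::]))%fset.

Lemma in_set_of (Rel : finType) (ar : Rel -> nat) (s : seq (gatom ar)) a :
  (a \in Defs.set_of s) = (a \in s).
Proof. by rewrite /Defs.set_of in_fset. Qed.

Lemma facts0 (Rel : finType) (ar : Rel -> nat) : facts (fset0 : {fset gatom ar}) = fset0.
Proof. by apply/eqP; rewrite -fsubset0; apply/fsubsetP => x /in_facts [a]; rewrite inE. Qed.

(** As [B] is empty and no rule has an abducible head, the program contains no abducible fact, and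
    [F] must be empty. *)
Lemma gexplanation O E F : explanation gA gP O E F <->
  [/\ abducibles gA E, F = fset0 & forall a, a \in O -> sem E (raw a)].
Proof.
split=> [[hE hF hd hsub h] | [hE -> h]].
  have F0 : F = fset0.
    apply/eqP; apply/negPn/negP => /fset0Pn [a ha].
    have /fsubsetP /(_ (fact a)) := hsub; rewrite mem_facts => /(_ ha).
    rewrite in_fsetU in_gadget => /orP [hr | /in_facts [b]]; last by rewrite in_set_of.
    have := gadget_no_abducible_head (r := fact a); rewrite in_gadget => /(_ hr).
    by rewrite hF.
  by split=> // a /h; rewrite F0 => /(gprog_sem hE).
split=> //.
- by apply/fdisjointP => x _; rewrite inE.
- by rewrite facts0 fsub0set.
- by move=> a /h hs; apply/gprog_sem.
Qed.

(** * Replacements in the gadget and truth assignments *)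

Section Gadget.
Variables (cls : seq clause) (us : seq var).

(** All names except the dummy and the existential ones, thus also the auxiliary variables that
    describe the run: their values are chosen by whoever performs the replacement. *)
Definition uvars : seq var :=
  [seq v <- flatten [seq c.1 ++ c.2 | c <- cls] | (v != [::]) && (v \notin us)].

Definition Olist : seq (gatom gar) :=
  [seq gCl c | c <- cls] ++ [seq gVal (nm v) | v <- uvars] ++ [seq gCh (nm u) | u <- us].

Definition Elist (y : var -> bool) : seq (gatom gar) :=
  gS k0 :: [seq gE (nm v) k0 | v <- uvars] ++
           [seq gAt (nm u) (if y u then k1 else k0) | u <- us].

Hypothesis wf : forall c, c \in cls -> size c.1 = 3 /\ size c.2 = 2.
Hypothesis us0 : [::] \notin us.
Hypothesis pure : forall c, c \in cls -> has (mem uvars) (c.1 ++ c.2).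
Hypothesis cls0 : cls != [::].

Lemma uvars_ne : exists v, v \in uvars.
Proof.
by case: cls pure cls0 => [|c s] // h _; have /hasP [v _ hv] := h c (mem_head _ _); exists v.
Qed.

Lemma uvar_or c v : c \in cls -> v \in c.1 ++ c.2 -> v != [::] -> v \in uvars \/ v \in us.
Proof.
move=> hc hv h0; case hu : (v \in us); [by right | left].
rewrite mem_filter h0 hu /=; apply/flattenP; exists (c.1 ++ c.2) => //.
by apply/mapP; exists c.
Qed.

Lemma sem_clause E (beta : var -> bool) c : c \in cls ->
  (forall v, v \in uvars \/ v \in us -> if beta v then sTru E (nm v) else sFal E (nm v)) ->
  csat beta c -> sCl E (clause_args c).
Proof.
move=> hc h; have := uvar_or hc; have [] := wf hc.
case: c {hc} => [[|a [|b [|d [|]]]] [|p [|q [|]]]] //= _ _.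
rewrite /csat /= !orbF => hv /orP [/or3P [] | /orP []] /andP [h0 hb]; rewrite /sCl /=.
- left; constructor 1; have := h a (hv a _ h0).
  by rewrite (negbTE hb); apply; rewrite !inE eqxx.
- left; constructor 2; have := h b (hv b _ h0).
  by rewrite (negbTE hb); apply; rewrite !inE eqxx orbT.
- left; constructor 3; have := h d (hv d _ h0).
  by rewrite (negbTE hb); apply; rewrite !inE eqxx !orbT.
- right; left; have := h p (hv p _ h0).
  by rewrite hb; apply; rewrite !inE eqxx !orbT.
- right; right; have := h q (hv q _ h0).
  by rewrite hb; apply; rewrite !inE eqxx !orbT.
Qed.

Lemma OlistP (Q : gatom gar -> Prop) :
  (forall c, c \in cls -> Q (gCl c)) -> (forall v, v \in uvars -> Q (gVal (nm v))) ->
  (forall u, u \in us -> Q (gCh (nm u))) -> forall a, a \in Defs.set_of Olist -> Q a.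
Proof.
move=> h1 h2 h3 a; rewrite in_set_of !mem_cat => /or3P [] /mapP [x hx ->]; auto.
Qed.

Lemma mem_gCl c : c \in cls -> gCl c \in Defs.set_of Olist.
Proof. by move=> h; rewrite in_set_of !mem_cat map_f. Qed.
Lemma mem_gVal v : v \in uvars -> gVal (nm v) \in Defs.set_of Olist.
Proof. by move=> h; rewrite in_set_of !mem_cat (map_f (fun v => gVal (nm v))) ?orbT. Qed.
Lemma mem_gCh u : u \in us -> gCh (nm u) \in Defs.set_of Olist.
Proof. by move=> h; rewrite in_set_of !mem_cat (map_f (fun v => gCh (nm v))) ?orbT. Qed.

Section Shift.
Variables (E : {fset gatom gar}) (z xi : const) (phi : gatom gar -> bool).
Hypothesis hphi : forall a, phi a -> (exists x, raw a = (pE, [:: x; z])) \/ raw a = (pS, [:: z]).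

(** In the atoms selected by [phi] the constant [z] is the second argument of an [e] or the only
    argument of an [s], hence the position [nat_of_bool]. Both replacements used against a candidate
    are of this form. *)
Definition shift : {fset occ gar} :=
  [fset (a, nat_of_bool (tag a == pE)) | a in [fset a in E | phi a]]%fset.

Lemma in_shift a k : ((a, k) \in shift) = [&& a \in E, phi a & k == (tag a == pE)].
Proof.
apply/imfsetP/and3P => [[b /=] | [h1 h2 /eqP ->]]; last first.
  by exists a => //=; rewrite !inE h1.
by rewrite !inE => /andP [h1 h2] [-> ->].
Qed.

Lemma shift_replacement a : a \in E -> phi a -> replacement E z shift.
Proof.
move=> ha pa; split.
  by apply/fset0Pn; exists (a, nat_of_bool (tag a == pE)); rewrite in_shift ha pa eqxx.
move=> [b k]; rewrite in_shift => /and3P [hb pb /eqP ->]; rewrite /occurs_at /= hb /=.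
by case: (hphi pb) => [[x] |] [e1 e2]; rewrite e2 e1.
Qed.

Lemma shift_id a : a \in E -> ~~ phi a -> inE_ (replace E shift xi) (tag a) (tagged a).
Proof.
move=> ha pa; exists (replace_atom shift xi a); first by apply/imfsetP; exists a.
rewrite /raw replace_raw; congr (_, _).
rewrite (eq_map (g := fun p => p.2)); last by move=> p; rewrite in_shift (negbTE pa) andbF.
by rewrite -/unzip2 unzip2_zip // size_iota.
Qed.

Lemma shift_E a x : a \in E -> phi a -> raw a = (pE, [:: x; z]) ->
  inE_ (replace E shift xi) pE [:: x; xi].
Proof.
move=> ha pa e; exists (replace_atom shift xi a); first by apply/imfsetP; exists a.
case: e => [e1 e2]; have hs k : ((a, k) \in shift) = (k == 1) by rewrite in_shift ha pa e1.
by rewrite /raw replace_raw e2 /= !hs /= e1.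
Qed.

Lemma shift_S a : a \in E -> phi a -> raw a = (pS, [:: z]) ->
  inE_ (replace E shift xi) pS [:: xi].
Proof.
move=> ha pa e; exists (replace_atom shift xi a); first by apply/imfsetP; exists a.
case: e => [e1 e2]; have hs k : ((a, k) \in shift) = (k == 0) by rewrite in_shift ha pa e1.
by rewrite /raw replace_raw e2 /= !hs /= e1.
Qed.

Lemma replace_abducibles C : abducibles gA E -> abducibles gA (replace E C xi).
Proof. by move=> h a /imfsetP [b /= hb ->]; exact: h hb. Qed.

Lemma shift_keep p l : inE_ E p l -> (forall a, raw a = (p, l) -> ~~ phi a) ->
  inE_ (replace E shift xi) p l.
Proof.
by move=> [a ha e] h; have := shift_id ha (h _ e); case: e => e1 e2; rewrite e2 e1.
Qed.

End Shift.

(** If [E] had an [s(z)] with [z] other than [k0], then [z] could be renamed at once in [s] and in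
    the second argument of all [e], as no rule tells it from a fresh constant there. So a
    constrained [E] has only [s(k0)], and by [pVal] all the [e(v, k0)]. A satisfying assignment then
    tells which of them can be moved together with [s(k0)]. *)
Theorem gadget_fwd E F :
  constrained_explanation gA gP (Defs.set_of Olist) E F ->
  exists y : var -> bool, forall beta : var -> bool,
    (forall u, u \in us -> beta u = y u) -> ~~ all (csat beta) cls.
Proof.
move=> [/gexplanation [hE -> hO] hdeg].
(* [E] may give an existential variable both values; it then counts as true. *)
exists (fun u => gAt (nm u) k1 \in E) => beta hb; apply/negP => hsat.
have [xi hxi] := fresh_exists gP (Defs.set_of Olist) E.
have /is_degree0 hno := hdeg xi hxi.
have hS p l : inE_ E p l -> exists2 a, a \in E & raw a = (p, l) by [].
case: (boolP [exists a : E, (tag (val a) == pS) && (tval (tagged (val a)) != [:: k0])]).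
  move=> /existsP [[a ha] /= /andP [/eqP ta na]].
  have [z ez] : exists z, tval (tagged a) = [:: z].
    have := size_tuple (tagged a); move: (tval (tagged a)) => l; rewrite ta.
    case: l => [|z [|]] //= _.
    by exists z.
  have zk : z != k0 by apply: contra na => /eqP <-; rewrite ez.
  pose phi (a : gatom gar) := ((tag a == pE) && (nth k0 (tagged a) 1 == z)) ||
                              ((tag a == pS) && (nth k0 (tagged a) 0 == z)).
  have hphi b : phi b -> (exists x, raw b = (pE, [:: x; z])) \/ raw b = (pS, [:: z]).
    have := size_tuple (tagged b); rewrite /phi /raw; move: (tval (tagged b)) => l.
    move=> sl /orP [] /andP [/eqP e1 /eqP e2]; rewrite e1 in sl *; [left | right].
      by case: l sl e2 => [|x [|x' [|]]] //= _ ->; exists x.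
    by case: l sl e2 => [|x [|]] //= _ ->.
  have pa : phi a by rewrite /phi ez ta /= eqxx.
  apply: (hno z (shift E phi) (shift_replacement hphi ha pa)).
  apply/gexplanation; split=> //; first exact: replace_abducibles.
  have kA l : inE_ E pA l -> inE_ (replace E (shift E phi) xi) pA l.
    move=> h; apply: shift_keep h _ => b [e1 e2]; by rewrite /phi e2 e1.
  have kE x : inE_ E pE [:: x; k0] -> inE_ (replace E (shift E phi) xi) pE [:: x; k0].
    move=> h; apply: shift_keep h _ => b [e1 e2]; rewrite /phi e2 e1 /= orbF.
    by rewrite eq_sym.
  have kS x t : inE_ E pE [:: x; t] -> inE_ E pS [:: t] ->
      exists2 t', inE_ (replace E (shift E phi) xi) pE [:: x; t'] &
                  inE_ (replace E (shift E phi) xi) pS [:: t'].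
    move=> h1 h2; case: (t =P z) => [et | /eqP nt].
      subst t; exists xi.
        have [b hb1 e] := h1; apply: (shift_E xi hb1 _ e).
        by case: e => e1 e2; rewrite /phi e2 e1 /= eqxx.
      have [b hb1 e] := h2; apply: (shift_S xi hb1 _ e).
      by case: e => e1 e2; rewrite /phi e2 e1 /= eqxx.
    exists t; apply: shift_keep; rewrite // => b [e1 e2]; rewrite /phi e2 e1 /= ?orbF //.
  have kT x : sTru E x -> sTru (replace E (shift E phi) xi) x.
    by case=> [[t h1 h2] | /kA h]; [left; exact: kS h1 h2 | right].
  have kF x : sFal E x -> sFal (replace E (shift E phi) xi) x.
    by case=> [/kE | /kA] h; [left | right].
  apply: OlistP => [c hc | v hv | u hu].
  - by case: (hO _ (mem_gCl hc)) => [[] | []] h; [left; constructor 1 | left; constructor 2 |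
      left; constructor 3 | right; left | right; right]; auto.
  - case: (hO _ (mem_gVal hv)) => t [h1 | h1] h2.
      by have [t' h3 h4] := kS _ _ h1 h2; exists t' => //; left.
    have [b hb1 e] := h2; case pb : (phi b); last first.
      exists t; first by right; exact: kE.
      by have := shift_id xi hb1 (negbT pb); case: e => e1 e2; rewrite e2 e1.
    exists xi; first by right; exact: kE.
    by apply: (shift_S xi hb1 pb); case: (hphi _ pb) => [[x] |] // e'; move: e; rewrite e'.
  - by case: (hO _ (mem_gCh hu)) => h; [left | right]; exact: kA.
move=> /existsPn hnS.
have onlyS x : inE_ E pS [:: x] -> x = k0.
  move=> [a ha [e1 e2]]; have := hnS [` ha]%fset; rewrite /= e2 e1 eqxx negbK /=.
  by move=> /eqP [].
have hEv v : v \in uvars -> inE_ E pE [:: nm v; k0].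
  by move=> hv; case: (hO _ (mem_gVal hv)) => t [h1 | //] /onlyS e; move: h1; rewrite e.
have [a0 ha0 ea0] : inE_ E pS [:: k0].
  have [v0 hv0] := uvars_ne; case: (hO _ (mem_gVal hv0)) => t _ h.
  by move: (h); rewrite (onlyS _ h).
(* The [e(v, k0)] of the true variables move along with [s(k0)] and make them true; the others stay
   and make their variables false. *)
pose T := [seq nm v | v <- uvars & beta v].
pose phi (a : gatom gar) :=
  ((tag a == pE) && (nth k1 (tagged a) 1 == k0) && (nth k1 (tagged a) 0 \in T)) ||
  (raw a == (pS, [:: k0])).
have hphi b : phi b -> (exists x, raw b = (pE, [:: x; k0])) \/ raw b = (pS, [:: k0]).
  move=> /orP [/andP [/andP [/eqP e1 /eqP e2] _] | /eqP]; [left | by right].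
  have := size_tuple (tagged b); rewrite /raw; move: (tval (tagged b)) e2 => l e2 sl.
  by rewrite e1 in sl *; case: l sl e2 => [|x [|x' [|]]] //= _ ->; exists x.
have pa0 : phi a0 by rewrite /phi ea0 eqxx orbT.
apply: (hno k0 (shift E phi) (shift_replacement hphi ha0 pa0)).
apply/gexplanation; split=> //; first exact: replace_abducibles.
have kA l : inE_ E pA l -> inE_ (replace E (shift E phi) xi) pA l.
  move=> h; apply: shift_keep h _ => b e; rewrite /phi e; by case: e => e1 e2; rewrite e2 e1.
have rS : inE_ (replace E (shift E phi) xi) pS [:: xi] by exact: shift_S ha0 pa0 ea0.
have rT v : v \in uvars -> beta v -> inE_ (replace E (shift E phi) xi) pE [:: nm v; xi].
  move=> hv hbv; have [b hb1 e] := hEv v hv; apply: (shift_E xi hb1 _ e).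
  case: e => e1 e2; rewrite /phi e2 e1 /=; apply/orP; left; apply/mapP; exists v => //.
  by rewrite mem_filter hbv.
have rF v : v \in uvars -> ~~ beta v -> inE_ (replace E (shift E phi) xi) pE [:: nm v; k0].
  move=> hv hbv; apply: shift_keep (hEv v hv) _ => b e; rewrite /phi e.
  case: e => e1 e2; rewrite e2 e1 /= orbF; apply/mapP => -[v']; rewrite mem_filter => /andP [h1 _].
  by move/nm_inj => ev; move: hbv; rewrite ev h1.
have lit v : v \in uvars \/ v \in us ->
    if beta v then sTru (replace E (shift E phi) xi) (nm v)
    else sFal (replace E (shift E phi) xi) (nm v).
  case=> hv.
    case hbv : (beta v); first by left; exists xi => //; exact: rT.
    by left; apply: rF; rewrite ?hbv.
  rewrite hb //; case: ifP => hin.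
    by right; apply: kA; exists (gAt (nm v) k1).
  case: (hO _ (mem_gCh hv)) => [h | [a ha e]]; first by right; exact: kA.
  by move: hin; rewrite -(raw_inj (e : raw a = raw (gAt (nm v) k1))) ha.
apply: OlistP => [c hc | v hv | u hu].
- by apply: sem_clause lit _ => //; move/allP: hsat; apply.
- case hbv : (beta v); exists xi => //; first by left; exact: rT.
  by right; apply: rF; rewrite ?hbv.
- by case: (hO _ (mem_gCh hu)) => h; [left | right]; exact: kA.
Qed.

Lemma Elist_abducible y : abducibles gA (Defs.set_of (Elist y)).
Proof.
move=> a; rewrite in_set_of inE mem_cat => /or3P [/eqP -> | /mapP [v _ ->] | /mapP [v _ ->]];
  by rewrite inE.
Qed.

(** A replacement that keeps the observation is confined by it: [pCh] forbids touching an [a], and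
    [pVal] forbids touching the name in an [e] and allows moving its [k0] only together with the one
    in [s]. What remains determines one value for each variable, and the atoms [pCl] say that this
    assignment satisfies [cls]. *)
Theorem gadget_bwd (y : var -> bool) :
  (forall beta : var -> bool, (forall u, u \in us -> beta u = y u) -> ~~ all (csat beta) cls) ->
  constrained_explanation gA gP (Defs.set_of Olist) (Defs.set_of (Elist y)) fset0.
Proof.
move=> hun; set E := Defs.set_of (Elist y).
have sE : inE_ E pS [:: k0] by exists (gS k0) => //; rewrite in_set_of mem_head.
have eE v : v \in uvars -> gE (nm v) k0 \in E.
  by move=> hv; rewrite in_set_of inE mem_cat (map_f (fun v => gE (nm v) k0)) ?orbT.
have aE u : u \in us -> gAt (nm u) (if y u then k1 else k0) \in E.
  by move=> hu; rewrite in_set_of inE mem_cat (map_f (fun u => gAt (nm u) (if y u then k1 else k0))) ?orbT.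
split.
  apply/gexplanation; split=> //; first exact: Elist_abducible.
  apply: OlistP => [c hc | v hv | u hu].
  (* Before any replacement a universal variable is both true and false, so one such variable
     satisfies the clause in whichever slot it stands. *)
  - have /hasP [v hv huv] := pure hc.
    have hf : sFal E (nm v) by left; exists (gE (nm v) k0) => //; exact: eE.
    have ht : sTru E (nm v) by left; exists k0 => //; exists (gE (nm v) k0) => //; exact: eE.
    have [] := wf hc; rewrite /sem /=; case: c hv {hc} => [[|a [|b [|d [|]]]] [|p [|q [|]]]] //= + _ _.
    rewrite !inE => /or3P [/eqP e | /eqP e | /or3P [] /eqP e]; rewrite /sCl /= -e;
      by [left; constructor 1 | left; constructor 2 | left; constructor 3 | right; left | right; right].
  - by exists k0 => //; left; exists (gE (nm v) k0) => //; exact: eE.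
  - rewrite /sem /= /sCh; have := aE u hu; case: (y u) => h.
      by right; exists (gAt (nm u) k1).
    by left; exists (gAt (nm u) k0).
move=> xi [hx1 hx2]; apply/is_degree0 => c C [C0 hC] /gexplanation [_ _ hO].
have xk0 : xi <> k0.
  move=> e; have := hx1 (gS k0); rewrite in_fsetU in_set_of mem_head => /(_ isT).
  by rewrite e inE eqxx.
(* [k1] may be absent from [E]; that it is not fresh follows from a rule that mentions it. *)
have xk1 : xi <> k1.
  move=> e; have := hx2 (nth (fact (gS k0)) gadget_rules 1).
  rewrite in_fsetU in_gadget mem_nth // => /(_ isT (pA @[[:: inl 0; inr k1]])).
  by rewrite e !inE => h; suff : ~~ true by []; apply: h; rewrite eqxx orbT.
have xv v : v \in uvars -> nm v <> xi.
  move=> hv e; have := hx1 (gE (nm v) k0); rewrite in_fsetU (eE v hv) => /(_ isT).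
  by rewrite e inE eqxx.
have xu u : u \in us -> nm u <> xi.
  move=> hu e; have := hx1 (gAt (nm u) (if y u then k1 else k0)).
  by rewrite in_fsetU (aE u hu) => /(_ isT); rewrite e inE eqxx.
set E' := replace E C xi in hO.
have inv p l : inE_ E' p l -> exists2 a, a \in E & (p, l) = (tag a,
    [seq if (a, q.1) \in C then xi else q.2 | q <- zip (iota 0 (size (tagged a))) (tagged a)]).
  move=> [b /imfsetP [a /= ha ->]]; rewrite /raw replace_raw => <-; by exists a.
have caseE a : a \in E -> [\/ a = gS k0, exists2 v, v \in uvars & a = gE (nm v) k0 |
    exists2 u, u \in us & a = gAt (nm u) (if y u then k1 else k0)].
  rewrite in_set_of inE mem_cat => /or3P [/eqP -> | /mapP [v hv ->] | /mapP [v hv ->]].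
  - by constructor 1.
  - by constructor 2; exists v.
  - by constructor 3; exists v.
have invS x : inE_ E' pS [:: x] -> x = if (gS k0, 0) \in C then xi else k0.
  by move=> /inv [a /caseE [-> | [v _ ->] | [u _ ->]]] //= [].
have invE x t : inE_ E' pE [:: x; t] -> exists v, [/\ v \in uvars,
    x = if (gE (nm v) k0, 0) \in C then xi else nm v &
    t = if (gE (nm v) k0, 1) \in C then xi else k0].
  by move=> /inv [a /caseE [-> | [v hv ->] | [u _ ->]]] //= [-> ->]; exists v.
have invA x t : inE_ E' pA [:: x; t] -> exists u, let g := gAt (nm u) (if y u then k1 else k0) in
    [/\ u \in us, x = if (g, 0) \in C then xi else nm u &
    t = if (g, 1) \in C then xi else if y u then k1 else k0].
  by move=> /inv [a /caseE [-> | [v hv ->] | [u hu ->]]] //= [-> ->]; exists u.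
have invE' v t : v \in uvars -> inE_ E' pE [:: nm v; t] ->
    (gE (nm v) k0, 0) \notin C /\ t = if (gE (nm v) k0, 1) \in C then xi else k0.
  move=> hv /invE [v' [hv']]; case: ifP => [_ /(xv _ hv) // | h /nm_inj e ->].
  by rewrite e h.
have val1 v : v \in uvars -> (gE (nm v) k0, 0) \notin C /\
    ((gE (nm v) k0, 1) \in C -> (gS k0, 0) \in C).
  move=> hv; case: (hO _ (mem_gVal hv)) => t [] h1 h2; have [h3 h4] := invE' _ _ hv h1; split=> // h5.
    by move: h4; rewrite h5 => e; have := invS _ h2; rewrite e; case: ifP => // _ /xk0.
  by move: h4; rewrite h5 => /esym /xk0.
have ch1 u : u \in us -> let g := gAt (nm u) (if y u then k1 else k0) in
    (g, 0) \notin C /\ (g, 1) \notin C.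
  move=> hu; have aux t : t = k0 \/ t = k1 -> inE_ E' pA [:: nm u; t] ->
      let g := gAt (nm u) (if y u then k1 else k0) in (g, 0) \notin C /\ (g, 1) \notin C.
    move=> ht /invA [u' [hu']]; case: ifP => [_ /(xu _ hu) // | h /nm_inj e]; subst u'.
    case: ifP => h'; last by rewrite /= h h'.
    by case: ht => -> /esym; [move/xk0 | move/xk1].
  by case: (hO _ (mem_gCh hu)); apply: aux; [left | right].
(* Here the nonemptiness of [C] is used: whichever occurrence it contains, the one in [s(k0)]
   belongs to it as well. *)
have sC : (gS k0, 0) \in C.
  have /fset0Pn [[a k] hak] := C0; have := hC _ hak; rewrite /occurs_at /= => /andP [ha hk].
  case: (caseE a ha) => [e | [v hv e] | [u hu e]]; subst a.
  - by case: k hak hk => [|[|k]].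
  - have [h1 h2] := val1 v hv; case: k hak hk => [|[|[|k]]] //= hak _; last exact: h2.
    by rewrite hak in h1.
  - have [h1 h2] := ch1 u hu; case: k hak hk => [|[|[|k]]] //= hak _.
      by rewrite hak in h1.
    by rewrite hak in h2.
pose beta v := if v \in us then y v else (gE (nm v) k0, 1) \in C.
have hbu u : u \in us -> beta u = y u by rewrite /beta => ->.
have /negP := hun beta hbu; apply.
have uvN v : v \in uvars -> v != [::] /\ v \in us = false.
  by rewrite mem_filter => /andP [/andP [-> /negbTE]].
have nmv v w : w \in uvars -> nm v = (if (gE (nm w) k0, 0) \in C then xi else nm w) -> v = w.
  by move=> hw; rewrite (negbTE (val1 w hw).1) => /nm_inj.
have nmu v w : w \in us -> nm v = (if (gAt (nm w) (if y w then k1 else k0), 0) \in C then xi else nm w) -> v = w.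
  by move=> hw; rewrite (negbTE (ch1 w hw).1) => /nm_inj.
have lF v : sFal E' (nm v) -> (v != [::]) && ~~ beta v.
  case=> [/invE [w [hw /(nmv _ _ hw) -> ht]] | /invA [w [hw /(nmu _ _ hw) -> ht]]].
    have [-> h] := uvN w hw; rewrite /beta h /=; apply/negP => hc; move: ht; rewrite hc.
    by move/esym/xk0.
  rewrite /beta hw; move: ht; rewrite (negbTE (ch1 w hw).2); case: (y w) => // _.
  by rewrite andbT; apply: contraNneq us0 => <-.
have lT v : sTru E' (nm v) -> (v != [::]) && beta v.
  case=> [[t /invE [w [hw /(nmv _ _ hw) -> ht]] /invS] | /invA [w [hw /(nmu _ _ hw) -> ht]]].
    rewrite sC ht => h1; have [-> h] := uvN w hw; rewrite /beta h /=.
    by move: h1; case: ifP => // _ /esym /xk0.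
  rewrite /beta hw; move: ht; rewrite (negbTE (ch1 w hw).2); case: (y w) => // _.
  by rewrite andbT; apply: contraNneq us0 => <-.
apply/allP => cl hcl; have := hO _ (mem_gCl hcl); have [] := wf hcl; rewrite /csat.
case: cl {hcl} => [[|a [|b [|d [|]]]] [|p [|q [|]]]] //= _ _.
case=> [[] /lF -> | [] /lT ->]; by rewrite ?orbT.
Qed.

End Gadget.

(** * Computing the clauses and the encodings *)

(** The list of indices is fixed, so the map unrolls into one program per index and [I] requires no
    code. *)
Lemma pt_map_fix {X U} {CX : Code X} {CU : Code U} (I : Type) (s : seq I) (F : X -> I -> U) :
  (forall i, ptime (fun x => F x i)) -> ptime (fun x => [seq F x i | i <- s]).
Proof.
move=> h; elim: s => [|i s IH] /=; first exact: pt_const.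
by apply: pt_cons.
Qed.

Lemma pt_nth {X T} {CX : Code X} {CT : Code T} (x0 : T) i (l : X -> seq T) :
  ptime l -> ptime (fun x => nth x0 (l x) i).
Proof.
elim: i l => [|i IH] l hl.
  by apply: (pt_ext (f := fun x => head x0 (l x))); [move=> x; case: (l x) | exact: pt_head].
apply: (pt_ext (f := fun x => nth x0 (behead (l x)) i)).
  by move=> x; rewrite nth_behead.
by apply: IH; apply: pt_behead.
Qed.

Lemma pt_enc_seq {X T} {CX : Code X} {CT : Code T} (e : T -> seq bool) (l : X -> seq T) :
  ptime e -> ptime l -> ptime (fun x => enc_seq e (l x)).
Proof.
move=> he hl; apply: pt_cat; last exact: pt_const.
apply: pt_flatten; apply: (pt_map (f := fun _ y => true :: e y)) => //.
by apply: pt_cons; [exact: pt_const | exact: pt_comp pt_snd0 he].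
Qed.

Lemma pt_enc_word {X} {CX : Code X} (f : X -> seq bool) : ptime f -> ptime (fun x => enc_word (f x)).
Proof. by move=> hf; apply: pt_enc_seq => //; pts. Qed.

Definition enc_raw (a : nat * seq const) : seq bool := nseq a.1 true ++ false :: enc_seq enc_word a.2.

Lemma pt_enc_raw : ptime enc_raw.
Proof.
apply: pt_cat; first by apply: pt_nseq; pts.
apply: pt_cons; first exact: pt_const.
by apply: pt_enc_seq; [apply: pt_enc_word; pts | pts].
Qed.

Definition nraw (Rel : finType) (ar : Rel -> nat) (a : gatom ar) : nat * seq const :=
  (nat_of_ord (enum_rank (tag a)), tval (tagged a)).

Lemma nraw_inj (Rel : finType) (ar : Rel -> nat) : injective (@nraw Rel ar).
Proof.
move=> a b [e1 e2]; apply: raw_inj; rewrite /raw e2.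
by congr (_, _); apply: enum_rank_inj; apply: val_inj.
Qed.

Lemma enc_gatomsE (Rel : finType) (ar : Rel -> nat) (s : seq (gatom ar)) :
  enc_gatoms s = enc_seq enc_raw [seq nraw a | a <- s].
Proof. by rewrite /enc_gatoms /enc_seq -map_comp. Qed.

Definition prefix_free (T : Type) (e : T -> seq bool) :=
  forall x y r r', e x ++ r = e y ++ r' -> x = y /\ r = r'.

Lemma enc_seq_pf (T : Type) (e : T -> seq bool) : prefix_free e -> prefix_free (enc_seq e).
Proof.
move=> he; elim=> [|x s IH] [|y s'] r r'; rewrite /enc_seq //=; first by case.
rewrite -!catA => -[/he [-> h]].
by have [|-> ->] := IH s' r r'; rewrite // /enc_seq -!catA.
Qed.

Lemma enc_word_pf : prefix_free enc_word.
Proof. by apply: enc_seq_pf => b b' r r' []. Qed.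

Lemma enc_raw_pf : prefix_free enc_raw.
Proof.
move=> [i s] [j s'] r r'; rewrite /enc_raw /= -!catA /=.
elim: i j => [|i IH] [|j] //= [] //; last by move=> /IH [[-> ->] ->].
by move=> /(enc_seq_pf enc_word_pf) [-> ->].
Qed.

Lemma enc_gatoms_pf (Rel : finType) (ar : Rel -> nat) : prefix_free (@enc_gatoms Rel ar).
Proof.
move=> x y r r'; rewrite !enc_gatomsE => /(enc_seq_pf enc_raw_pf) [h ->]; split=> //.
exact: (inj_map (@nraw_inj _ _)) h.
Qed.

(** * The clauses of a fixed machine are generated in polynomial time *)

Section PtClauses.
Variable m : machine.
Notation Q := (option (mst m)).

Ltac ptc := repeat first
 [ pt1 | apply: pt_cat | apply: pt_add | apply: pt_iota0 | apply: pt_flatten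
 | (apply: pt_map_fix => ?) | (apply: pt_map; cbv beta) ].

Lemma pt_keep (q : Q) rs : ptime (fun p : nat * nat => keep p.1 p.2 q rs).
Proof. by rewrite /keep /hcl /vQ /vP; ptc. Qed.

Lemma pt_step (q : Q) : ptime (fun p : nat * nat * nat => step_clauses p.1.1 p.1.2 p.2 q).
Proof.
have hk (q' : Q) rs : ptime (fun p : nat * nat * nat => keep p.1.2 p.2 q' rs).
  apply: (pt_comp (f := fun p : nat * nat * nat => (p.1.2, p.2)) _ (pt_keep q' rs)); pts.
case: q => [q|]; rewrite /step_clauses /goto /hcl /vQ /vP /vB /vL; last by ptc.
by case: (mins q) => [r b q' | r q' | r p q1 q2]; ptc.
Qed.

Lemma pt_run : ptime (fun p : nat * nat => run_clauses m p.1 p.2).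
Proof.
rewrite /run_clauses /init_clauses /unit_cl /ocl /vQ /vP /vB /vL; apply: pt_cat; first by ptc.
apply: pt_flatten; apply: pt_map; cbv beta; last by ptc.
apply: pt_flatten; apply: pt_map_fix => q.
by apply: (pt_comp (f := fun p : nat * nat * nat => (p.1.1, p.1.1.+1 + p.1.2, p.2)) _ (pt_step q)); ptc.
Qed.

Lemma pt_input : ptime (fun p : seq bool * nat * nat => input_clauses p.1.1 p.1.2 p.2).
Proof.
have hs : ptime (fun p : seq bool * nat * nat => size p.1.1) by apply: pt_nsize; pts.
have hsj : ptime (fun p : seq bool * nat * nat * nat => size p.1.1.1 + p.2).
  by apply: pt_add; [apply: pt_nsize; pts | pts].
have hsj2 : ptime (fun p : seq bool * nat * nat * nat => size p.1.1.1 + p.1.1.2 + p.2).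
  by apply: pt_add; [apply: pt_add; [apply: pt_nsize; pts | pts] | pts].
have hb : ptime (fun p : seq bool * nat * nat * (nat * bool) => bit_num (Some p.2.2)).
  by apply: (pt_comp (f := fun p : seq bool * nat * nat * (nat * bool) => p.2.2)
      (g := fun b : bool => bit_num (Some b))); [pts | exact: pt_fin].
rewrite /input_clauses /unit_cl /ocl /hcl /vU /vB.
apply: pt_cat.
  apply: pt_map; cbv beta; first by pts.
  by apply: pt_zip; [apply: pt_iota0 | pts].
by repeat apply: pt_cat; ptc.
Qed.

Lemma pt_final : ptime (fun p : nat * nat => final_clauses p.1 p.2).
Proof. by rewrite /final_clauses /ncl /vP /vB; ptc. Qed.

Lemma pt_clauses : ptime (fun p : seq bool * nat * nat * nat =>
  clauses m p.1.1.1 p.1.1.2 p.1.2 p.2).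
Proof.
have hn : ptime (fun p : seq bool * nat * nat * nat => size p.1.1.1 + p.1.1.2 + p.1.2).
  by apply: pt_add; [apply: pt_add; [apply: pt_nsize; pts | pts] | pts].
rewrite /clauses; apply: pt_cat; last apply: pt_cat.
- by apply: (pt_comp (f := fun p : seq bool * nat * nat * nat =>
    (size p.1.1.1 + p.1.1.2 + p.1.2, p.2)) _ pt_run); pts.
- by apply: (pt_comp (f := fun p : seq bool * nat * nat * nat => p.1) _ pt_input); pts.
- apply: (pt_comp (f := fun p : seq bool * nat * nat * nat =>
    ((size p.1.1.1 + p.1.1.2 + p.1.2).+1 + p.2, p.2)) _ pt_final); pts.
  by apply: pt_add; pts.
Qed.

(** 4 is the tag of the variables [vU], the only ones that become existential; a proper clause thus
    contains a universal variable. *)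
Definition proper (c : clause) : bool :=
  [&& size c.1 == 3, size c.2 == 2 & has (fun v => (v != [::]) && (head 0 v != 4)) (c.1 ++ c.2)].

Lemma clauses_proper w m1 m2 T : all proper (clauses m w m1 m2 T).
Proof.
have hm (I : eqType) (F : I -> clause) s : (forall i, proper (F i)) -> all proper (map F s).
  by move=> h; apply/allP => c /mapP [i _ ->].
have hk N t q rs : all proper (@keep m N t q rs).
  by apply/allP => c /allpairsP [[r d] [_ _ ->]].
rewrite /clauses (all_cat _ (run_clauses m _ T)) (all_cat _ (input_clauses w m1 m2)).
apply/and3P; split.
- rewrite /run_clauses all_cat; apply/andP; split.
    rewrite /init_clauses all_cat; apply/andP; split; last by apply: hm.
    by rewrite /= /proper /=.
  apply/allP => c /flattenP [s1 /mapP [t _ ->]] /flattenP [s2 /mapP [q _ ->]].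
  apply/allP; case: q => [q|]; rewrite /step_clauses.
  2: by rewrite -cat1s all_cat; apply/andP; split; [| exact: hk].
  case: (mins q) => [r b q' | r q' | r p q1 q2].
  + by rewrite !all_cat; apply/and3P; split; [| exact: hm | exact: hk].
  + rewrite -cat1s all_cat; apply/andP; split=> //; rewrite all_cat; apply/andP; split.
      by apply/allP => c' /allpairsP [[d d'] [_ _ ->]].
    exact: hk.
  + rewrite all_cat; apply/andP; split; last exact: hk.
    by apply/allP => c' /allpairsP [[d d'] [_ _ ->]].
- by rewrite /input_clauses !all_cat; apply/and4P; split; exact: hm.
- by apply/allP => c' /allpairsP [[d d'] [_ _ ->]].
Qed.

End PtClauses.

Definition evars (n : nat) : seq var := [seq vU j | j <- iota 0 n].

(** The observation as it is written in the input, free of dependent types; 7, 5 and 6 are the ranks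
    of [pCl], [pVal] and [pCh]. Below, 2 and 0 are those of [pS] and [pE]. *)
Definition rawO (cls : seq clause) (us : seq var) : seq (nat * seq const) :=
  [seq (7, clause_args c) | c <- cls] ++ [seq (5, [:: nm v]) | v <- uvars cls us] ++
  [seq (6, [:: nm u]) | u <- us].

Definition rawE (cls : seq clause) (us : seq var) : seq (nat * seq const) :=
  (2, [:: k0]) :: [seq (0, [:: nm v; k0]) | v <- uvars cls us].

Lemma rank_ord n (p : 'I_n) : nat_of_ord (enum_rank p) = p.
Proof. by rewrite enum_rank_ord. Qed.

Lemma rawOE cls us : [seq nraw a | a <- Olist cls us] = rawO cls us.
Proof.
by rewrite /Olist !map_cat -!map_comp; congr (_ ++ (_ ++ _)); apply: eq_map => x;
  rewrite /= /nraw /= rank_ord.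
Qed.

Lemma rawEE cls y : [seq nraw a | a <- Elist cls [::] y] = rawE cls [::].
Proof.
rewrite /Elist cats0 /= -map_comp /rawE {1}/nraw rank_ord; congr (_ :: _).
by apply: eq_map => x; rewrite /= /nraw /= rank_ord.
Qed.

Section PtRaw.
Context {X : Type} {CX : Code X}.
Variables (cls : X -> seq clause) (us : X -> seq var).
Hypotheses (hc : ptime cls) (hu : ptime us).

Lemma pt_nm : ptime nm.
Proof.
apply: pt_flatten; apply: (pt_map (f := fun _ i => nseq i true ++ [:: false])); last by pts.
by apply: pt_cat; [apply: pt_nseq; pts | pts].
Qed.

Lemma pt_clause_args : ptime clause_args.
Proof.
have h1 i : ptime (fun c : clause => nm (nth [::] c.1 i)).
  by apply: (pt_comp (f := fun c : clause => nth [::] c.1 i) _ pt_nm); apply: pt_nth; pts.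
have h2 i : ptime (fun c : clause => nm (nth [::] c.2 i)).
  by apply: (pt_comp (f := fun c : clause => nth [::] c.2 i) _ pt_nm); apply: pt_nth; pts.
by rewrite /clause_args; pts.
Qed.

Lemma pt_uvars : ptime (fun x => uvars (cls x) (us x)).
Proof.
rewrite /uvars; apply: pt_filter.
  apply: pt_and; apply: pt_neg; first by apply: pt_eq; pts.
  by apply: pt_mem; [pts | exact: pt_comp pt_fst0 hu].
apply: pt_flatten; apply: (pt_map (f := fun _ c => c.1 ++ c.2)) => //.
by apply: pt_cat; pts.
Qed.

Lemma pt_rawO : ptime (fun x => rawO (cls x) (us x)).
Proof.
have hn : ptime (fun p : X * var => nm p.2) by exact: pt_comp pt_snd0 pt_nm.
apply: pt_cat; last apply: pt_cat.
- apply: (pt_map (f := fun _ c => (7, clause_args c))) => //.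
  by apply: pt_pair; [exact: pt_const | exact: pt_comp pt_snd0 pt_clause_args].
- by apply: (pt_map (f := fun _ v => (5, [:: nm v]))); [pts | exact: pt_uvars].
- by apply: (pt_map (f := fun _ v => (6, [:: nm v]))); pts.
Qed.

Lemma pt_rawE : ptime (fun x => rawE (cls x) (us x)).
Proof.
have hn : ptime (fun p : X * var => nm p.2) by exact: pt_comp pt_snd0 pt_nm.
apply: pt_cons; first exact: pt_const.
by apply: (pt_map (f := fun _ v => (0, [:: nm v; k0]))); [pts | exact: pt_uvars].
Qed.

End PtRaw.

Lemma proper_gadget cls k : all proper cls -> cls != [::] ->
  [/\ forall c, c \in cls -> size c.1 = 3 /\ size c.2 = 2, [::] \notin evars k &
      forall c, c \in cls -> has (mem (uvars cls (evars k))) (c.1 ++ c.2)].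
Proof.
move=> /allP h _; split.
- by move=> c /h /and3P [/eqP -> /eqP ->].
- by apply/mapP => -[].
- move=> c hc; have /and3P [_ _ /hasP [v hv /andP [v0 v4]]] := h c hc.
  apply/hasP; exists v => //; rewrite inE mem_filter v0 /=; apply/andP; split.
    by apply/mapP => -[j _ e]; rewrite e in v4.
  by apply/flattenP; exists (c.1 ++ c.2) => //; apply: map_f.
Qed.

(** [h] accepts the counterexamples. *)
Theorem clause_family (m1 m2 : seq bool -> nat) (h : seq bool -> bool) :
  ptime m1 -> ptime m2 -> ptime h ->
  exists2 cls : seq bool -> seq clause, ptime cls & forall x,
    [/\ all proper (cls x), cls x != [::] &
     (exists y : var -> bool, forall beta : var -> bool,
        (forall u, u \in evars (m1 x) -> beta u = y u) -> ~~ all (csat beta) (cls x)) <->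
     (exists2 y1, size y1 = m1 x & forall y2, size y2 = m2 x ->
        ~~ h (enc_word x ++ y1 ++ y2))].
Proof.
move=> h1 h2 hh.
have [|c [k hc]] := @pt_raw (fun z => [:: h z]); first by pts.
pose m := compile c.
(* A time that depends only on lengths serves all strings to be tried at once; a run that ends
   earlier idles in the exit state. *)
pose T x := (size (enc_word x) + m1 x + m2 x + 2) ^ k.
have hw : ptime (fun x : seq bool => enc_word x) by apply: pt_enc_word; pts.
have hT : ptime T.
  apply: pt_expn; apply: pt_add; last exact: pt_const.
  by do 2![apply: pt_add => //]; apply: pt_nsize.
exists (fun x => clauses m (enc_word x) (m1 x) (m2 x) (T x)).
  by apply: (pt_comp (f := fun x => (enc_word x, m1 x, m2 x, T x)) _ (pt_clauses m)); pts.
move=> x; split=> //; first exact: clauses_proper.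
have hrun z : size z = size (enc_word x) + m1 x + m2 x ->
    iter (T x) (@mstep m) (mstart m, St z [::] [::] [::]) = (None, St [:: h z] [::] [::] [::]).
  move=> sz_z; have [t ht /compile_correct /mpath_iter e] := hc z.
  by rewrite /T -sz_z -(subnK ht) iterD e mstep_exit.
have key := clauses_correct hrun.
split=> [[y hy] | [y1 s1 hy]].
  exists (mkseq (fun j => y (vU j)) (m1 x)); first by rewrite size_mkseq.
  move=> y2 s2; apply/negP => ha.
  have [|_ /(_ (ex_intro2 _ _ y2 s2 ha)) [beta hb hs]] := key (mkseq (fun j => y (vU j)) (m1 x)).
    by rewrite size_mkseq.
  move: hs; apply/negP; apply: hy => u /mapP [j]; rewrite mem_iota => hj ->.
  by rewrite hb // nth_mkseq.
(* [nth 0 v 1] recovers [j] from [vU j]. *)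
exists (fun v => nth false y1 (nth 0 v 1)) => beta hb; apply/negP => hs.
have [/(_ _) hk _] := key y1 s1.
have [|y2 s2 ha] := hk; last by move: ha; apply/negP; exact: hy.
exists beta => // j hj; rewrite hb //; apply/mapP; exists j => //; by rewrite mem_iota.
Qed.

(** ** The hardness reductions *)

(** The quantified strings have exact lengths, because one set of clauses describes inputs of one
    length, and the matrix is a negated test, because unsatisfiability is what the gadget
    expresses. *)
Definition normal2 (L : language) := exists m1 m2 h,
  [/\ ptime m1, ptime m2, ptime h & forall x, L x <->
   (exists2 y1, size y1 = m1 x & forall y2, size y2 = m2 x -> ~~ h (enc_word x ++ y1 ++ y2))].

Definition normal1 (L : language) := exists m2 h,
  [/\ ptime m2, ptime h & forall x, L x <->
   (forall y2, size y2 = m2 x -> ~~ h (enc_word x ++ y2))].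

Theorem existence_hard L : normal2 L -> reducible L (constrained_existence gA gadget).
Proof.
move=> [m1 [m2 [h [h1 h2 hh hL]]]].
have [cls hc hcls] := clause_family h1 h2 hh.
have hu : ptime (fun x => evars (m1 x)).
  by apply: pt_map; [rewrite /vU; pts | apply: pt_iota0].
exists (fun x => enc_seq enc_raw [::] ++ enc_seq enc_raw (rawO (cls x) (evars (m1 x)))).
  apply: ptime_polytime; apply: pt_cat; first exact: pt_const.
  by apply: pt_enc_seq pt_enc_raw _; exact: pt_rawO.
move=> x; have [hp h0 ex] := hcls x; have [wf us0 pure] := proper_gadget (m1 x) hp h0.
rewrite hL -ex.
have -> : enc_seq enc_raw [::] ++ enc_seq enc_raw (rawO (cls x) (evars (m1 x))) =
   enc_gatoms ([::] : seq (gatom gar)) ++ enc_gatoms (Olist (cls x) (evars (m1 x))).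
  by rewrite !enc_gatomsE rawOE.
split=> [[y hy] | [b [o [e _ _ [E [F hEF]]]]]].
  exists [::], (Olist (cls x) (evars (m1 x))); split=> //.
    by move=> a; rewrite in_set_of.
    by apply: (OlistP (Q := fun a => tag a \notin gA)) => *; rewrite inE.
  by exists (Defs.set_of (Elist (cls x) (evars (m1 x)) y)), fset0; exact: gadget_bwd.
have [eb eo] := enc_gatoms_pf e; subst b.
have [eo' _] : Olist (cls x) (evars (m1 x)) = o /\ ([::] : seq bool) = [::].
  by apply: enc_gatoms_pf; rewrite !cats0.
subst o; exact: (gadget_fwd wf pure h0 hEF).
Qed.

(** Without existential variables the candidate explanation does not depend on any choice, so the
    reduction can write it into the input. *)
Theorem recognition_hard L : normal1 L -> reducible L (constrained_recognition gA gadget).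
Proof.
move=> [m2 [h [h2 hh hL]]].
have [|cls hc hcls] := clause_family (m1 := fun=> 0) _ h2 hh; first exact: pt_const.
pose nil := enc_seq enc_raw [::].
exists (fun x => nil ++ enc_seq enc_raw (rawO (cls x) [::]) ++
                 enc_seq enc_raw (rawE (cls x) [::]) ++ nil).
  apply: ptime_polytime; apply: pt_cat; first exact: pt_const.
  apply: pt_cat; last (apply: pt_cat; last exact: pt_const).
    by apply: pt_enc_seq pt_enc_raw _; apply: pt_rawO => //; exact: pt_const.
  by apply: pt_enc_seq pt_enc_raw _; apply: pt_rawE => //; exact: pt_const.
move=> x; have [hp h0 ex] := hcls x; have [wf us0 pure] := proper_gadget 0 hp h0.
have -> : L x <-> (exists y : var -> bool, forall beta : var -> bool,
    (forall u, u \in evars 0 -> beta u = y u) -> ~~ all (csat beta) (cls x)).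
  rewrite ex hL; split=> [hy | [y1 /size0nil -> hy]]; last by move=> y2 /hy.
  by exists [::] => // y2 /hy.
pose y0 (v : var) := false.
have -> : nil ++ enc_seq enc_raw (rawO (cls x) [::]) ++
                 enc_seq enc_raw (rawE (cls x) [::]) ++ nil =
   enc_gatoms ([::] : seq (gatom gar)) ++ enc_gatoms (Olist (cls x) [::]) ++
   enc_gatoms (Elist (cls x) [::] y0) ++ enc_gatoms ([::] : seq (gatom gar)).
  by rewrite !enc_gatomsE rawOE rawEE.
have f0 : Defs.set_of ([::] : seq (gatom gar)) = fset0 by apply/fsetP => a; rewrite in_set_of.
split=> [[y hy] | [b [o [e [f [eq _ _ _ hEF]]]]]].
  exists [::], (Olist (cls x) [::]), (Elist (cls x) [::] y0), [::]; split=> //.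
  - by move=> a; rewrite in_set_of.
  - by apply: (OlistP (Q := fun a => tag a \notin gA)) => *; rewrite inE.
  - by split; [exact: Elist_abducible | move=> a; rewrite in_set_of].
  have := @gadget_bwd (cls x) [::] wf us0 pure y0; rewrite -f0; apply=> beta hb; exact: hy.
have [eb eq2] := enc_gatoms_pf eq; subst b.
have [eo eq3] := enc_gatoms_pf eq2; subst o.
exact: (gadget_fwd (us := [::]) wf pure h0 hEF).
Qed.

(** * Normal forms of coNP and of the second level *)

(** An automaton that reads [enc_pair] in one pass: the first flag says that the first word has
    ended, the second that a bit has been announced. *)
Definition upstep (s : (bool * bool) * (seq bool * seq bool)) (b : bool) :=
  if s.1.1 then (s.1, (s.2.1, rcons s.2.2 b)) else
  if s.1.2 then ((false, false), (rcons s.2.1 b, s.2.2)) else ((~~ b, b), s.2).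

Definition unpair (z : seq bool) : seq bool * seq bool :=
  (foldl upstep ((false, false), ([::], [::])) z).2.

Lemma unpairK x y : unpair (enc_pair x y) = (x, y).
Proof.
have hy c a : foldl upstep ((true, false), (a, c)) y = ((true, false), (a, c ++ y)).
  elim: y c => [|b y IH] c /=; first by rewrite cats0.
  by rewrite /upstep /= IH cat_rcons.
have hx a : foldl upstep ((false, false), (a, [::])) (enc_word x ++ y) = ((true, false), (a ++ x, y)).
  elim: x a => [|b x IH] a; first by rewrite /= hy cats0.
  by rewrite -cat_rcons -IH.
by rewrite /unpair /enc_pair hx.
Qed.

Lemma pt_unpair : ptime unpair.
Proof.
apply: pt_snd; apply: (pt_foldl (X := seq bool) (f := fun _ => upstep) (l := fun z => z)); first last.
- exists 4 => x [[d fl] [a c]] b.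
  have h16 : (0 + 2) ^ 4 <= (sz x + sz b + 2) ^ 4 by exact: pow_mono.
  have hb (b' : bool) : sz b' <= 3 by exact: sz_bool.
  have hd : 0 < sz d by exact: sz_gt0.
  have hf : 0 < sz fl by exact: sz_gt0.
  rewrite /upstep /=; case: ifP => _; last case: ifP => _; rewrite !sz_pair ?sz_rcons.
  + by move: (hb b) (hb d); lia.
  + by move: (hb b) (hb false); lia.
  + by move: (hb b) (hb (~~ b)); lia.
- by pts.
- by pts.
rewrite /upstep; pts; try (by apply: pt_rcons; pts).
Qed.

Definition unpad (l : seq bool) : seq bool :=
  (foldl (fun (s : bool * seq bool) b => if s.1 then (true, rcons s.2 b) else (b, s.2))
     (false, [::]) l).2.

Lemma unpadE b l : unpad (b :: l) = if b then l else unpad l.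
Proof.
case: b => //=; rewrite /unpad /=; rewrite -[RHS]/([::] ++ l).
by elim: l [::] => [|b l IH] a /=; rewrite ?cats0 // IH cat_rcons.
Qed.

Lemma size_unpad l n : size l = n.+1 -> size (unpad l) <= n.
Proof.
elim: l n => [|b l IH] n //= [e]; rewrite unpadE; case: b; first by rewrite e.
by case: n e => [/size0nil -> // | n /IH h]; apply: leqW.
Qed.

(** Turns the lengths up to [n] into the single length [n + 1]; the first [true] ends the
    padding. *)
Definition pad n (y : seq bool) := nseq (n - size y) false ++ true :: y.

Lemma size_pad n y : size y <= n -> size (pad n y) = n.+1.
Proof. by move=> h; rewrite size_cat size_nseq /=; lia. Qed.

Lemma padK n y : unpad (pad n y) = y.
Proof. by rewrite /pad; elim: (n - size y) => [|k IH] /=; rewrite unpadE. Qed.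

Lemma pt_unpad : ptime unpad.
Proof.
apply: pt_snd; apply: (pt_foldl (X := seq bool) (f := fun _ (s : bool * seq bool) b =>
  if s.1 then (true, rcons s.2 b) else (b, s.2)) (l := fun z => z)); first last.
- exists 4 => x [d a] b.
  have h16 : (0 + 2) ^ 4 <= (sz x + sz b + 2) ^ 4 by exact: pow_mono.
  have hb (b' : bool) : sz b' <= 3 by exact: sz_bool.
  have hd : 0 < sz d by exact: sz_gt0.
  case: ifP => _; rewrite !sz_pair ?sz_rcons /=; move: (hb b) (hb true); lia.
- by pts.
- by pts.
by pts; apply: pt_rcons; pts.
Qed.

Lemma size_enc_word x : size (enc_word x) = (size x).*2.+1.
Proof. by elim: x => // b x IH; rewrite -[LHS]/((size (enc_word x)).+2) IH doubleS. Qed.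

Theorem coNP_normal1 L : coNP L -> normal1 L.
Proof.
move=> [L' [p [[f /polytime_ptime hf hL'] hL]]].
exists (fun x => (p.[size x]%R).+1).
(* [f] decides the complement of [L'], so this test recognises the certificates against [x]. *)
exists (fun z => f (enc_pair (unpair z).1 (unpad (unpair z).2)) != [:: true]); split.
- by apply: pt_S; apply: pt_horner; apply: pt_nsize; pts.
- apply: pt_neg; apply: pt_eq; last by pts.
  apply: pt_comp hf; apply: pt_cat; first by apply: pt_enc_word; apply: pt_fst; exact: pt_unpair.
  by apply: pt_comp pt_unpad; apply: pt_snd; exact: pt_unpair.
move=> x; split=> [hx y2 s2 | h].
  rewrite (unpairK x y2) negbK /=; apply/eqP/hL' => hn.
  have [_ h2] := hL x; apply: h2 => //.
  by exists (unpad y2); split=> //; exact: size_unpad.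
apply: NNPP => hx; have [h1 _] := hL x; have [y [sy hy]] := h1 hx.
have := h (pad (p.[size x]%R) y) (size_pad sy).
by rewrite (unpairK x) negbK padK => /eqP /hL'.
Qed.

Theorem Sigma2_normal2 L : Sigma2P L -> normal2 L.
Proof.
move=> [L1 [p1 [[L2 [p2 [[f /polytime_ptime hf hf2] hL1]]] hL]]].
pose m1 (x : seq bool) := (p1.[size x]%R).+1.
(* [(size x).*2.+1] is the length of [enc_word x], so this bounds [p2] at the length of every pair
   of [x] with a first certificate. *)
pose m2 (x : seq bool) := (p2.[(size x).*2.+1 + p1.[size x]]%R).+1.
pose z1 z := enc_pair (unpair z).1 (unpad (take (m1 (unpair z).1) (unpair z).2)).
pose y2 z := unpad (drop (m1 (unpair z).1) (unpair z).2).
have pm1 : ptime m1 by apply: pt_S; apply: pt_horner; apply: pt_nsize; pts.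
have pu1 : ptime (fun z => (unpair z).1) by apply: pt_fst; exact: pt_unpair.
have pu2 : ptime (fun z => (unpair z).2) by apply: pt_snd; exact: pt_unpair.
have pmu : ptime (fun z => m1 (unpair z).1) by exact: pt_comp pu1 pm1.
have pz1 : ptime z1.
  apply: pt_cat; first by apply: pt_enc_word.
  by apply: pt_comp pt_unpad; apply: pt_take.
have py2 : ptime y2 by apply: pt_comp pt_unpad; apply: pt_drop.
(* The actual pair may be shorter than the bound used in [m2], so the length of the second
   certificate has to be tested again. *)
exists m1, m2, (fun z => (size (y2 z) <= p2.[size (z1 z)]%R) && (f (enc_pair (z1 z) (y2 z)) != [:: true])).
split=> //.
- apply: pt_S; apply: pt_horner; apply: pt_add; last by apply: pt_horner; apply: pt_nsize; pts.
  apply: pt_S; apply: (pt_ext (f := fun x => size x + size x)); first by move=> x; rewrite addnn.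
  by apply: pt_add; apply: pt_nsize; pts.
- apply: pt_and; first by apply: pt_leq; [|apply: pt_horner]; apply: pt_nsize.
  apply: pt_neg; apply: pt_eq; last by pts.
  by apply: pt_comp hf; apply: pt_cat => //; apply: pt_enc_word.
have eu x a b : size a = m1 x -> z1 (enc_word x ++ a ++ b) = enc_pair x (unpad a) /\
    y2 (enc_word x ++ a ++ b) = unpad b.
  by move=> sa; rewrite /z1 /y2 (unpairK x) /= -sa take_size_cat // drop_size_cat.
move=> x; split=> [/hL [y [sy hy]] | [a sa h]].
  exists (pad (p1.[size x]%R) y); first exact: size_pad.
  move=> b sb; have [-> ->] := eu x _ b (size_pad sy); rewrite padK negb_and negbK.
  case: leqP => //= hle; apply/eqP/hf2 => hn.
  by have [_ h2] := hL1 (enc_pair x y); apply: h2 => //; exists (unpad b).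
apply/hL; exists (unpad a); split; first exact: size_unpad.
apply: NNPP => hn; have [h1 _] := hL1 (enc_pair x (unpad a)); have [y [sy hy]] := h1 hn.
have sy' : size y <= (p2.[(size x).*2.+1 + p1.[size x]]%R).
  apply: leq_trans sy _; apply: horner_nat_mono; rewrite size_cat size_enc_word leq_add2l.
  exact: size_unpad.
have := h (pad _ y) (size_pad sy').
have [-> ->] := eu x a (pad (p2.[(size x).*2.+1 + p1.[size x]]%R) y) sa.
by rewrite padK sy negbK => /eqP /hf2.
Qed.

(** * Renaming constants *)

Section Renaming.
Variables (Rel : finType) (ar : Rel -> nat).
Implicit Types (a : gatom ar) (P R : {fset rule ar}) (A : {set Rel}).
Implicit Types (B O E F : {fset gatom ar}).

Definition gmap (h : const -> const) a : gatom ar :=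
  Tagged (fun p => (ar p).-tuple const) (map_tuple h (tagged a)).

Lemma gmap_id h a : {in tval (tagged a), forall c, h c = c} -> gmap h a = a.
Proof. by move=> hh; apply: raw_inj; congr (_, _); apply: map_id_in. Qed.

Lemma instantiate_map h v (b : atom ar) :
  (forall c, (inr c : term) \in aterms b -> h c = c) ->
  gmap h (instantiate v b) = instantiate (fun n => h (v n)) b.
Proof.
move=> hb; apply: raw_inj; congr (_, _); rewrite /= -map_comp.
by apply/eq_in_map => -[n|c] //= hc; apply: hb.
Qed.

(** The preimage of [M] under [gmap h] is a Herbrand model. Facts are treated apart, since [h] may
    move their constants. Rules need to hold in [M] only for valuations with values of [h], so [M]
    may live on a finite universe. *)
Lemma least_model_map P (M : gatom ar -> Prop) h :
  (forall r, r \in P ->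
     (exists2 b, r = fact b & M (gmap h b)) \/
     (forall c, c \in rule_consts r -> h c = c) /\
     (forall v, (forall b, b \in r.2 -> M (instantiate (fun n => h (v n)) b)) ->
        M (instantiate (fun n => h (v n)) r.1))) ->
  forall a, least_model P a -> M (gmap h a).
Proof.
move=> hP a /(_ (fun a => M (gmap h a))); apply=> r /hP [[b -> hM] | [hc hM]] v hb.
  by rewrite instantiate_fact.
have hi b : b \in r.1 :: r.2 -> gmap h (instantiate v b) = instantiate (fun n => h (v n)) b.
  by move=> hbr; apply: instantiate_map => c hcb; apply: hc; apply: rule_constsP hcb.
rewrite hi ?mem_head //; apply: hM => b hbr; rewrite -hi ?inE ?hbr ?orbT //; exact: hb.
Qed.

Lemma fact_const a c : c \in rule_consts (fact a) -> c \in tval (tagged a).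
Proof.
rewrite /rule_consts /= cats0 mem_pmap => /mapP [t ht]; move: ht; rewrite /aterms /=.
by move=> /mapP [d hd ->] [->].
Qed.

Lemma facts_sub_consts P F a c : (facts F `<=` P)%fset -> a \in F -> c \in tval (tagged a) ->
  exists2 r, r \in P & c \in rule_consts r.
Proof.
move=> /fsubsetP hs ha hc; exists (fact a); first by apply: hs; rewrite mem_facts.
rewrite /rule_consts /= cats0 mem_pmap; apply/mapP; exists (inr c) => //.
by rewrite /aterms /=; apply: map_f.
Qed.

(** A renaming that only introduces a constant foreign to [P] cannot send an atom
    outside [F] into [F]. *)
Lemma explanation_map A P O E E' F h xi :
  (forall r, r \in P -> forall c, c \in rule_consts r -> h c = c /\ c <> xi) ->
  (forall a, a \in O -> forall c, c \in tval (tagged a) -> h c = c) ->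
  (forall c, h c = c \/ h c = xi) ->
  (forall a, a \in E -> gmap h a \in E') ->
  (forall b, b \in E' -> exists2 a, a \in E & b = gmap h a) ->
  explanation A P O E F -> explanation A P O E' F.
Proof.
move=> hP hO hx hE hE' [aE aF /fdisjointP dEF sF hM].
have key a : gmap h a \in F -> gmap h a = a.
  move=> ha; apply: gmap_id => c hc; case: (hx c) => // e.
  have [|r hr hcr] := facts_sub_consts (c := h c) sF ha; first exact: map_f.
  by have [_] := hP r hr _ hcr; rewrite e.
split=> //.
- by move=> b /hE' [a ha ->]; exact: aE ha.
- apply/fdisjointP => b /hE' [a ha ->]; apply/negP => hF.
  by move: (dEF a ha); rewrite -(key a hF) hF.
move=> a ha; have -> : a = gmap h a by rewrite gmap_id // => c; exact: hO ha c.
move: (hM a ha); apply: least_model_map => r; rewrite in_fsetD in_fsetU => /andP [nF /orP [hr | hr]].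
  right; split=> [c hc | v hb]; first by case: (hP r hr c hc).
  by apply: least_model_rule hb; rewrite in_fsetD nF in_fsetU hr.
have [b hb er] := in_facts _ _ hr; left; exists b => //; apply: least_model_fact.
rewrite in_fsetD in_fsetU !mem_facts hE // orbT andbT.
by apply/negP => hF; move: nF; rewrite er mem_facts -(key b hF) hF.
Qed.

Lemma replace_gmap C x h a :
  (forall k c, onth (tagged a) k = Some c -> (if (a, k) \in C then x else c) = h c) ->
  replace_atom C x a = gmap h a.
Proof.
move=> hh; apply: raw_inj; congr (_, _); rewrite replace_raw /=.
apply: (@eq_from_nth _ [::]); first by rewrite !size_map size_zip size_iota minnn.
move=> k; rewrite size_map size_zip size_iota minnn => hk.
rewrite (nth_map (0, [::])) ?size_zip ?size_iota ?minnn // nth_zip ?size_iota // nth_iota //.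
by rewrite (nth_map [::]) //=; apply: hh; rewrite onthE (nth_map [::]).
Qed.

(** Any fresh constant may be used to compute the degree. *)
Lemma explanation_fresh A P O E F C c xi xi' :
  replacement E c C -> fresh P O E xi -> fresh P O E xi' ->
  explanation A P O (replace E C xi) F -> explanation A P O (replace E C xi') F.
Proof.
move=> [_ hC] [f1 f2] [g1 g2].
pose h (c : const) := if c == xi then xi' else c.
have hid s : xi \notin s -> forall c, c \in s -> h c = c.
  by move=> hs d hd; rewrite /h; case: eqP => // e; rewrite -e hd in hs.
have hrc r : r \in P -> xi \notin rule_consts r /\ xi' \notin rule_consts r.
  move=> hr; split; apply/negP => /flattenP [s /mapP [b hb ->]]; rewrite mem_pmap => /mapP [[n|d] // hd [e]];
    subst d; [have := f2 r hr b hb | have := g2 r hr b hb]; by move/negP; apply.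
(* Where [C] has put [xi], the renaming turns it into [xi']; elsewhere in [E] there is no [xi], as
   it is fresh. *)
have hrep a : a \in E -> replace_atom C xi' a = gmap h (replace_atom C xi a).
  move=> ha; apply: raw_inj; congr (_, _); rewrite [RHS]/= !replace_raw -map_comp.
  apply/eq_in_map => -[k d] /= hd; rewrite /h; case: ifP => _; first by rewrite eqxx.
  case: eqP => // e; have := f1 a; rewrite in_fsetU ha => /(_ isT) /negP; case.
  by rewrite -e; move: hd => /(map_f snd) /=; rewrite -/unzip2 unzip2_zip // size_iota.
apply: (@explanation_map _ _ _ _ _ _ h xi').
- move=> r hr d hd; have [n1 n2] := hrc r hr; split; first exact: hid n1 _ hd.
  by move=> e; rewrite -e hd in n2.
- by move=> a ha; apply: hid; apply: f1; rewrite in_fsetU ha orbT.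
- by move=> d; rewrite /h; case: ifP; [right | left].
- by move=> a /imfsetP [b /= hb ->]; rewrite -hrep //; apply/imfsetP; exists b.
- move=> b /imfsetP [a /= ha ->]; exists (replace_atom C xi a); last exact: hrep.
  by apply/imfsetP; exists a.
Qed.

(** Otherwise all its occurrences could be replaced at once. *)
Lemma constrained_consts A P O E F a c :
  constrained_explanation A P O E F -> a \in E -> c \in tval (tagged a) ->
  (exists2 r, r \in P & c \in rule_consts r) \/ (exists2 o, o \in O & c \in tval (tagged o)).
Proof.
move=> [hex hdeg] ha hc; apply: NNPP => hn.
have [nP nO] : (forall r, r \in P -> c \notin rule_consts r) /\
    (forall o, o \in O -> c \notin tval (tagged o)).
  by split=> r hr; apply/negP => hcr; apply: hn; [left | right]; exists r.
have [xi hxi] := fresh_exists P O E; have [f1 f2] := hxi.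
pose C : {fset occ ar} := [fset o in [seq (a, k) | a <- enum_fset E, k <- iota 0 (\max_p ar p)] |
   onth (tagged o.1) o.2 == Some c]%fset.
have inC b k : b \in E -> ((b, k) \in C) = (onth (tagged b) k == Some c).
  move=> hb; rewrite !inE /= andbC; case e : (_ == _) => //=.
  apply/allpairsP; exists (b, k); split=> //=; rewrite mem_iota /=.
  have hk : k < size (tagged b).
    by rewrite ltnNge; apply/negP => hle; move: e; rewrite onthE nth_default ?size_map.
  by rewrite size_tuple in hk; apply: leq_trans hk _; exact: (leq_bigmax (tag b)).
have /is_degree0 /(_ c C) := hdeg xi hxi; apply.
  split.
    have [k hk] : exists k, onth (tagged a) k = Some c.
      exists (index c (tagged a)); rewrite onthE (nth_map [::]) ?index_mem // nth_index //.
    by apply/fset0Pn; exists (a, k); rewrite inC // hk.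
  move=> [b k] /imfsetP [[b' k'] /=]; rewrite inE => /andP [/allpairsP [[b2 k2] /= [hb _ [-> ->]]] e] [-> ->].
  by rewrite /occurs_at /= e andbT.
pose h (d : const) := if d == c then xi else d.
have hid s : c \notin s -> forall d, d \in s -> h d = d.
  by move=> hs d hd; rewrite /h; case: eqP => // e; rewrite -e hd in hs.
have hrep b : b \in E -> replace_atom C xi b = gmap h b.
  by move=> hb; apply: replace_gmap => k d hd; rewrite inC // hd /h.
apply: (explanation_map (h := h) (xi := xi) _ _ _ _ _ hex).
- move=> r hr d hd; split; first exact: hid (nP r hr) _ hd.
  move=> e; subst d; move: hd => /flattenP [s /mapP [b hb ->]]; rewrite mem_pmap => /mapP [[n|d] // hd [e]].
  by subst d; have := f2 r hr b hb; move/negP; apply.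
- by move=> o ho; apply: hid; apply: nO.
- by move=> d; rewrite /h; case: ifP; [right | left].
- by move=> b hb; rewrite -hrep //; apply/imfsetP; exists b.
- by move=> b /imfsetP [b' /= hb' ->]; exists b' => //; exact: hrep.
Qed.

End Renaming.

(** * Parsing *)

Definition natom : Type := (nat * seq const)%type.

Definition pstate : Type :=
  ((nat * seq bool) * (seq const * nat) * (seq natom * seq (seq natom)))%type.

(** The state is a mode, the word, the constants and the predicate number being
    read, and the atoms and the lists already read. *)
Definition parse_step (s : pstate) (b : bool) : pstate :=
  if s.1.1.1 == 0 then
    (if b then ((1, s.1.1.2), s.1.2, s.2) else ((0, s.1.1.2), s.1.2, ([::], rcons s.2.2 s.2.1)))
  else if s.1.1.1 == 1 then
    (if b then (s.1.1, (s.1.2.1, s.1.2.2.+1), s.2) else ((2, s.1.1.2), s.1.2, s.2))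
  else if s.1.1.1 == 2 then
    (if b then ((3, s.1.1.2), s.1.2, s.2)
     else ((0, s.1.1.2), ([::], 0), (rcons s.2.1 (s.1.2.2, s.1.2.1), s.2.2)))
  else if s.1.1.1 == 3 then
    (if b then ((4, s.1.1.2), s.1.2, s.2)
     else ((2, [::]), (rcons s.1.2.1 s.1.1.2, s.1.2.2), s.2))
  else ((3, rcons s.1.1.2 b), s.1.2, s.2).

Definition pst0 outs : pstate := ((0, [::]), ([::], 0), ([::], outs)).

Definition parse_lists (w : seq bool) : seq (seq natom) := (foldl parse_step (pst0 [::]) w).2.2.

Lemma enc_seq_cons (T : Type) (e : T -> seq bool) x s r :
  enc_seq e (x :: s) ++ r = true :: e x ++ (enc_seq e s ++ r).
Proof. by rewrite /enc_seq /= -!catA. Qed.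

Lemma parse_word x w cs k ao r :
  foldl parse_step ((3, w), (cs, k), ao) (enc_word x ++ r) =
  foldl parse_step ((2, [::]), (rcons cs (w ++ x), k), ao) r.
Proof.
elim: x w => [|b x IH] w; first by rewrite cats0.
by rewrite /enc_word enc_seq_cons /= IH cat_rcons.
Qed.

Lemma parse_consts l cs k ats outs r :
  foldl parse_step ((2, [::]), (cs, k), (ats, outs)) (enc_seq enc_word l ++ r) =
  foldl parse_step ((0, [::]), ([::], 0), (rcons ats (k, cs ++ l), outs)) r.
Proof.
elim: l cs => [|x l IH] cs; first by rewrite cats0.
by rewrite enc_seq_cons /= parse_word IH cat_rcons.
Qed.

Lemma parse_raw a k ats outs r :
  foldl parse_step ((1, [::]), ([::], k), (ats, outs)) (enc_raw a ++ r) =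
  foldl parse_step ((0, [::]), ([::], 0), (rcons ats (k + a.1, a.2), outs)) r.
Proof.
case: a => i l; rewrite /enc_raw /= -catA /=.
elim: i k => [|i IH] k /=; first by rewrite addn0 parse_consts.
by rewrite IH addSnnS.
Qed.

Lemma parse_list l ats outs r :
  foldl parse_step ((0, [::]), ([::], 0), (ats, outs)) (enc_seq enc_raw l ++ r) =
  foldl parse_step (pst0 (rcons outs (ats ++ l))) r.
Proof.
elim: l ats => [|a l IH] ats; first by rewrite cats0.
rewrite enc_seq_cons /= parse_raw IH cat_rcons add0n.
by case: a.
Qed.

Lemma parse_enc ls : parse_lists (flatten [seq enc_seq enc_raw l | l <- ls]) = ls.
Proof.
rewrite /parse_lists -[RHS]/([::] ++ ls).
have h : forall outs, foldl parse_step (pst0 outs) (flatten [seq enc_seq enc_raw l | l <- ls]) =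
    pst0 (outs ++ ls).
  elim: ls => [|l ls IH] outs /=; first by rewrite cats0.
  by rewrite parse_list IH cat_rcons.
by rewrite h.
Qed.

Lemma pt_parse : ptime parse_lists.
Proof.
do 2![apply: pt_snd].
apply: (pt_foldl (X := seq bool) (f := fun _ => parse_step) (l := fun z => z)); first last.
- exists 6 => x [[[m w] [cs k]] [ats outs]] b.
  have h : (0 + 2) ^ 6 <= (sz x + sz b + 2) ^ 6 by exact: pow_mono.
  have hb (b' : bool) : sz b' <= 3 by exact: sz_bool.
  have hw : 0 < sz w by exact: sz_gt0.
  have hc : 0 < sz cs by exact: sz_gt0.
  have ha : 0 < sz ats by exact: sz_gt0.
  have ew : @sz const _ w = sz w by [].
  have {}h : 64 <= (sz x + sz b + 2) ^ 6 by [].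
  rewrite /parse_step; move: (_ ^ 6) (hb b) h ew => P hb' h ew; rewrite /=.
  case: (m == 0); [case: (b) | case: (m == 1); [case: (b) | case: (m == 2); [case: (b) |
    case: (m == 3); [case: (b) |]]]];
  by rewrite !sz_pair ?sz_rcons ?sz_pair ?sz_nil !sz_nat; lia.
- by pts.
- exact: pt_const.
rewrite /parse_step; pts; first [by apply: pt_eq; pts | by apply: pt_rcons; pts].
Qed.

(** * Deciding explanations *)

Lemma pt_has_fix {X} {CX : Code X} (I : Type) (s : seq I) (F : X -> I -> bool) :
  (forall i, ptime (fun x => F x i)) -> ptime (fun x => has (F x) s).
Proof.
move=> h; elim: s => [|i s IH] /=; first exact: pt_const.
exact: pt_or.
Qed.

Lemma pt_all_fix {X} {CX : Code X} (I : Type) (s : seq I) (F : X -> I -> bool) :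
  (forall i, ptime (fun x => F x i)) -> ptime (fun x => all (F x) s).
Proof.
move=> h; elim: s => [|i s IH] /=; first exact: pt_const.
exact: pt_and.
Qed.

Lemma sz_filter T {CT : Code T} (p : pred T) (s : seq T) : sz (filter p s) <= sz s.
Proof. by elim: s => //= x s IH; case: (p x); rewrite !sz_cons; lia. Qed.

(** The iterates increase and are all filters of [U]; each is strictly longer than the previous one
    until one repeats, so [size U] rounds suffice. *)
Lemma filter_fix (T : eqType) (U : seq T) (p : seq T -> pred T) :
  (forall M M', {subset M <= M'} -> forall a, p M a -> p M' a) ->
  let g M := filter (p M) U in let M := iter (size U) g [::] in g M = M.
Proof.
move=> mono g.
(* Of two filters of one list, the smaller equals the larger as soon as the lengths agree. *)
have sub (q q' : pred T) s : (forall a, q a -> q' a) ->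
    size (filter q s) <= size (filter q' s) ?= iff (filter q s == filter q' s).
  move=> hq; elim: s => [|a s IH] /=; first by rewrite eqxx; split.
  case e : (q a); first by rewrite (hq a e) /= eqseq_cons eqxx /=; split; rewrite ?ltnS ?eqSS; case: IH.
  case e' : (q' a) => //; case: IH => IH _; split; first exact: leqW.
  rewrite /= ltn_eqF ?ltnS //; apply/esym/eqP => E.
  by have := mem_filter q a s; rewrite E e inE eqxx.
have inc i : {subset iter i g [::] <= iter i.+1 g [::]}.
  elim: i => [|i IH] a //; rewrite [iter i.+1 _ _]iterS iterS !mem_filter => /andP [h ->].
  by rewrite andbT; exact: mono IH _ h.
have key n : iter n.+1 g [::] = iter n g [::] \/ n < size (iter n.+1 g [::]).
  elim: n => [|n [e | h]].
  - by rewrite /=; case: (g [::]) => [|a s]; [left | right].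
  - by left; rewrite iterS e -iterS.
  have [h1 h2] := sub (p (iter n g [::])) (p (iter n.+1 g [::])) U (mono _ _ (inc n)).
  case: (iter n.+2 g [::] =P iter n.+1 g [::]) => [e | /eqP ne]; [by left | right].
  apply: leq_ltn_trans h _; rewrite ltn_neqAle; apply/andP; split; last exact: h1.
  by rewrite [X in size X != _]iterS h2 eq_sym.
case: (key (size U)) => [// | h].
by move: h; rewrite iterS ltnNge; case/negP; rewrite size_filter; exact: count_size.
Qed.

(** * Saturation over a finite universe of constants *)

Section Decision.
Variables (Rel : finType) (ar : Rel -> nat) (A : {set Rel}) (R : program ar).
Hypothesis hR : no_abducible_head A R.

Definition rk (p : Rel) : nat := enum_rank p.

Definition okp (q : pred Rel) (a : natom) : bool :=
  has (fun p => [&& q p, a.1 == rk p & size a.2 == ar p]) (enum Rel).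

Lemma okpP (q : pred Rel) a : reflect (exists2 g : gatom ar, nraw g = a & q (tag g)) (okp q a).
Proof.
apply: (iffP hasP) => [[p _ /and3P [hq /eqP e1 e2]] | [g <- hq]].
  exists (Tagged (fun p => (ar p).-tuple const) (Tuple e2)) => //.
  by rewrite /nraw /= -/(rk p) -e1; case: (a).
by exists (tag g); rewrite ?mem_enum // hq /= eqxx size_tuple /=.
Qed.

Lemma all_okp (q : pred Rel) l : all (okp q) l ->
  exists2 s : seq (gatom ar), [seq nraw g | g <- s] = l & all (fun g => q (tag g)) s.
Proof.
elim: l => [|a l IH] /=; first by exists [::].
by case/andP => /okpP [g <- hq] /IH [s <- hs]; exists (g :: s); rewrite //= hq.
Qed.

Lemma okp_all (q : pred Rel) (s : seq (gatom ar)) : all (fun g => q (tag g)) s -> all (okp q) [seq nraw g | g <- s].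
Proof. by move=> /allP h; apply/allP => a /mapP [g /h hq ->]; apply/okpP; exists g. Qed.

Lemma pt_okp (q : pred Rel) : ptime (okp q).
Proof.
apply: pt_has_fix => p; apply: pt_and; first exact: pt_const.
by apply: pt_and; apply: pt_eq; [pts | pts | apply: pt_nsize; pts | pts].
Qed.

Fixpoint vals k (D : seq const) : seq (seq const) :=
  if k is k'.+1 then [seq d :: l | d <- D, l <- vals k' D] else [:: [::]].

Lemma mem_vals k D l : (l \in vals k D) = (size l == k) && all (mem D) l.
Proof.
elim: k l => [|k IH] [|d l] //=; last rewrite eqSS.
  by apply/negbTE/negP => /allpairsP [[d' l'] [_ _]].
apply/allpairsP/and3P => [[[d' l'] /= [h1 h2 [-> ->]]] | [h1 h2 h3]].
  by move: h2; rewrite IH => /andP [h2 h3]; split.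
by exists (d, l); rewrite /= IH h1 h3.
Qed.

Lemma pt_vals k : ptime (vals k).
Proof.
elim: k => [|k IH] /=; first exact: pt_const.
by apply: pt_allpairs; [pts | pts | exact: pt_comp pt_fst0 IH].
Qed.

(** The Herbrand base over [D]; predicates and arities are fixed, so its size is polynomial in that
    of [D]. *)
Definition univ (D : seq const) : seq natom :=
  flatten [seq [seq (rk p, l) | l <- vals (ar p) D] | p <- enum Rel].

Lemma mem_univ D (g : gatom ar) : (nraw g \in univ D) = all (mem D) (tagged g).
Proof.
apply/flattenP/idP => [[s /mapP [p _ ->] /mapP [l hl]] | h].
  by rewrite mem_vals in hl; case/andP: hl => _ hl [_ ->].
exists [seq (rk (tag g), l) | l <- vals (ar (tag g)) D].
  by apply/mapP; exists (tag g); rewrite ?mem_enum.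
by apply/mapP; exists (tval (tagged g)); rewrite // mem_vals size_tuple eqxx.
Qed.

Lemma pt_univ : ptime univ.
Proof.
apply: pt_flatten; apply: pt_map_fix => p; apply: pt_map; last exact: pt_vals.
by pts.
Qed.

Definition tvar (t : term) : nat := if t is inl n then n.+1 else 0.

(** A constant of the problem, as [R] is fixed; hence the valuations in [D] are polynomially
    many. *)
Definition nvars : nat :=
  \max_(r <- enum_fset R) \max_(b <- r.1 :: r.2) \max_(t <- aterms b) tvar t.

Lemma nvarsP r b n : r \in R -> b \in r.1 :: r.2 -> (inl n : term) \in aterms b -> n < nvars.
Proof.
move=> hr hb ht.
apply: leq_trans (@leq_bigmax_seq _ _ xpredT (fun r : rule ar => \max_(b <- r.1 :: r.2) \max_(t <- aterms b) tvar t) r hr isT).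
apply: leq_trans (@leq_bigmax_seq _ _ xpredT (fun b : atom ar => \max_(t <- aterms b) tvar t) b hb isT).
exact: (@leq_bigmax_seq _ _ xpredT tvar (inl n) ht isT).
Qed.

Definition inst (val : seq const) (b : atom ar) : natom :=
  (rk (tag b), [seq ev (nth [::] val) t | t <- aterms b]).

Definition fire D (M : seq natom) (a : natom) : bool :=
  has (fun r : rule ar => has (fun val => (inst val r.1 == a) && all (fun b => inst val b \in M) r.2)
         (vals nvars D)) (enum_fset R).

Definition sat_step (base : seq natom) D (M : seq natom) : seq natom :=
  [seq a <- univ D | (a \in base) || fire D M a].

Definition sat base D : seq natom := iter (size (univ D)) (sat_step base D) [::].

Lemma pt_inst b : ptime (fun val => inst val b).
Proof.
apply: pt_pair; first exact: pt_const.
apply: pt_map_fix => -[n|c] /=; last exact: pt_const.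
by apply: pt_nth; pts.
Qed.

Lemma pt_sat : ptime (fun p : seq natom * seq const => sat p.1 p.2).
Proof.
have hf : ptime (fun p : seq const * seq natom * natom => fire p.1.1 p.1.2 p.2).
  apply: pt_has_fix => r; apply: pt_has.
    apply: pt_and; first by apply: pt_eq; [exact: pt_comp pt_snd0 (pt_inst _) | pts].
    apply: pt_all_fix => b; apply: pt_mem; first exact: pt_comp pt_snd0 (pt_inst _).
    by pts.
  by apply: pt_comp (pt_vals _); pts.
pose g (s : seq natom * seq const * seq natom) := (s.1, sat_step s.1.1 s.1.2 s.2).
have hg : ptime g.
  apply: pt_pair; first by pts.
  apply: pt_filter; last by apply: pt_comp pt_univ; pts.
  apply: pt_or; first by apply: pt_mem; pts.
  apply: (pt_comp (f := fun q : seq natom * seq const * seq natom * natom =>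
     (q.1.1.2, q.1.2, q.2)) _ hf); pts.
have hi p i : iter i g (p, [::]) = (p, iter i (sat_step p.1 p.2) [::]).
  by elim: i => // i IH; rewrite iterS IH.
apply: (pt_ext (f := fun p => (iter (size (univ p.2)) g (p, [::])).2)).
  by move=> p; rewrite hi.
apply: pt_snd; apply: pt_iter => //; first by apply: pt_comp pt_univ; pts.
  by pts.
have [k hk] := pt_size pt_univ.
have [k' hk'] : pb (fun n => n + (n + 2) ^ k + 1) by pbs.
exists k' => p i _; apply: leq_trans (hk' _); rewrite hi sz_pair.
have h1 : sz (iter i (sat_step p.1 p.2) [::]) <= sz (univ p.2).
  by case: i => [|i]; [rewrite sz_nil; exact: sz_gt0 | exact: sz_filter].
have h2 := hk p.2; have h3 : (sz p.2 + 2) ^ k <= (sz p + 2) ^ k.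
  by apply: pow_mono; case: (p) => a b; rewrite sz_pair /=; lia.
by lia.
Qed.

Lemma sat_closed base D : sat_step base D (sat base D) = sat base D.
Proof.
apply: (@filter_fix _ (univ D) (fun M a => (a \in base) || fire D M a)) => M M' hM a.
case/orP => [-> // | /hasP [r hr /hasP [v hv /andP [h1 /allP h2]]]].
apply/orP; right; apply/hasP; exists r => //; apply/hasP; exists v => //.
by rewrite h1; apply/allP => b /h2 /hM.
Qed.

Definition Rconsts : seq const := flatten [seq rule_consts r | r <- enum_fset R].

(** Collapsing all constants outside [D] onto [[::]] sends the least model into the saturation and
    fixes the atoms over [D]. This is why [[::]] is put into [D] along with the constants of [R]. *)
Lemma sat_correct (s : seq (gatom ar)) (D : seq const) :
  [::] \in D -> {subset Rconsts <= D} ->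
  (forall g, g \in s -> all (mem D) (tagged g)) ->
  forall a : gatom ar, all (mem D) (tagged a) ->
  (nraw a \in sat [seq nraw g | g <- s] D) <-> least_model (R `|` facts (Defs.set_of s))%fset a.
Proof.
move=> D0 DR Ds a ha; set base := [seq nraw g | g <- s]; split.
  rewrite /sat; move: (size _) => n; elim: n a {ha} => [|n IH] a //.
  rewrite iterS mem_filter => /andP [/orP [|] + _].
    rewrite (mem_map (@nraw_inj _ _)) => hs; apply: least_model_fact.
    by rewrite in_fsetU mem_facts in_set_of hs orbT.
  move=> /hasP [r hr /hasP [v hv /andP [/eqP e /allP h]]].
  have <- : instantiate (nth [::] v) r.1 = a by apply: nraw_inj.
  apply: least_model_rule; first by rewrite in_fsetU; apply/orP; left.
  by move=> b /h hb; exact: (IH (instantiate (nth [::] v) b) hb).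
pose h (c : const) : const := if c \in D then c else [::].
have hD c : h c \in D by rewrite /h; case: ifP.
have hid c : c \in D -> h c = c by rewrite /h => ->.
have -> : nraw a = nraw (gmap h a).
  by rewrite gmap_id // => c hc; apply: hid; move/allP: ha; apply.
apply: (@least_model_map _ _ _ (fun g => nraw g \in sat base D)) => r.
rewrite in_fsetU => /orP [hr | /in_facts [b]]; last first.
  rewrite in_set_of => hb ->; left; exists b => //.
  rewrite gmap_id; last by move=> c hc; apply: hid; move/allP: (Ds b hb); apply.
  by rewrite -sat_closed mem_filter mem_univ Ds // map_f.
right; split=> [c hc | v hb].
  by apply: hid; apply: DR; apply/flattenP; exists (rule_consts r) => //; apply: map_f.
pose val := mkseq (fun n => h (v n)) nvars.
have hval : val \in vals nvars D.
  by rewrite mem_vals size_mkseq eqxx; apply/allP => c /mapP [n _ ->]; exact: hD.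
have hinst b : b \in r.1 :: r.2 -> inst val b = nraw (instantiate (fun n => h (v n)) b).
  move=> hbr; congr (_, _); apply/eq_in_map => -[n|c] //= hn.
  by rewrite nth_mkseq //; exact: nvarsP hr hbr hn.
rewrite -sat_closed mem_filter mem_univ; apply/andP; split.
  apply/orP; right; apply/hasP; exists r => //; apply/hasP; exists val => //.
  rewrite hinst ?mem_head // eqxx; apply/allP => b hbr.
  by rewrite hinst ?inE ?hbr ?orbT //; exact: hb.
apply/allP => c /mapP [[n|d] hd ->] /=; first exact: hD.
apply: DR; apply/flattenP; exists (rule_consts r); first exact: map_f.
by apply: (rule_constsP (b := r.1)); rewrite ?mem_head.
Qed.

Definition dom (b o e : seq natom) : seq const :=
  [::] :: Rconsts ++ flatten [seq a.2 | a <- b ++ o ++ e].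

Definition base (b e f : seq natom) : seq natom := [seq a <- b ++ e | a \notin f].

Definition explains (b o e f : seq natom) : bool :=
  [&& all (okp (mem A)) e, all (okp (mem A)) f, all (fun a => a \notin f) e,
      all (fun a => a \in b) f & all (fun a => a \in sat (base b e f) (dom b o e)) o].

Lemma pt_dom : ptime (fun p : seq natom * seq natom * seq natom => dom p.1.1 p.1.2 p.2).
Proof.
rewrite /dom; pts; apply: pt_cat; first by pts.
apply: pt_flatten; apply: (pt_map (f := fun _ a => a.2)); first by pts.
by do 2![apply: pt_cat; first by pts]; pts.
Qed.

Lemma pt_explains : ptime (fun p : seq natom * seq natom * seq natom * seq natom =>
  explains p.1.1.1 p.1.1.2 p.1.2 p.2).
Proof.
apply: pt_and; first by apply: pt_all; [exact: pt_comp pt_snd0 (pt_okp _) | pts].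
apply: pt_and; first by apply: pt_all; [exact: pt_comp pt_snd0 (pt_okp _) | pts].
apply: pt_and; first by apply: pt_all; [apply: pt_neg; apply: pt_mem; pts | pts].
apply: pt_and; first by apply: pt_all; [apply: pt_mem; pts | pts].
apply: pt_all; last by pts.
apply: pt_mem; first by pts.
apply: (pt_comp (f := fun q : seq natom * seq natom * seq natom * seq natom * natom =>
  (base q.1.1.1.1 q.1.1.2 q.1.2, dom q.1.1.1.1 q.1.1.1.2 q.1.1.2)) _ pt_sat).
apply: pt_pair.
  apply: pt_filter; first by apply: pt_neg; apply: pt_mem; pts.
  by apply: pt_cat; pts.
by apply: (pt_comp (f := fun q : seq natom * seq natom * seq natom * seq natom * natom => q.1.1) _ pt_dom); pts.
Qed.

Lemma abd_all (s : seq (gatom ar)) : abducibles A (Defs.set_of s) <-> all (fun g => tag g \in A) s.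
Proof.
by split=> [h | /allP h a]; [apply/allP => a ha; apply: h; rewrite in_set_of | rewrite in_set_of => /h].
Qed.

Lemma obs_all (s : seq (gatom ar)) : observation A (Defs.set_of s) <-> all (fun g => tag g \notin A) s.
Proof.
by split=> [h | /allP h a]; [apply/allP => a ha; apply: h; rewrite in_set_of | rewrite in_set_of => /h].
Qed.

Lemma facts_sub (b f : seq (gatom ar)) : all (fun g => tag g \in A) f ->
  (facts (Defs.set_of f) `<=` R `|` facts (Defs.set_of b))%fset <-> {subset f <= b}.
Proof.
move=> /allP hf; split=> [/fsubsetP h a ha | h].
  have := h (fact a); rewrite mem_facts in_set_of ha => /(_ isT).
  rewrite in_fsetU mem_facts in_set_of => /orP [/hR | //].
  by rewrite /= hf.
apply/fsubsetP => r /in_facts [a]; rewrite in_set_of => /h ha ->.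
by rewrite in_fsetU mem_facts in_set_of ha orbT.
Qed.

Lemma explainsP (b o e f : seq (gatom ar)) :
  explains [seq nraw g | g <- b] [seq nraw g | g <- o] [seq nraw g | g <- e] [seq nraw g | g <- f] <->
  explanation A (R `|` facts (Defs.set_of b))%fset (Defs.set_of o) (Defs.set_of e) (Defs.set_of f).
Proof.
have mm (s : seq (gatom ar)) a : (nraw a \in [seq nraw g | g <- s]) = (a \in s).
  exact: (mem_map (@nraw_inj _ _)).
have okm (s : seq (gatom ar)) : all (okp (mem A)) [seq nraw g | g <- s] = all (fun g => tag g \in A) s.
  by rewrite all_map; apply: eq_all => g; apply/okpP/idP => [[g' /nraw_inj ->] | h] //; exists g.
pose s := [seq a <- b ++ e | a \notin f].
have eb : base [seq nraw g | g <- b] [seq nraw g | g <- e] [seq nraw g | g <- f] = [seq nraw g | g <- s].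
  rewrite /base /s -map_cat filter_map; congr map; apply: eq_filter => g /=.
  by rewrite mm.
set D := dom [seq nraw g | g <- b] [seq nraw g | g <- o] [seq nraw g | g <- e].
have hD g : g \in b ++ o ++ e -> all (mem D) (tagged g).
  move=> hg; apply/allP => c hc; rewrite /= inE mem_cat; apply/orP; right; apply/orP; right.
  apply/flattenP; exists (tval (tagged g)) => //; rewrite -!map_cat -map_comp.
  exact: (map_f (fun g : gatom ar => (nraw g).2) hg).
have hs : forall a, a \in o -> (nraw a \in sat [seq nraw g | g <- s] D) <->
    least_model (R `|` facts (Defs.set_of s))%fset a.
  move=> a ha; apply: sat_correct.
  - exact: mem_head.
  - by move=> c hc; rewrite inE mem_cat hc orbT.
  - by move=> g; rewrite mem_filter mem_cat => /andP [_ hg]; apply: hD; rewrite !mem_cat;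
      case/orP: hg => ->; rewrite ?orbT.
  - by apply: hD; rewrite !mem_cat ha orbT.
(* Removing the facts of [F] takes nothing away from [R], whose heads are not abducible, so it
   amounts to filtering the lists. *)
have prog : all (fun g => tag g \in A) f ->
    ((R `|` facts (Defs.set_of b) `|` facts (Defs.set_of e)) `\` facts (Defs.set_of f) =
    R `|` facts (Defs.set_of s))%fset.
  move=> /allP hf; apply/fsetP => r; rewrite in_fsetD !in_fsetU.
  apply/andP/orP => [[h1 /orP [/orP [|] | ]] | [hr | /in_facts [a]]].
  - by left.
  - move=> /in_facts [a]; rewrite in_set_of => ha er; right; rewrite er in h1 *.
    by rewrite !mem_facts !in_set_of mem_filter mem_cat ha in h1 *; rewrite h1.
  - move=> /in_facts [a]; rewrite in_set_of => ha er; right; rewrite er in h1 *.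
    by rewrite !mem_facts !in_set_of mem_filter mem_cat ha orbT andbT in h1 *.
  - split; last by rewrite hr.
    by apply/negP => /in_facts [a]; rewrite in_set_of => /hf ha er; have := hR hr; rewrite er /= ha.
  - rewrite in_set_of mem_filter mem_cat => /andP [h1 h2] ->.
    by rewrite !mem_facts !in_set_of h1; split=> //; case/orP: h2 => ->; rewrite ?orbT.
rewrite /explains !okm eb -/D; split.
  case/and5P => he hf /allP hd /allP hsub /allP ho; split.
  - exact/abd_all.
  - exact/abd_all.
  - apply/fdisjointP => a; rewrite !in_set_of => ha.
    by have := hd (nraw a); rewrite mm ha mm; apply.
  - by apply/facts_sub => // a ha; rewrite -mm; apply: hsub; rewrite mm.
  - move=> a; rewrite in_set_of => ha; rewrite prog //; apply/hs => //.
    by apply: ho; rewrite mm.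
case=> /abd_all he /abd_all hf /fdisjointP hd /(facts_sub _ hf) hsub ho; apply/and5P; split=> //.
- by apply/allP => _ /mapP [a ha ->]; rewrite mm; have := hd a; rewrite !in_set_of; apply.
- by apply/allP => _ /mapP [a ha ->]; rewrite mm; exact: hsub.
- apply/allP => _ /mapP [a ha ->]; apply/hs => //; rewrite -prog //.
  by apply: ho; rewrite in_set_of.
Qed.

End Decision.

(** * Membership *)

(** Soundness holds for strings of any length and only completeness asks for a short one, so
    verifiers need not measure their certificates. *)
Definition NPform (L : language) := exists2 V : seq bool * seq bool -> bool, ptime V &
  (forall x y, V (x, y) -> L x) /\
  exists k, forall x, L x -> exists2 y, size y <= (size x + 2) ^ k & V (x, y).

Lemma pt_size_raw (f : seq bool -> seq bool) : ptime f ->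
  exists k, forall x, size (f x) <= (size x + 2) ^ k.
Proof.
move=> /pt_size [k hk]; have [k' hk'] : pb (fun n => (4 * n + 1 + 2) ^ k) by pbs.
exists k' => x; apply: leq_trans (hk' _).
have h1 : size (f x) < sz (f x) by exact: size_sz.
have h2 := pow_mono k (sz_bits x); have := hk x; lia.
Qed.

Lemma NPform_Sigma1 L : NPform L -> SigmaP 1 L.
Proof.
move=> [V hV [sound [k complete]]]; exists (fun z => V (unpair z)), (pow_poly k); split.
  exists (fun z => [:: ~~ V (unpair z)]).
    apply: ptime_polytime; apply: pt_cons; last exact: pt_const.
    by apply: pt_neg; exact: pt_comp pt_unpair hV.
  by move=> z; rewrite /compl; case: (V _); split.
move=> x; rewrite pow_polyE; split=> [/complete [y sy hy] | [y [_]]].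
  by exists y; rewrite unpairK.
by rewrite unpairK; exact: sound.
Qed.

Lemma NPform_preim L (g : seq bool -> seq bool) : ptime g -> NPform L -> NPform (fun x => L (g x)).
Proof.
move=> hg [V hV [sound [k complete]]]; have [k' hk'] := pt_size_raw hg.
exists (fun p => V (g p.1, p.2)).
  apply: (pt_comp (f := fun p : seq bool * seq bool => (g p.1, p.2)) _ hV).
  by apply: pt_pair; [exact: pt_comp pt_fst0 hg | pts].
split=> [x y /sound // |].
have [k2 hk2] : pb (fun n => ((n + 2) ^ k' + 2) ^ k) by pbs.
exists k2 => x /complete [y sy hy]; exists y => //; apply: leq_trans sy (leq_trans _ (hk2 _)).
exact: pow_mono.
Qed.

Lemma size_enc_seq_cons (T : Type) (e : T -> seq bool) x s :
  size (enc_seq e (x :: s)) = (size (e x) + size (enc_seq e s)).+1.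
Proof. by rewrite -[enc_seq e (x :: s)]cats0 enc_seq_cons cats0 /= size_cat. Qed.

Lemma enc_seq_size (T : eqType) (e : T -> seq bool) s x : x \in s -> size (e x) < size (enc_seq e s).
Proof.
elim: s => // y s IH; rewrite inE size_enc_seq_cons.
by case/orP => [/eqP -> | /IH]; lia.
Qed.

Lemma enc_seq_filter (T : Type) (e : T -> seq bool) (p : pred T) s :
  size (enc_seq e (filter p s)) <= size (enc_seq e s).
Proof.
elim: s => // y s IH; rewrite size_enc_seq_cons [filter _ _]/=.
by case: (p y); rewrite ?size_enc_seq_cons; lia.
Qed.

Lemma onth_some (T : Type) (l : seq T) k c x0 : onth l k = Some c -> k < size l /\ nth x0 l k = c.
Proof. by elim: l k => [|a l IH] [|k] //= => [[->] | /IH]. Qed.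

Lemma some_onth (T : Type) (l : seq T) k x0 : k < size l -> onth l k = Some (nth x0 l k).
Proof. by elim: l k => [|a l IH] [|k] //= /IH. Qed.

Lemma head_drop (T : Type) (x0 : T) k l : head x0 (drop k l) = nth x0 l k.
Proof. by rewrite -nth0 nth_drop addn0. Qed.

Definition in_ k (w : seq bool) : seq natom := nth [::] (parse_lists w) k.

Lemma pt_in k : ptime (in_ k).
Proof. by apply: pt_nth; exact: pt_parse. Qed.

Lemma in1 l : in_ 0 (enc_seq enc_raw l) = l.
Proof. by rewrite /in_; have := parse_enc [:: l]; rewrite /= cats0 => ->. Qed.

Lemma in2 b o (w := enc_seq enc_raw b ++ enc_seq enc_raw o) : in_ 0 w = b /\ in_ 1 w = o.
Proof. by rewrite /in_ /w; have := parse_enc [:: b; o]; rewrite /= cats0 => ->. Qed.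

Lemma in4 b o e f (w := enc_seq enc_raw b ++ enc_seq enc_raw o ++ enc_seq enc_raw e ++ enc_seq enc_raw f) :
  [/\ in_ 0 w = b, in_ 1 w = o, in_ 2 w = e & in_ 3 w = f].
Proof. by rewrite /in_ /w; have := parse_enc [:: b; o; e; f]; rewrite /= cats0 => ->. Qed.

(** An occurrence [(a, k)] is written as the atom [a] with an additional first
    argument, the unary numeral of [k]. *)
Definition rep (Cs : seq natom) (xi : const) (a : natom) : natom :=
  (a.1, [seq if (a.1, nseq p.1 true :: a.2) \in Cs then xi else p.2
        | p <- zip (iota 0 (size a.2)) a.2]).

Definition cst (t : natom) : const := head [::] (drop (size (head [::] t.2)) (behead t.2)).

Definition okocc (c : const) (e : seq natom) (t : natom) : bool :=
  [&& t.2 != [::], head [::] t.2 == nseq (size (head [::] t.2)) true, (t.1, behead t.2) \in e,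
      size (head [::] t.2) < size (behead t.2) & cst t == c].

Definition repok (e Cs : seq natom) : bool :=
  (Cs != [::]) && all (okocc (cst (head (0, [::]) Cs)) e) Cs.

(** All positions in the atoms of [l]; a certificate can be taken as a sublist of it, which bounds
    its length. *)
Definition allocc (l : seq natom) : seq natom :=
  [seq (a.1, nseq k true :: a.2) | a <- l, k <- iota 0 (size a.2)].

Lemma pt_rep : ptime (fun q : seq natom * const * natom => rep q.1.1 q.1.2 q.2).
Proof.
apply: pt_pair; first by pts.
apply: pt_map; last first.
  by apply: pt_zip; [apply: pt_iota0; apply: pt_nsize; pts | pts].
apply: pt_if; [|by pts|by pts].
apply: pt_mem; last by pts.
by apply: pt_pair; [pts | apply: pt_cons; [apply: pt_nseq; pts | pts]].
Qed.

Lemma pt_cst : ptime cst.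
Proof.
apply: pt_head; apply: pt_drop; last by apply: pt_behead; pts.
by apply: pt_nsize; apply: pt_head; pts.
Qed.

Lemma pt_repok : ptime (fun p : seq natom * seq natom => repok p.1 p.2).
Proof.
apply: pt_and; first by apply: pt_neg; apply: pt_eq; pts.
apply: pt_all; last by pts.
have hh : ptime (fun q : seq natom * seq natom * natom => head [::] q.2.2) by apply: pt_head; pts.
have hb : ptime (fun q : seq natom * seq natom * natom => behead q.2.2) by apply: pt_behead; pts.
apply: pt_and; first by apply: pt_neg; apply: pt_eq; pts.
apply: pt_and; first by apply: pt_eq; [| apply: pt_nseq; apply: pt_nsize].
apply: pt_and; first by apply: pt_mem; pts.
apply: pt_and; first by apply: pt_leq; [apply: pt_S |]; apply: pt_nsize.
apply: pt_eq; first exact: pt_comp pt_snd0 pt_cst.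
by apply: (pt_comp _ pt_cst); apply: pt_head; pts.
Qed.

(** * Certificates against being constrained, and the upper bounds *)

Section Membership.
Variables (Rel : finType) (ar : Rel -> nat) (A : {set Rel}) (R : program ar).
Hypothesis hR : no_abducible_head A R.

Notation okA := (okp ar (mem A)).
Notation okN := (okp ar (fun p => p \notin A)).

Definition wf4 (w : seq bool) : bool :=
  [&& w == enc_seq enc_raw (in_ 0 w) ++ enc_seq enc_raw (in_ 1 w) ++
           enc_seq enc_raw (in_ 2 w) ++ enc_seq enc_raw (in_ 3 w),
      all okA (in_ 0 w), all okN (in_ 1 w), all okA (in_ 2 w) & all okA (in_ 3 w)].

(** Longer than every constant of the input and of [R], hence fresh, and computed from lengths
    alone. *)
Definition new_const (w : seq bool) : const :=
  nseq (size w + (\max_(c <- Rconsts R) size c).+1) true.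

(** It verifies the complement, so it accepts words that encode no input and pairs that are no
    explanation. Only for an actual explanation is the certificate needed. *)
Definition verify (p : seq bool * seq bool) : bool :=
  if wf4 p.1 then
    ~~ explains A R (in_ 0 p.1) (in_ 1 p.1) (in_ 2 p.1) (in_ 3 p.1) ||
    (repok (in_ 2 p.1) (in_ 0 p.2) &&
     explains A R (in_ 0 p.1) (in_ 1 p.1)
       [seq rep (in_ 0 p.2) (new_const p.1) a | a <- in_ 2 p.1] (in_ 3 p.1))
  else true.

Lemma pt_wf4 : ptime wf4.
Proof.
have hi k : ptime (in_ k) := pt_in k.
have he k : ptime (fun w => enc_seq enc_raw (in_ k w)) by apply: pt_enc_seq => //; exact: pt_enc_raw.
have ho q k : ptime (fun w => all (okp ar q) (in_ k w)).
  by apply: pt_all => //; exact: pt_comp pt_snd0 (pt_okp _ _).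
apply: pt_and; first by apply: pt_eq; [pts | do 3!apply: pt_cat => //].
by do 3!apply: pt_and => //.
Qed.

Lemma pt_verify : ptime verify.
Proof.
have h1 k : ptime (fun p : seq bool * seq bool => in_ k p.1) by exact: pt_comp pt_fst0 (pt_in k).
have h2 k : ptime (fun p : seq bool * seq bool => in_ k p.2) by exact: pt_comp pt_snd0 (pt_in k).
apply: pt_if; [exact: pt_comp pt_fst0 pt_wf4 | | exact: pt_const].
apply: pt_or.
  apply: pt_neg; apply: (pt_comp (f := fun p : seq bool * seq bool =>
    (in_ 0 p.1, in_ 1 p.1, in_ 2 p.1, in_ 3 p.1)) _ (pt_explains A R)).
  by do 3!apply: pt_pair => //.
apply: pt_and.
  apply: (pt_comp (f := fun p : seq bool * seq bool => (in_ 2 p.1, in_ 0 p.2)) _ pt_repok).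
  exact: pt_pair.
apply: (pt_comp (f := fun p : seq bool * seq bool => (in_ 0 p.1, in_ 1 p.1,
  [seq rep (in_ 0 p.2) (new_const p.1) a | a <- in_ 2 p.1], in_ 3 p.1)) _ (pt_explains A R)).
apply: pt_pair => //; apply: pt_pair; first exact: pt_pair.
apply: pt_map => //.
apply: (pt_comp (f := fun q : seq bool * seq bool * natom =>
  (in_ 0 q.1.2, new_const q.1.1, q.2)) _ pt_rep).
apply: pt_pair; last by pts.
apply: pt_pair; first by apply: (pt_comp _ (pt_in 0)); pts.
by apply: pt_nseq; apply: pt_add; [apply: pt_nsize; pts | pts].
Qed.

Lemma wf4P w : wf4 w -> exists b o e f : seq (gatom ar),
  [/\ w = enc_gatoms b ++ enc_gatoms o ++ enc_gatoms e ++ enc_gatoms f,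
      abducibles A (Defs.set_of b), observation A (Defs.set_of o),
      abducibles A (Defs.set_of e) /\ abducibles A (Defs.set_of f) &
      [/\ in_ 0 w = [seq nraw g | g <- b], in_ 1 w = [seq nraw g | g <- o],
          in_ 2 w = [seq nraw g | g <- e] & in_ 3 w = [seq nraw g | g <- f]]].
Proof.
case/and5P => /eqP ew /all_okp [b eb hb] /all_okp [o eo ho] /all_okp [e ee he] /all_okp [f ef hf].
exists b, o, e, f; split=> //.
- by rewrite !enc_gatomsE eb eo ee ef.
- exact/abd_all.
- exact/obs_all.
- by split; apply/abd_all.
Qed.

Lemma wf4_enc (b o e f : seq (gatom ar))
  (w := enc_gatoms b ++ enc_gatoms o ++ enc_gatoms e ++ enc_gatoms f) :
  abducibles A (Defs.set_of b) -> observation A (Defs.set_of o) ->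
  abducibles A (Defs.set_of e) -> abducibles A (Defs.set_of f) ->
  wf4 w /\ [/\ in_ 0 w = [seq nraw g | g <- b], in_ 1 w = [seq nraw g | g <- o],
          in_ 2 w = [seq nraw g | g <- e] & in_ 3 w = [seq nraw g | g <- f]].
Proof.
move=> /abd_all hb /obs_all ho /abd_all he /abd_all hf; rewrite /wf4 /w !enc_gatomsE.
have [-> -> -> ->] := in4 [seq nraw g | g <- b] [seq nraw g | g <- o] [seq nraw g | g <- e] [seq nraw g | g <- f].
by split=> //; rewrite eqxx !okp_all.
Qed.

Lemma const_size (s : seq (gatom ar)) g c : g \in s -> c \in tval (tagged g) ->
  size c < size (enc_gatoms s).
Proof.
move=> hg hc; have h1 := enc_seq_size (@enc_gatom _ ar) hg; apply: leq_ltn_trans h1.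
have h2 := enc_seq_size enc_word hc.
have h3 : size c <= size (enc_word c) by rewrite size_enc_word -addnn; apply: leqW; exact: leq_addr.
apply: leq_trans h3 (leq_trans (ltnW h2) _); rewrite /enc_gatom size_cat /=.
by apply: leq_trans (leq_addl _ _); exact: leqnSn.
Qed.

Lemma new_const_fresh (b o e f : seq (gatom ar))
  (w := enc_gatoms b ++ enc_gatoms o ++ enc_gatoms e ++ enc_gatoms f) :
  fresh (R `|` facts (Defs.set_of b))%fset (Defs.set_of o) (Defs.set_of e) (new_const w).
Proof.
have big g : [|| g \in b, g \in o | g \in e] -> new_const w \notin tval (tagged g).
  move=> hg; apply/negP => hc; suff : size (new_const w) < size w by rewrite size_nseq; lia.
  have hw : size w = size (enc_gatoms b) + (size (enc_gatoms o) +
      (size (enc_gatoms e) + size (enc_gatoms f))) by rewrite /w !size_cat.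
  by case/or3P: hg => hg; apply: (leq_trans (const_size hg hc)); rewrite hw; lia.
split=> [g | r].
  by rewrite in_fsetU !in_set_of => hg; apply: big; case/orP: hg => ->; rewrite ?orbT.
rewrite in_fsetU => hr t ht; apply/negP => hx; have hc := rule_constsP ht hx.
case/orP: hr => [hr | /in_facts [a]].
  have hin : new_const w \in Rconsts R.
    by apply/flattenP; exists (rule_consts r) => //; apply: map_f.
  have := @leq_bigmax_seq _ _ xpredT (fun c : const => size c) _ hin isT.
  by apply/negP; rewrite -ltnNge size_nseq -addSnnS; exact: leq_addl.
rewrite in_set_of => ha er; rewrite er in hc.
by have := big a; rewrite ha (fact_const hc) => /(_ isT).
Qed.

Definition occ_enc (o : occ ar) : natom := (rk (tag o.1), nseq o.2 true :: tval (tagged o.1)).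

Lemma occ_enc_inj : injective occ_enc.
Proof.
move=> [g k] [g' k'] [e1 e2 e3].
have -> : k = k' by have := congr1 size e2; rewrite !size_nseq.
by congr (_, _); apply: nraw_inj; rewrite /nraw; congr (_, _).
Qed.

Lemma rep_replace (e : seq (gatom ar)) (C : {fset occ ar}) Cs xi :
  (forall g k, g \in e -> k < ar (tag g) -> ((g, k) \in C) = (occ_enc (g, k) \in Cs)) ->
  [seq rep Cs xi a | a <- [seq nraw g | g <- e]] = [seq nraw g | g <- [seq replace_atom C xi g | g <- e]].
Proof.
move=> hC; rewrite -!map_comp; apply/eq_in_map => g hg.
rewrite /= /rep [RHS]/nraw replace_raw; congr (_, _).
apply/eq_in_map => -[k d] hk /=; rewrite hC //.
have := map_f fst hk; rewrite -/unzip1 unzip1_zip ?size_iota // mem_iota /=.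
by rewrite size_tuple.
Qed.

Lemma set_of_replace (e : seq (gatom ar)) (C : {fset occ ar}) xi :
  Defs.set_of [seq replace_atom C xi g | g <- e] = replace (Defs.set_of e) C xi.
Proof.
apply/fsetP => a; rewrite in_set_of; apply/mapP/imfsetP => -[g /= hg ->]; exists g => //.
  by rewrite /= in_set_of.
by rewrite in_set_of in hg.
Qed.

Theorem recognition_NP : NPform (compl (constrained_recognition A R)).
Proof.
exists verify; first exact: pt_verify.
split.
  move=> w y hv [b [o [e [f [ew hb ho [he hf] [hex hdeg]]]]]].
  have [hw [e0 e1 e2 e3]] := wf4_enc hb ho he hf; rewrite -ew in hw e0 e1 e2 e3.
  move: hv; rewrite /verify /= hw e0 e1 e2 e3.
  have -> : explains A R [seq nraw g | g <- b] [seq nraw g | g <- o] [seq nraw g | g <- e] [seq nraw g | g <- f].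
    exact/(explainsP hR).
  rewrite /=; set Cs := in_ 0 y => /andP [/andP [Cs0 /allP hCs] hE].
  pose C : {fset occ ar} := [fset x in [seq (g, k) | g <- e, k <- iota 0 (\max_p ar p)] |
     occ_enc x \in Cs]%fset.
  have hC g k : g \in e -> k < ar (tag g) -> ((g, k) \in C) = (occ_enc (g, k) \in Cs).
    move=> hg hk; rewrite !inE andbC; case hin : (_ \in Cs) => //=.
    apply/allpairsP; exists (g, k); split=> //=; rewrite mem_iota /=.
    by apply: leq_trans hk _; exact: (leq_bigmax (tag g)).
  move: hE; rewrite (rep_replace _ hC) => /(explainsP hR); rewrite set_of_replace.
  have hf2 : fresh (R `|` facts (Defs.set_of b))%fset (Defs.set_of o) (Defs.set_of e) (new_const w).
    by rewrite ew; exact: new_const_fresh.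
  have /is_degree0 hno := hdeg _ hf2; apply: (hno (cst (head (0, [::]) Cs))).
  have dec t : t \in Cs -> exists g k, [/\ t = occ_enc (g, k), g \in e, k < ar (tag g) &
      nth [::] (tagged g) k = cst (head (0, [::]) Cs)].
    move=> /hCs /and5P [t0 /eqP tk te tl /eqP <-].
    move: te => /mapP [g hg [eg1 eg2]]; exists g, (size (head [::] t.2)); split=> //.
    - rewrite /occ_enc /= -tk -eg2 /rk -eg1.
      by case: (t) t0 => t1 [|x l].
    - by rewrite eg2 size_tuple in tl.
    - by rewrite /cst eg2 head_drop.
  split.
    have ht : head (0, [::]) Cs \in Cs by case: (Cs) Cs0 => // t s _; exact: mem_head.
    have [g [k [et hg hk _]]] := dec _ ht.
    by apply/fset0Pn; exists (g, k); rewrite hC // -et.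
  move=> [g k] hgk; move: (hgk); rewrite !inE => /andP [/allpairsP [[g' k'] /= [hg _ [eg ek]]] hin].
  subst g' k'; have [g' [k' [/occ_enc_inj [eg ek] _ hk hn]]] := dec _ hin; subst g' k'.
  by rewrite /occurs_at /= in_set_of hg /= (some_onth [::]) ?size_tuple // hn.
have hall : ptime (fun w => enc_seq enc_raw (allocc (in_ 2 w))).
  apply: pt_enc_seq; first exact: pt_enc_raw.
  apply: pt_allpairs; [ | exact: pt_in | by apply: pt_iota0; apply: pt_nsize; pts].
  by pts; apply: pt_nseq; pts.
have [k hk] := pt_size_raw hall; exists k => w hn.
case hw : (wf4 w); last by exists [::]; rewrite // /verify /= hw.
have [b [o [e [f [ew hb ho [he hf] [e0 e1 e2 e3]]]]]] := wf4P hw.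
case hx : (explains A R [seq nraw g | g <- b] [seq nraw g | g <- o] [seq nraw g | g <- e] [seq nraw g | g <- f]);
  last by exists [::]; rewrite // /verify /= hw e0 e1 e2 e3 hx.
have hex := (explainsP hR _ _ _ _).1 hx.
have fx : fresh (R `|` facts (Defs.set_of b))%fset (Defs.set_of o) (Defs.set_of e) (new_const w).
  by rewrite ew; exact: new_const_fresh.
have [c [C [hr hE]]] : exists c C, replacement (Defs.set_of e) c C /\
    explanation A (R `|` facts (Defs.set_of b))%fset (Defs.set_of o)
      (replace (Defs.set_of e) C (new_const w)) (Defs.set_of f).
  (* If no replacement by [new_const w] succeeded, none by another fresh constant would, and [w]
     would belong to the language. *)
  apply: NNPP => hno; apply: hn; exists b, o, e, f; split=> //; split=> // xi fx'.
  apply/is_degree0 => c C hr hE; apply: hno; exists c, C; split=> //.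
  exact: (explanation_fresh hr fx' fx hE).
pose Cs := [seq t <- allocc [seq nraw g | g <- e] | t \in [seq occ_enc x | x <- enum_fset C]].
have hocc x : x \in C -> [/\ x.1 \in e, x.2 < ar (tag x.1) & nth [::] (tagged x.1) x.2 = c].
  move=> /hr.2 /andP []; rewrite in_set_of => h1 /eqP /(onth_some [::]) [h2 h3].
  by split=> //; rewrite size_tuple in h2.
have hC g k' : g \in e -> k' < ar (tag g) -> ((g, k') \in C) = (occ_enc (g, k') \in Cs).
  move=> hg hk'; rewrite mem_filter (mem_map occ_enc_inj).
  have -> : occ_enc (g, k') \in allocc [seq nraw g | g <- e].
    apply/allpairsPdep; exists (nraw g), k'; split=> //; first exact: map_f.
    by rewrite mem_iota /= size_tuple.
  by rewrite andbT.
have dec t : t \in Cs -> exists2 x, x \in C & t = occ_enc x.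
  by rewrite mem_filter => /andP [/mapP [x hxC ->] _]; exists x.
have hcst t : t \in Cs -> cst t = c.
  move=> /dec [x /hocc [_ _ <-] ->]; by rewrite /cst /= size_nseq head_drop.
have Cs0 : Cs != [::].
  have /fset0Pn [[g k'] hgk] := hr.1; have [h1 h2 _] := hocc _ hgk.
  by move: hgk; rewrite hC //; case: (Cs).
exists (enc_seq enc_raw Cs).
  by apply: leq_trans (enc_seq_filter _ _ _) _; rewrite -e2; exact: hk.
rewrite /verify /= hw in1 e0 e1 e2 e3; apply/orP; right; apply/andP; split.
  rewrite /repok Cs0 /=; have -> : cst (head (0, [::]) Cs) = c.
    by apply: hcst; case: (Cs) Cs0 => // t Cs' _; exact: mem_head.
  apply/allP => t ht; have [x hxC et] := dec t ht; have [h1 h2 h3] := hocc x hxC.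
  apply/and5P; split; rewrite ?hcst // et /= ?size_nseq //.
    by apply/mapP; exists x.1.
  by rewrite size_tuple.
by rewrite (rep_replace _ hC); apply/(explainsP hR); rewrite set_of_replace.
Qed.

Theorem recognition_coNP : coNP (constrained_recognition A R).
Proof. exact: NPform_Sigma1 recognition_NP. Qed.

(** * Existence: guessing an explanation and recognising it *)

Definition wf2 (w : seq bool) : bool :=
  [&& w == enc_seq enc_raw (in_ 0 w) ++ enc_seq enc_raw (in_ 1 w),
      all okA (in_ 0 w) & all okN (in_ 1 w)].

(** Appended to [w], the encoding of a guessed pair gives an input of the recognition problem. A
    malformed [w] might be completed by the certificate to such an input, so it is sent to the empty
    word, which encodes none. *)
Definition glue (z : seq bool) : seq bool :=
  if wf2 (unpair z).1 then (unpair z).1 ++ (unpair z).2 else [::].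

Lemma pt_glue : ptime glue.
Proof.
have h1 : ptime (fun z => (unpair z).1) by apply: pt_fst; exact: pt_unpair.
have h2 : ptime (fun z => (unpair z).2) by apply: pt_snd; exact: pt_unpair.
have he k : ptime (fun w => enc_seq enc_raw (in_ k w)) by apply: pt_enc_seq; [exact: pt_enc_raw | exact: pt_in].
have ho q k : ptime (fun w => all (okp ar q) (in_ k w)).
  by apply: pt_all; [exact: pt_comp pt_snd0 (pt_okp _ _) | exact: pt_in].
have hw : ptime wf2.
  by apply: pt_and; [apply: pt_eq; [pts | apply: pt_cat => //] | apply: pt_and].
by apply: pt_if; [exact: pt_comp h1 hw | apply: pt_cat | exact: pt_const].
Qed.

Theorem existence_Sigma2 : Sigma2P (constrained_existence A R).
Proof.
(* [E] can be listed as a sublist of the Herbrand base over the constants of [B], [O] and [R], and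
   [F] as a sublist of [B], which is part of [w]. *)
pose bnd w := enc_seq enc_raw (univ ar (dom R (in_ 0 w) (in_ 1 w) [::])) ++ w.
have hbnd : ptime bnd.
  apply: pt_cat; last by pts.
  apply: pt_enc_seq; first exact: pt_enc_raw.
  apply: (pt_comp _ (pt_univ ar)).
  apply: (pt_comp (f := fun w => (in_ 0 w, in_ 1 w, [::])) _ (pt_dom R)).
  by apply: pt_pair; [apply: pt_pair; exact: pt_in | exact: pt_const].
have [k hk] := pt_size_raw hbnd.
exists (fun z => constrained_recognition A R (glue z)), (pow_poly k); split.
  exact: NPform_Sigma1 (NPform_preim pt_glue recognition_NP).
move=> w; rewrite pow_polyE; split; last first.
  move=> [y [_]]; rewrite /glue unpairK /=; case: ifP => [/and3P [/eqP ew] | _]; last first.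
    by move=> [[|b0 b] [o [e [f []]]]].
  move=> /all_okp [b0 eb hb0] /all_okp [o0 eo ho0] [b [o [e [f [eq _ _ _ hc]]]]].
  have ew' : w = enc_gatoms b0 ++ enc_gatoms o0 by rewrite !enc_gatomsE eb eo.
  move: eq; rewrite ew' -catA => /enc_gatoms_pf [eb' /enc_gatoms_pf [eo' _]]; subst b o.
  exists b0, o0; split=> //; [exact/abd_all | exact/obs_all |].
  by exists (Defs.set_of e), (Defs.set_of f).
move=> [b [o [ew hb ho [E [F hc]]]]].
have [[hE hF _ hsub _] _] := hc.
have [i0 i1] : in_ 0 w = [seq nraw g | g <- b] /\ in_ 1 w = [seq nraw g | g <- o].
  by rewrite ew !enc_gatomsE; exact: in2.
pose D := dom R (in_ 0 w) (in_ 1 w) [::].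
have hD c : c \in Rconsts R \/ (exists2 g, g \in b ++ o & c \in tval (tagged g)) -> c \in D.
  rewrite inE mem_cat; case=> [-> | [g hg hcg]]; first by rewrite orbT.
  apply/orP; right; apply/orP; right; apply/flattenP; exists (tval (tagged g)) => //.
  by rewrite i0 i1 cats0 -map_cat -map_comp; exact: (map_f (fun g : gatom ar => (nraw g).2) hg).
have hU g : g \in E -> nraw g \in univ ar D.
  move=> hg; rewrite mem_univ; apply/allP => c hcg; apply: hD.
  case: (constrained_consts hc hg hcg) => [[r hr hcr] | [g' hg' hcg']]; last first.
    by right; exists g' => //; rewrite in_set_of in hg'; rewrite mem_cat hg' orbT.
  move: hr; rewrite in_fsetU => /orP [hr | /in_facts [a ha er]].
    by left; apply/flattenP; exists (rule_consts r) => //; apply: map_f.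
  right; exists a; first by rewrite in_set_of in ha; rewrite mem_cat ha.
  by apply: fact_const; rewrite -er.
pose el := [seq x <- univ ar D | x \in [seq nraw g | g <- enum_fset E]].
have [es ees hes] : exists2 es : seq (gatom ar), [seq nraw g | g <- es] = el &
    all (fun g => mem A (tag g)) es.
  apply: all_okp; apply/allP => x; rewrite mem_filter => /andP [/mapP [g hg ->] _].
  by apply/okpP; exists g => //; exact: hE.
have setE : Defs.set_of es = E.
  apply/fsetP => g; rewrite in_set_of -(mem_map (@nraw_inj _ ar)) ees mem_filter.
  rewrite (mem_map (@nraw_inj _ ar)); apply/andP/idP => [[] // | hg].
  by split=> //; exact: hU.
pose fs := [seq g <- b | g \in F].
have setF : Defs.set_of fs = F.
  apply/fsetP => g; rewrite in_set_of mem_filter; apply/andP/idP => [[] // | hg]; split=> //.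
  have /fsubsetP /(_ (fact g)) := hsub; rewrite mem_facts hg => /(_ isT).
  rewrite in_fsetU mem_facts in_set_of => /orP [/hR | //].
  by rewrite /= hF.
exists (enc_gatoms es ++ enc_gatoms fs); split.
  rewrite size_cat; apply: leq_trans (hk w); rewrite /bnd size_cat; apply: leq_add.
    by rewrite enc_gatomsE ees; exact: enc_seq_filter.
  apply: leq_trans (enc_seq_filter _ _ _) _.
  by rewrite [X in _ <= size X]ew size_cat leq_addr.
rewrite /glue unpairK /=.
have -> : wf2 w.
  rewrite /wf2 i0 i1 -!enc_gatomsE -ew eqxx /=; apply/andP; split; apply: okp_all.
    exact/abd_all.
  exact/obs_all.
exists b, o, es, fs; split=> //.
- by rewrite ew -catA.
- by rewrite setE setF.
- by rewrite setE setF.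
Qed.

End Membership.

(** * Completeness for both problems, the gadget program witnessing hardness *)

Theorem theorem5 :
  ((forall (Rel : finType) (ar : Rel -> nat) (A : {set Rel}) (R : program ar),
      no_abducible_head A R -> coNP (constrained_recognition A R)) /\
   (exists (Rel : finType) (ar : Rel -> nat) (A : {set Rel}) (R : program ar),
      no_abducible_head A R /\ complete coNP (constrained_recognition A R))) /\
  ((forall (Rel : finType) (ar : Rel -> nat) (A : {set Rel}) (R : program ar),
      no_abducible_head A R -> Sigma2P (constrained_existence A R)) /\
   (exists (Rel : finType) (ar : Rel -> nat) (A : {set Rel}) (R : program ar),
      no_abducible_head A R /\
      complete Sigma2P (constrained_existence A R))).
Proof.
split; split.
- by move=> Rel ar A R hR; exact: recognition_coNP.
- exists 'I_8, gar, gA, gadget; split; first exact: gadget_no_abducible_head.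
  split; first exact: recognition_coNP gadget_no_abducible_head.
  by move=> L hL; apply: recognition_hard; exact: coNP_normal1.
- by move=> Rel ar A R hR; exact: existence_Sigma2.
- exists 'I_8, gar, gA, gadget; split; first exact: gadget_no_abducible_head.
  split; first exact: existence_Sigma2 gadget_no_abducible_head.
  by move=> L hL; apply: existence_hard; exact: Sigma2_normal2.
Qed.
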